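(* Let $f(u)=u\left(u-\tfrac12\right)(1-u)$ and $g(u,w)=w(1-w)\left(u-\tfrac12\right)$, and consider for $(t,x)\in[0,\infty)\times\mathbb{R}$ the reaction-diffusion system $$\begin{aligned}\partial_t u_1&=\partial_x^2u_1+b_1f(u_1)+c_{12}\,g(u_1,u_2),\\ \partial_t u_2&=\partial_x^2u_2+b_2f(u_2)+c_{12}\,g(u_2,u_1)+c_{23}\,g(u_2,u_3),\\ \partial_t u_3&=\partial_x^2u_3+b_3f(u_3)+c_{23}\,g(u_3,u_2),\end{aligned}$$ with $(b_1,b_2,b_3)=(1,\,0.98,\,0.96)$ fixed. For each of the four choices of signs $(\sigma,\tau)\in\{+,-\}^2$, with coupling parameters $(c_{12},c_{23})=(\sigma\,0.04,\ \tau\,0.02)$, there exists a standing wave (time-independent) solution $\varphi_{\sigma,\tau}:\mathbb{R}\to\mathbb{R}^3$ of this system with $$\lim_{x\to-\infty}\varphi_{\sigma,\tau}(x)=(0,0,0),\qquad \lim_{x\to+\infty}\varphi_{\sigma,\tau}(x)=(1,1,1),$$ and such that, for the linearization of the system about $\varphi_{\sigma,\tau}$: (i) there are exactly $0$ positive eigenvalues in the point spectrum for $\varphi_{-,-}$; (ii) there is exactly $1$ positive eigenvalue in the point spectrum for $\varphi_{+,-}$, and exactly $1$ positive eigenvalue in the point spectrum for $\varphi_{-,+}$; (iii) there are exactly $2$ positive eigenvalues in the point spectrum for $\varphi_{+,+}$.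
   Context: The system has the gradient form $v_t=v_{xx}+\nabla G(v)$, $v=(u_1,u_2,u_3)$, with $$G(u_1,u_2,u_3)=-\tfrac14\sum_{i=1}^3 b_iu_i^2(1-u_i)^2-\tfrac12\sum_{i=1}^2 c_{i,i+1}\,u_i(1-u_i)u_{i+1}(1-u_{i+1}).$$ The point spectrum of a standing wave $\varphi$ means the set of eigenvalues of the linearized operator $\mathcal{L}u=u_{xx}+\nabla^2G(\varphi(x))u$, acting on $L^2(\mathbb{R};\mathbb{R}^3)$ with domain $H^2(\mathbb{R};\mathbb{R}^3)$. This operator is self-adjoint, so its eigenvalues are real. Here $\varphi_{\sigma,\tau}$ denotes the standing wave at the parameters with $c_{12}=\sigma\,0.04$ and $c_{23}=\tau\,0.02$. *)

(* Defs.v *)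
From HB Require Import structures.
From mathcomp Require Import all_boot all_order all_algebra.
From mathcomp Require Import all_classical all_reals all_analysis.

Set Implicit Arguments.
Unset Strict Implicit.
Unset Printing Implicit Defensive.

Import Order.TTheory GRing.Theory Num.Theory.
Import numFieldNormedType.Exports.

Local Open Scope classical_set_scope.
Local Open Scope ring_scope.

Section system.
Context {R : realType}.

Definition col3 (a1 a2 a3 : R) : 'cV[R]_3 := \col_i [:: a1; a2; a3]`_i.

Definition f (u : R) : R := u * (u - 1 / 2) * (1 - u).

Definition g (u w : R) : R := w * (1 - w) * (u - 1 / 2).

(* Coordinates are numbered from 0: [v 0 0], [v 1 0], [v 2 0] are u_1, u_2, u_3,
   and [b i 0] is b_(i+1). *)
Definition reaction (b : 'cV[R]_3) (c12 c23 : R) (v : 'cV[R]_3) : 'cV[R]_3 :=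
  let u1 := v 0 0 in let u2 := v 1 0 in let u3 := v 2 0 in
  col3 (b 0 0 * f u1 + c12 * g u1 u2)
       (b 1 0 * f u2 + c12 * g u2 u1 + c23 * g u2 u3)
       (b 2 0 * f u3 + c23 * g u3 u2).

Definition potential (b : 'cV[R]_3) (c12 c23 : R) (v : 'cV[R]_3) : R :=
  let u1 := v 0 0 in let u2 := v 1 0 in let u3 := v 2 0 in
  - (1 / 4) * \sum_(i < 3) b i 0 * v i 0 ^+ 2 * (1 - v i 0) ^+ 2
  - (1 / 2) * (c12 * u1 * (1 - u1) * u2 * (1 - u2)
               + c23 * u2 * (1 - u2) * u3 * (1 - u3)).

Definition hessian (G : 'cV[R]_3 -> R) (v : 'cV[R]_3) : 'M[R]_3 :=
  \matrix_(i, j) 'D_(delta_mx i 0) ('D_(delta_mx j 0) G) v.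

(* [v t x] solves v_t = v_xx + reaction v classically on [0, oo[ x R. The
   difference quotient in time only uses times t + h >= 0, so that at t = 0 it
   defines the one-sided derivative. *)
Definition solution (b : 'cV[R]_3) (c12 c23 : R) (v : R -> R -> 'cV[R]_3) :=
  forall t x : R, 0 <= t ->
    [/\ derivable (v t) x 1,
        derivable (v t)^`()%classic x 1 &
        h^-1 *: (v (t + h) x - v t x)
          @[h --> within [set h | 0 <= t + h] 0^'] -->
        (v t)^`(2)%classic x
          + reaction b c12 c23 (v t x)].

Definition standing_wave (b : 'cV[R]_3) (c12 c23 : R) (phi : R -> 'cV[R]_3) :=
  solution b c12 c23 (fun=> phi).

End system.

Section point_spectrum.
Context {R : realType}.

Local Notation mu := (@lebesgue_measure R).

Definition square_integrable (u : R -> 'cV[R]_3) :=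
  forall i, (fun x => u x i 0) \in Lfun mu 2%:E.

Definition test_function (psi : R -> R) :=
  (forall (n : nat) (x : R), derivable psi^`(n)%classic x 1) /\
  compact (closure [set x | psi x != 0]).

(* Only used for square integrable, hence locally integrable, u and w, so that
   both integrands are integrable. *)
Definition weak_derivative (u w : R -> 'cV[R]_3) :=
  forall psi : R -> R, test_function psi -> forall i,
    \int[mu]_x (u x i 0 * psi^`()%classic x) = - \int[mu]_x (w x i 0 * psi x).

(* u belongs to H^2(R; R^3) and its second weak derivative is uxx. *)
Definition H2_with (u uxx : R -> 'cV[R]_3) :=
  square_integrable u /\
  exists ux : R -> 'cV[R]_3,
    [/\ square_integrable ux, square_integrable uxx,
        weak_derivative u ux & weak_derivative ux uxx].

(* Functions stand for their classes modulo equality almost everywhere: an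
   eigenfunction must not vanish almost everywhere, and the eigenvalue equation
   is required almost everywhere. *)
Definition point_spectrum (b : 'cV[R]_3) (c12 c23 : R) (phi : R -> 'cV[R]_3)
    : set R :=
  [set lambda | exists u uxx : R -> 'cV[R]_3,
    [/\ H2_with u uxx,
        ~ {ae mu, forall x, u x = 0} &
        {ae mu, forall x,
          uxx x + hessian (potential b c12 c23) (phi x) *m u x
          = lambda *: u x}]].

Definition positive_point_spectrum (b : 'cV[R]_3) (c12 c23 : R)
    (phi : R -> 'cV[R]_3) : set R :=
  point_spectrum b c12 c23 phi `&` [set lambda | 0 < lambda].

End point_spectrum.

Variant sign := Plus | Minus.

Definition signr {R : realType} (s : sign) : R :=
  if s is Plus then 1 else -1.

(* Main.v *)
(* In the variables v = 2 u - 1 the uncoupled equations have the odd kinks v_i = tanh (k_i x), where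
   8 k_i^2 is b_i plus the couplings of component i.  Writing v_i = tanh (k_i x) + w_i, the coupled
   standing wave equation is a contraction for the odd corrections w_i, because the couplings only
   act through the small differences v_i^2 - v_j^2.

   An odd eigenfunction at a positive eigenvalue vanishes, so everything is decided by even ones,
   i.e. by Neumann problems on the half-line.  Upper bound: the quadratic form of the linearization
   is nonnegative on functions vanishing at 0 in the "pinned" components, which are the middle one
   and each outer one with a positive coupling.  Were there as many positive eigenvalues as pinned
   components, some combination of their eigenfunctions and of the translation mode v' would vanish
   at 0 in all of these components and contradict the nonnegativity.

   Lower bound: for 0 <= lam <= 1/50 let W(lam) be the symmetric Dirichlet-to-Neumann matrix of the
   decaying solutions on the half-line; even eigenfunctions correspond to det W(lam) = 0.  At
   lam = 1/50 the matrix is positive definite.  For small lam > 0 it is negative on the plane or line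
   spanned by the outer components with a positive coupling (by trial functions sech^2), and positive
   on a complement containing the translation mode.  When both couplings are positive it is, for
   lam = 65/10000, negative at (1, -1, 0) and positive on the plane a_1 = a_2.  The signs of the
   determinant give one root in the mixed cases and two if both couplings are positive.

   A weak eigenfunction in H^2 is almost everywhere equal to a classical one: testing the weak
   derivative against smoothed indicators of [a, b] and passing to the limit at Lebesgue points a, b
   gives u(b) - u(a) as the integral of the weak derivative. *)
Require Import Defs.
From HB Require Import structures.
From mathcomp Require Import all_boot all_order all_algebra.
From mathcomp Require Import all_classical all_reals all_analysis.
From mathcomp Require Import measurable_realfun ring lra.

Set Implicit Arguments.
Unset Strict Implicit.
Unset Printing Implicit Defensive.

Import Order.TTheory GRing.Theory Num.Theory.
Import numFieldNormedType.Exports.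

Local Open Scope classical_set_scope.
Local Open Scope ring_scope.

(** * Derivatives and primitives of real functions *)

Section calculus.
Context {R : realType}.
Implicit Types (f g F G : R -> R) (x : R).

(** The scalar operator - h'' + pot h has the kernel psi = sech^2, so it is inverted under the
    condition h(0) = 0 only. This costs nothing for the odd corrections, and for the half-line
    problems it leaves the boundary values free. Comparison on the half-line then turns explicit
    supersolutions, polynomials in tanh (k x) times a weight, into contraction constants. As the
    components decay at different rates, the common weight is the slow algebraic [om].

    The restriction lam <= 1/50 is what the supersolution of the Dirichlet problem absorbs; the form
    is already nonnegative at lam = 39/2000, so the two ranges just overlap. The perturbation of the
    scalar operators is O(tau^2). Its sign in an outer component is that of the coupling, which
    decides whether that component has to be pinned.

    The spectral estimates form no integral over the half-line. An integral inequality is a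
    pointwise one up to the derivative of a boundary function, and a limit at infinity is replaced
    by arbitrarily large arguments at which finitely many functions are small. Orthogonality of
    eigenfunctions enters through Wronskians. *)

Lemma derD f g x df dg : is_derive x 1 f df -> is_derive x 1 g dg ->
  is_derive x 1 (fun y => f y + g y) (df + dg).
Proof. by move=> hf hg; apply: is_deriveD. Qed.

Lemma derB f g x df dg : is_derive x 1 f df -> is_derive x 1 g dg ->
  is_derive x 1 (fun y => f y - g y) (df - dg).
Proof. by move=> hf hg; apply: is_deriveB. Qed.

Lemma derN f x df : is_derive x 1 f df -> is_derive x 1 (fun y => - f y) (- df).
Proof. by move=> hf; apply: is_deriveN. Qed.

Lemma derM f g x df dg : is_derive x 1 f df -> is_derive x 1 g dg ->
  is_derive x 1 (fun y => f y * g y) (f x * dg + g x * df).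
Proof. by move=> hf hg; apply: is_deriveM. Qed.

Lemma derX f n x df : is_derive x 1 f df ->
  is_derive x 1 (fun y => f y ^+ n) (n%:R * f x ^+ n.-1 * df).
Proof.
move=> hf; have := is_deriveX n hf; rewrite (_ : f ^+ n = fun y => f y ^+ n).
  by move=> h; apply: is_derive_eq; rewrite /GRing.scale/= mulr_natl.
by apply/funext => y; rewrite fctE.
Qed.

Lemma derC (c : R) x : is_derive x 1 (fun=> c) 0.
Proof. exact: is_derive_cst. Qed.

Lemma derI x : is_derive x 1 (fun y : R => y) 1.
Proof. exact: is_derive_id. Qed.

Lemma derV f x df : f x != 0 -> is_derive x 1 f df ->
  is_derive x 1 (fun y => (f y)^-1) (- df / f x ^+ 2).
Proof.
move=> f0 [hf <-]; split; first exact: derivableV.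
by rewrite deriveV// /GRing.scale/= mulNr mulrC -mulNr.
Qed.

Lemma der_comp f g x df dg : is_derive x 1 g dg -> is_derive (g x) 1 f df ->
  is_derive x 1 (fun y => f (g y)) (df * dg).
Proof.
move=> [hg <-] [hf <-]; have dfg : differentiable (f \o g) x.
  by move/derivable1_diffP : hg hf => hg /derivable1_diffP; exact: differentiable_comp.
split; first by apply/derivable1_diffP.
by rewrite -!derive1E -(derive1_comp hg hf).
Qed.

Lemma contD f g : continuous f -> continuous g -> continuous (fun y => f y + g y).
Proof. by move=> cf cg x; apply: (@continuousD _ _ _ f g); [exact: cf|exact: cg]. Qed.

Lemma contB f g : continuous f -> continuous g -> continuous (fun y => f y - g y).
Proof. by move=> cf cg x; apply: (@continuousB _ _ _ f g); [exact: cf|exact: cg]. Qed.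

Lemma contN f : continuous f -> continuous (fun y => - f y).
Proof. by move=> cf x; apply: (@continuousN _ _ _ f); exact: cf. Qed.

Lemma contM f g : continuous f -> continuous g -> continuous (fun y => f y * g y).
Proof. by move=> cf cg x; apply: (@continuousM _ _ f g); [exact: cf|exact: cg]. Qed.

Lemma contC (c : R) : continuous (fun _ : R => c).
Proof. exact: cst_continuous. Qed.

Lemma contI : continuous (fun x : R => x).
Proof. by move=> x; exact: cvg_id. Qed.

Lemma cont_comp f g : continuous f -> continuous g -> continuous (fun y => f (g y)).
Proof. by move=> cf cg x; apply: (@continuous_comp _ _ _ g f); [exact: cg|exact: cf]. Qed.

Lemma contX f n : continuous f -> continuous (fun y => f y ^+ n).
Proof.
move=> cf; elim: n => [|n IH]; first exact: contC.
rewrite (_ : (fun y => f y ^+ n.+1) = fun y => f y * f y ^+ n).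
  exact: contM.
by apply/funext => y; rewrite exprS.
Qed.

Lemma cont_sum n (F : 'I_n -> R -> R) : (forall i, continuous (F i)) ->
  continuous (fun x => \sum_(i < n) F i x).
Proof.
elim: n F => [|n IH] F cF.
  rewrite (_ : (fun x => _) = fun=> 0); first exact: contC.
  by apply/funext => x; rewrite big_ord0.
rewrite (_ : (fun x => _) =
    fun x => \sum_(i < n) F (widen_ord (leqnSn n) i) x + F ord_max x).
  by apply: contD; [apply: IH => i; exact: cF|exact: cF].
by apply/funext => x; rewrite big_ord_recr.
Qed.

End calculus.

Ltac cont :=
  cbv beta;
  lazymatch goal with
  | |- continuous (fun _ => ?c) => exact: contC
  | |- continuous (fun y => y) => exact: contI
  | |- continuous (fun y => @?f y + - (@?g y)) => apply: (@contB _ f g); cont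
  | |- continuous (fun y => @?f y + @?g y) => apply: (@contD _ f g); cont
  | |- continuous (fun y => - @?f y) => apply: (@contN _ f); cont
  | |- continuous (fun y => @?f y * @?g y) => apply: (@contM _ f g); cont
  | |- continuous (fun y => @?f y ^+ ?n) => apply: (@contX _ f n); cont
  | |- continuous (fun y => \sum_(i < _) _) => apply: cont_sum => ?; cont
  | |- continuous _ => try assumption
  | _ => idtac
  end.

Create HintDb der.

Ltac der_step :=
  lazymatch goal with
  | |- is_derive _ _ (fun _ => ?c) _ => eapply derC
  | |- is_derive _ _ (fun y => y) _ => eapply derI
  | |- is_derive _ _ (fun y => @?f y + - (@?g y)) _ => eapply (@derB _ f g)
  | |- is_derive _ _ (fun y => @?f y + @?g y) _ => eapply (@derD _ f g)
  | |- is_derive _ _ (fun y => - @?f y) _ => eapply (@derN _ f)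
  | |- is_derive _ _ (fun y => @?f y * @?g y) _ => eapply (@derM _ f g)
  | |- is_derive _ _ (fun y => @?f y ^+ _) _ => eapply (@derX _ f)
  | |- is_derive _ _ (fun y => (@?f y)^-1) _ => eapply (@derV _ f)
  | _ => idtac
  end.
Ltac der_leaf := solve [match goal with H : context [@is_derive] |- _ => eapply H end | eauto 2 with der nocore].
Ltac der_rec :=
  cbv beta;
  lazymatch goal with
  | |- is_derive _ _ _ _ => first [der_leaf | (progress der_step); der_rec | idtac]
  | _ => idtac
  end.
Ltac der := eapply is_derive_eq; [der_rec | cbv beta ].

Section calculus2.
Context {R : realType}.
Implicit Types (f g F G : R -> R) (x : R).

Lemma der_continuous F x d : is_derive x 1 F d -> {for x, continuous F}.
Proof. by move=> [h _]; apply/differentiable_continuous/derivable1_diffP. Qed.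

Lemma der_nondecreasing F f a b : (forall x, a <= x <= b -> is_derive x 1 F (f x)) ->
  (forall x, a <= x <= b -> 0 <= f x) -> a <= b -> F a <= F b.
Proof.
move=> dF f0 ab; apply: (@ger0_derive1_le_cc _ F a b) => //.
- move=> x; rewrite in_itv/= => /andP[/ltW ax /ltW xb].
  have h : a <= x <= b by rewrite ax xb.
  by have [] := dF x h.
- move=> x; rewrite in_itv/= => /andP[/ltW ax /ltW xb].
  have h : a <= x <= b by rewrite ax xb.
  by have [_] := dF x h; rewrite derive1E => ->; exact: f0.
- apply: derivable_within_continuous => x; rewrite in_itv/= => h.
  by have [] := dF x h.
- by rewrite in_itv/= lexx.
- by rewrite in_itv/= lexx ab.
Qed.

Lemma der_le F G f g a b : a <= b -> F a <= G a ->
  (forall x, a <= x <= b -> is_derive x 1 F (f x)) ->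
  (forall x, a <= x <= b -> is_derive x 1 G (g x)) ->
  (forall x, a <= x <= b -> f x <= g x) -> F b <= G b.
Proof.
move=> ab Fa dF dG fg.
have : G a - F a <= G b - F b.
  apply: (@der_nondecreasing (fun x => G x - F x) (fun x => g x - f x)) => //.
    by move=> x h; apply: derB; [exact: dG|exact: dF].
  by move=> x h; rewrite subr_ge0 fg.
lra.
Qed.

Lemma der_eq0 F a b : (forall x, is_derive x 1 F 0) -> F a = F b.
Proof.
move=> dF; wlog ab : a b / a <= b.
  by move=> h; have [/h//|/ltW/h ->] := leP a b.
apply/eqP; rewrite eq_le; apply/andP; split.
  exact: (@der_nondecreasing F (fun=> 0)).
rewrite -lerN2; apply: (@der_nondecreasing (fun x => - F x) (fun=> 0)) => // x _.
by rewrite -oppr0; exact: derN.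
Qed.

Local Notation mu := (@lebesgue_measure R).

(** The integrals from - (n + 1) differ from one another by constants. Normalized to vanish at 0
    they agree wherever they are defined, so at each point any n with - (n + 1) < x may be used. *)
Lemma primitive_exists f : continuous f ->
  exists F, F 0 = 0 /\ forall x, is_derive x 1 F (f x).
Proof.
move=> cf.
have intf a b : mu.-integrable `[a, b] (EFin \o f).
  apply: continuous_compact_integrable; first exact: segment_compact.
  exact: continuous_subspaceT.
pose a n : R := - n.+1%:R.
pose P n x : R := \int[mu]_(t in `[a n, x]) f t.
have dP n x : a n < x -> is_derive x 1 (P n) (f x).
  move=> nx; have [] := @continuous_FTC1_closed _ f (a n) x (x + 1).
  - by rewrite ltrDl.
  - exact: intf.
  - exact: nx.
  - exact: cf.
  by move=> h1 h2; split; [exact: h1|rewrite -derive1E; exact: h2].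
have H n m x y : a n < x -> a m < x -> x <= y -> P m x - P n x = P m y - P n y.
  move=> nx mx xy.
  have d z : x <= z <= y -> is_derive z 1 (fun y => P m y - P n y) 0.
    move=> /andP[xz _]; rewrite -(subrr (f z)).
    by apply: derB; apply: dP; [exact: lt_le_trans xz|exact: lt_le_trans xz].
  apply/eqP; rewrite eq_le; apply/andP; split.
    exact: (@der_nondecreasing (fun y => P m y - P n y) (fun=> 0)).
  rewrite -lerN2.
  apply: (@der_nondecreasing (fun y => - (P m y - P n y)) (fun=> 0)) => // z h.
  by rewrite -oppr0; apply/derN/d.
have a0 n : a n < 0 by rewrite oppr_lt0.
have H0 n m x : a n < x -> a m < x -> P m x - P m 0 = P n x - P n 0.
  move=> nx mx; have [x0|/ltW x0] := leP x 0.
    have := H n m x 0 nx mx x0; lra.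
  have := H n m 0 x (a0 _) (a0 _) x0; lra.
have aN x : exists n, a n < x.
  exists (Num.truncn `|x|); have := @truncnS_gt R `|x|.
  rewrite /a ltrNl; apply: le_lt_trans; rewrite -normrN; exact: ler_norm.
pose N x := xget 0%N [set n | a n < x].
have NP x : a (N x) < x by apply: (xgetPex 0%N (aN x)).
pose F x := P (N x) x - P (N x) 0.
exists F; split; first by rewrite /F subrr.
move=> x; apply: (@near_eq_is_derive _ _ _ (fun y => P (N x) y - P (N x) 0)).
- near=> y; rewrite /F; apply: H0 => //.
  by near: y; apply: lt_nbhsr.
- by rewrite -[f x]subr0; exact: (derB (dP _ _ (NP x)) (derC _ _)).
Unshelve. all: by end_near. Qed.

End calculus2.

(** * Hyperbolic functions *)

HB.lock Definition ch {R : realType} (x : R) : R := (expR x + expR (- x)) / 2.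
HB.lock Definition sh {R : realType} (x : R) : R := (expR x - expR (- x)) / 2.
HB.lock Definition th {R : realType} (x : R) : R := sh x / ch x.

Section tanh.
Context {R : realType}.
Implicit Types x y a b : R.

Lemma der_expR x : is_derive x 1 (@expR R) (expR x).
Proof. exact: is_derive_expR. Qed.

Lemma der_expRN x : is_derive x 1 (fun y => expR (- y)) (- expR (- x)).
Proof.
by rewrite -mulrN1; apply: (der_comp (derN (derI x))); exact: der_expR.
Qed.

Local Hint Resolve der_expR der_expRN : der.

Lemma der_ch x : is_derive x 1 ch (sh x).
Proof.
rewrite ch.unlock; der.
by rewrite sh.unlock; field.
Qed.

Lemma der_sh x : is_derive x 1 sh (ch x).
Proof.
rewrite sh.unlock; der.
by rewrite ch.unlock; field.
Qed.

Local Hint Resolve der_ch der_sh : der.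

Lemma chsh x : ch x ^+ 2 = 1 + sh x ^+ 2.
Proof.
rewrite ch.unlock sh.unlock; have := expRxMexpNx_1 x; move: (expR x) (expR (- x)) => u v uv.
apply/eqP; rewrite -subr_eq0; apply/eqP; transitivity (u * v - 1); first by field.
by rewrite uv subrr.
Qed.

Lemma ch_gt0 x : 0 < ch x.
Proof. by rewrite ch.unlock divr_gt0// addr_gt0// expR_gt0. Qed.

Lemma ch_ge1 x : 1 <= ch x.
Proof.
have := chsh x; have := sqr_ge0 (sh x); have := ch_gt0 x; nra.
Qed.

Lemma sh0 : sh 0 = 0 :> R. Proof. by rewrite sh.unlock oppr0 subrr mul0r. Qed.
Lemma ch0 : ch 0 = 1 :> R. Proof. by rewrite ch.unlock oppr0 expR0; field. Qed.

Lemma sh_ge x : 0 <= x -> x <= sh x.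
Proof.
move=> x0; apply: (@der_le _ (fun y => y) sh (fun=> 1) ch 0 x) => //.
- by rewrite sh0.
- by move=> y _; exact: der_sh.
- by move=> y _; exact: ch_ge1.
Qed.

Lemma ch_ge x : 0 <= x -> 1 + x ^+ 2 / 2 <= ch x.
Proof.
move=> x0; apply: (@der_le _ (fun y => 1 + y ^+ 2 / 2) ch (fun y => y) sh 0 x) => //.
- by rewrite ch0 expr2 !mul0r addr0.
- by move=> y _; der; field.
- by move=> y _; exact: der_ch.
- by move=> y /andP[y0 _]; exact: sh_ge.
Qed.

Lemma one_sub_th2 x : 1 - th x ^+ 2 = (ch x ^+ 2)^-1.
Proof.
rewrite th.unlock; have h := chsh x; have c := ch_gt0 x; have c0 : ch x != 0 by rewrite gt_eqF.
have -> : (sh x / ch x) ^+ 2 = sh x ^+ 2 / ch x ^+ 2 by field.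
have -> : sh x ^+ 2 = ch x ^+ 2 - 1 by rewrite h; ring.
by field.
Qed.

Lemma der_th x : is_derive x 1 th (1 - th x ^+ 2).
Proof.
have c0 : ch x != 0 by rewrite gt_eqF// ch_gt0.
rewrite th.unlock; der; first exact: c0.
by field.
Qed.

Local Hint Resolve der_th : der.

Lemma th0 : th 0 = 0 :> R. Proof. by rewrite th.unlock sh0 mul0r. Qed.

Lemma thN x : th (- x) = - th x.
Proof.
have e1 : sh (- x) = - sh x by rewrite sh.unlock opprK; field.
have e2 : ch (- x) = ch x by rewrite ch.unlock opprK addrC.
by rewrite th.unlock e1 e2 mulNr.
Qed.

Lemma th2_lt1 x : th x ^+ 2 < 1.
Proof. by rewrite -subr_gt0 one_sub_th2 invr_gt0 exprn_gt0// ch_gt0. Qed.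

Lemma th_lt1 x : th x < 1.
Proof. have := th2_lt1 x; nra. Qed.

Lemma th_le x y : x <= y -> th x <= th y.
Proof.
move=> xy; apply: (@der_nondecreasing _ th (fun x => 1 - th x ^+ 2)) => // z _.
  exact: der_th.
by rewrite subr_ge0 ltW// th2_lt1.
Qed.

Lemma th_ge0 x : 0 <= x -> 0 <= th x.
Proof. by move=> x0; rewrite -th0 th_le. Qed.

(** Concavity of tanh on the half-line: the graph lies below the tangent at a. *)
Lemma th_sub_le a b : 0 <= a -> a <= b -> th b - th a <= (b - a) * (1 - th a ^+ 2).
Proof.
move=> a0 ab.
apply: (@der_le _ (fun x => th x - th a) (fun x => (x - a) * (1 - th a ^+ 2))
   (fun x => 1 - th x ^+ 2) (fun=> 1 - th a ^+ 2) a b) => //.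
- by rewrite !subrr mul0r.
- by move=> x _; der; ring.
- by move=> x _; der; ring.
- move=> x /andP[ax _]; have := th_le ax; have := th_ge0 a0; nra.
Qed.

Lemma th_scale c x : 0 <= c <= 1 -> 0 <= x -> c * th x <= th (c * x).
Proof.
move=> /andP[c0 c1] x0.
apply: (@der_le _ (fun x => c * th x) (fun x => th (c * x))
   (fun x => c * (1 - th x ^+ 2)) (fun x => (1 - th (c * x) ^+ 2) * c) 0 x) => //.
- by rewrite mulr0 th0 mulr0.
- by move=> y _; der; ring.
- by move=> y _; apply: (@der_comp _ th (fun y => c * y)); [der; ring|exact: der_th].
- move=> y /andP[y0 _].
  have h1 : th (c * y) <= th y by rewrite th_le// ler_piMl.
  have h2 : 0 <= th (c * y) by rewrite th_ge0// mulr_ge0.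
  rewrite [leRHS]mulrC ler_wpM2l// lerD2l lerN2 lerXn2r ?nnegrE//.
  exact: le_trans h1.
Qed.

(** From cosh x >= 1 + x^2 / 2. This algebraic decay is all that is ever used of sech^2. *)
Lemma sech2_le x : 0 <= x -> (1 - th x ^+ 2) * (1 + x ^+ 2 / 2) ^+ 2 <= 1.
Proof.
move=> x0; rewrite one_sub_th2 mulrC ler_pdivrMr ?mul1r ?exprn_gt0 ?ch_gt0//.
by rewrite lerXn2r ?nnegrE ?ch_ge ?(ltW (ch_gt0 _))// addr_ge0// divr_ge0// sqr_ge0.
Qed.

End tanh.

(** * The linearized scalar kink *)

#[export] Hint Resolve der_th : der.

Section kink.
Context {R : realType}.
Implicit Types (k x : R) (h F S : R -> R).

Definition vanishing (u : R -> R) :=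
  forall e, 0 < e -> exists X, forall x, X <= x -> `|u x| <= e.

Lemma vanishing_le (u v : R -> R) X0 : (forall x, X0 <= x -> `|u x| <= v x) ->
  vanishing v -> vanishing u.
Proof.
move=> uv vv e e0; have [X hX] := vv _ e0; exists (Num.max X X0) => x.
rewrite ge_max => /andP[hx h0]; apply: le_trans (uv _ h0) _.
by apply: le_trans (ler_norm _) _; exact: hX.
Qed.

Lemma vanishingD (u v : R -> R) : vanishing u -> vanishing v -> vanishing (fun x => u x + v x).
Proof.
move=> hu hv e e0; have e2 : 0 < e / 2 by lra.
have [X hX] := hu _ e2; have [Y hY] := hv _ e2; exists (Num.max X Y) => x.
rewrite ge_max => /andP[hx hy]; have := hX _ hx; have := hY _ hy.
have := ler_normD (u x) (v x); lra.
Qed.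

Lemma vanishingM (u v : R -> R) C X0 : vanishing u -> (forall x, X0 <= x -> `|v x| <= C) ->
  vanishing (fun x => u x * v x).
Proof.
move=> hu hv e e0; have C0 : 0 <= C by apply: le_trans (hv X0 (lexx _)).
have [X hX] := hu (e / (C + 1)) (divr_gt0 e0 (ltr_wpDl C0 ltr01)).
exists (Num.max X X0) => x; rewrite ge_max => /andP[hx h0].
rewrite normrM; have h1 := hX _ hx; have h2 := hv _ h0.
apply: le_trans (ler_pM _ _ h1 h2) _ => //.
rewrite mulrAC ler_pdivrMr ?ltr_wpDl//; nra.
Qed.

Lemma vanishing_cst (c : R) : vanishing (fun=> c) -> c = 0.
Proof.
move=> h; apply/eqP/negPn/negP => c0; have c1 : 0 < `|c| by rewrite normr_gt0.
have [|X hX] := h (`|c| / 2); first by rewrite divr_gt0.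
have := hX X (lexx X); lra.
Qed.

Definition tk k x : R := th (k * x).
Definition psi k x : R := 1 - tk k x ^+ 2.
(** Linearizing the scalar equation at the kink tanh (k x) gives - h'' + pot h, and psi'' = pot
    psi. *)
Definition pot k x : R := k ^+ 2 * (6 * tk k x ^+ 2 - 2).

Lemma der_tk k x : is_derive x 1 (tk k) (k * (1 - tk k x ^+ 2)).
Proof.
rewrite mulrC; apply: (@der_comp _ th (fun y => k * y)); last exact: der_th.
by der; ring.
Qed.
Local Hint Resolve der_tk : der.

Lemma der_psi k x : is_derive x 1 (psi k) (- 2 * k * tk k x * psi k x).
Proof. by rewrite /psi; der; ring. Qed.
Local Hint Resolve der_psi : der.

Lemma psi_gt0 k x : 0 < psi k x.
Proof. by rewrite subr_gt0 th2_lt1. Qed.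

Lemma psi_neq0 k x : psi k x != 0.
Proof. by rewrite gt_eqF// psi_gt0. Qed.

Lemma psi_le1 k x : psi k x <= 1.
Proof. by rewrite gerBl sqr_ge0. Qed.

Lemma tk0 k : tk k 0 = 0. Proof. by rewrite /tk mulr0 th0. Qed.
Lemma psi0 k : psi k 0 = 1. Proof. by rewrite /psi tk0 expr0n subr0. Qed.
Lemma tkN k x : tk k (- x) = - tk k x. Proof. by rewrite /tk mulrN thN. Qed.
Lemma potN k x : pot k (- x) = pot k x. Proof. by rewrite /pot tkN sqrrN. Qed.
Lemma tk_lt1 k x : tk k x < 1. Proof. exact: th_lt1. Qed.
Lemma tk_ge0 k x : 0 <= k -> 0 <= x -> 0 <= tk k x.
Proof. by move=> k0 x0; rewrite th_ge0// mulr_ge0. Qed.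

Lemma continuous_tk k : continuous (tk k).
Proof. by move=> x; exact: der_continuous (der_tk k x). Qed.

Lemma continuous_psi k : continuous (psi k).
Proof. by move=> x; exact: der_continuous (der_psi k x). Qed.

Lemma psi_le k x : 0 <= k -> 0 <= x -> psi k x * (1 + (k * x) ^+ 2 / 2) ^+ 2 <= 1.
Proof. by move=> k0 x0; apply: sech2_le; rewrite mulr_ge0. Qed.

Lemma vanishing_psi k : 0 < k -> vanishing (psi k).
Proof.
move=> k0 e e0; have ke : 0 < k ^+ 2 * e by rewrite mulr_gt0// exprn_gt0.
exists (Num.max 1 (1 / (k ^+ 2 * e))) => x; rewrite ge_max ler_pdivrMr// => /andP[x1 hx].
have x0 : 0 <= x by lra.
rewrite gtr0_norm ?psi_gt0//.
have h := psi_le (ltW k0) x0; have p0 := psi_gt0 k x.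
have h1 : psi k x * (k * x) ^+ 2 <= 1 by have := sqr_ge0 (k * x); nra.
have k2 : 0 < k ^+ 2 by rewrite exprn_gt0.
have h2 : psi k x * (k ^+ 2 * x) <= 1.
  apply: le_trans h1; rewrite exprMn ler_wpM2l ?(ltW p0)// ler_wpM2l ?(ltW k2)//.
  by rewrite expr2 ler_peMl.
rewrite -(ler_pM2r (mulr_gt0 k2 (lt_le_trans ltr01 x1))).
by apply: le_trans h2 _; rewrite mulrCA mulrA mulrC.
Qed.

(** This is psi h' - psi' h, because psi' = - 2 k tk psi. *)
Definition wronsk k h h1 x : R := psi k x * (h1 x + 2 * k * tk k x * h x).

Lemma der_wronsk k h h1 d x : is_derive x 1 h (h1 x) -> is_derive x 1 h1 d ->
  is_derive x 1 (wronsk k h h1) (psi k x * (d - pot k x * h x)).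
Proof. by move=> dh dh1; rewrite /wronsk; der; rewrite /pot /psi; ring. Qed.

Lemma der_div_psi k h h1 x : is_derive x 1 h (h1 x) ->
  is_derive x 1 (fun y => h y / psi k y) (wronsk k h h1 x / psi k x ^+ 2).
Proof.
move=> dh; der; first exact: psi_neq0.
by rewrite /wronsk; field; exact: psi_neq0.
Qed.

Lemma vanishing_wronsk k h h1 C : 0 < k -> (forall x, 0 <= x -> `|h x| <= C) ->
  (forall x, 0 <= x -> `|h1 x| <= C) -> vanishing (wronsk k h h1).
Proof.
move=> k0 hC h1C; apply: (@vanishingM _ _ (C + 2 * k * C) 0); first exact: vanishing_psi.
move=> x x0; apply: le_trans (ler_normD _ _) _; rewrite lerD ?h1C//.
rewrite -mulrA normrM ger0_norm ?(mulr_ge0 _ (ltW k0))//.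
rewrite ler_wpM2l ?(mulr_ge0 _ (ltW k0))// normrM.
rewrite (le_trans _ (hC _ x0))// ler_piMl// ger0_norm ?tk_ge0 ?(ltW k0)//.
exact/ltW/tk_lt1.
Qed.

(** The problem - h'' + pot h = F. A homogeneous solution has constant Wronskian with psi, so the
    decay condition leaves only multiples of psi, and h(0) = 0 removes these. Nothing is required at
    -oo. *)
Definition sol k F h h1 := [/\ h 0 = 0, forall x, is_derive x 1 h (h1 x),
  forall x, is_derive x 1 h1 (pot k x * h x - F x) & vanishing (wronsk k h h1)].

Lemma vanishingN (u : R -> R) : vanishing u -> vanishing (fun x => - u x).
Proof. by move=> hu e e0; have [X hX] := hu _ e0; exists X => x hx; rewrite normrN hX. Qed.

Lemma sol_sub k F G h h1 g g1 : sol k F h h1 -> sol k G g g1 ->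
  sol k (fun x => F x - G x) (fun x => h x - g x) (fun x => h1 x - g1 x).
Proof.
move=> [h0 dh dh1 vh] [g0 dg dg1 vg]; split.
- by rewrite h0 g0 subrr.
- by move=> x; exact: derB.
- by move=> x; der; ring.
- have := vanishingD vh (vanishingN vg); congr vanishing; apply/funext => x.
  by rewrite /wronsk; ring.
Qed.

Lemma sol_zero k h h1 : sol k (fun=> 0) h h1 -> forall x, h x = 0 /\ h1 x = 0.
Proof.
move=> [h0 dh dh1 vh].
have dW x : is_derive x 1 (wronsk k h h1) 0.
  by apply: (is_derive_eq (der_wronsk _ (dh x) (dh1 x))); rewrite subr0 subrr mulr0.
have W0 x : wronsk k h h1 x = 0.
  apply: vanishing_cst => e e0; have [X hX] := vh e e0; exists X => y hy.
  by rewrite (@der_eq0 _ _ x y dW); exact: hX.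
have h_0 x : h x = 0.
  have dq (y : R) : is_derive y 1 (fun y => h y / psi k y) 0.
    by apply: (is_derive_eq (der_div_psi k (dh y))); rewrite W0 mul0r.
  have := @der_eq0 _ _ 0 x dq; rewrite h0 mul0r => /esym/eqP.
  by rewrite mulf_eq0 invr_eq0 (negbTE (psi_neq0 _ _)) orbF => /eqP.
move=> x; split => //; have := W0 x; rewrite /wronsk h_0 mulr0 addr0 => /eqP.
by rewrite mulf_eq0 (negbTE (psi_neq0 _ _)) => /eqP.
Qed.

Lemma sol_unique k F h h1 g g1 : sol k F h h1 -> sol k F g g1 ->
  forall x, h x = g x /\ h1 x = g1 x.
Proof.
move=> sh sg x; have := sol_sub sh sg.
rewrite (_ : (fun x => F x - F x) = fun=> 0); last by apply/funext => y; rewrite subrr.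
by move=> /sol_zero/(_ x) [/eqP + /eqP]; rewrite !subr_eq0 => /eqP -> /eqP ->.
Qed.

(** The function h(x) + h(-x) solves the homogeneous equation and vanishes at 0 together with its
    derivative. Its Wronskian is therefore 0 everywhere, without any condition at -oo. *)
Lemma sol_odd k F h h1 : (forall x, F (- x) = - F x) -> sol k F h h1 ->
  forall x, h (- x) = - h x.
Proof.
move=> oF [h0 dh dh1 _] x.
pose d x := h x + h (- x); pose d1 x := h1 x - h1 (- x).
have dN (u : R -> R) (y c : R) : is_derive (- y) 1 u c -> is_derive y 1 (fun z => u (- z)) (- c).
  by move=> du; rewrite -mulrN1; apply: (der_comp (derN (derI y))).
have dd (y : R) : is_derive y 1 d (d1 y) by apply: derD (dh y) (dN _ _ _ (dh (- y))).
have dd1 (y : R) : is_derive y 1 d1 (pot k y * d y).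
  apply: (is_derive_eq (derB (dh1 y) (dN _ _ _ (dh1 (- y))))).
  by rewrite /d oF potN; ring.
have dW (y : R) : is_derive y 1 (wronsk k d d1) 0.
  by apply: (is_derive_eq (der_wronsk _ (dd y) (dd1 y))); rewrite subrr mulr0.
have W0 y : wronsk k d d1 y = 0.
  rewrite (@der_eq0 _ _ y 0 dW) /wronsk /d /d1 oppr0 h0; ring.
have dq (y : R) : is_derive y 1 (fun y => d y / psi k y) 0.
  by apply: (is_derive_eq (der_div_psi k (dd y))); rewrite W0 mul0r.
have := @der_eq0 _ _ 0 x dq; rewrite {1}/d oppr0 h0 addr0 mul0r => /esym/eqP.
rewrite mulf_eq0 invr_eq0 (negbTE (psi_neq0 _ _)) orbF /d addrC addr_eq0.
by move=> /eqP.
Qed.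

(** A candidate supersolution on the half-line. If |F| <= pot S - S'', it bounds both the solution h
    and the Wronskian of h. *)
Definition majorant k S S1 S2 := [/\ S 0 = 0,
  forall x, 0 <= x -> is_derive x 1 S (S1 x), forall x, 0 <= x -> is_derive x 1 S1 (S2 x) &
  vanishing (wronsk k S S1)].

(* The Wronskian of psi and h has derivative - psi F, so that h is recovered from F
   by two integrations, the inner one starting from +oo. *)
Lemma sol_exists k F S S1 S2 : continuous F -> majorant k S S1 S2 ->
  (forall x, 0 <= x -> `|F x| <= pot k x * S x - S2 x) ->
  exists h h1, sol k F h h1 /\ forall x, 0 <= x ->
    `|h x| <= S x /\ `|wronsk k h h1 x| <= wronsk k S S1 x.
Proof.
move=> cF [S0 dS dS1 vS] FS.
have [P [P0 dP]] : exists P, P 0 = 0 /\ forall x, is_derive x 1 P (psi k x * F x).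
  apply: primitive_exists => x.
  by apply: continuousM; [exact: continuous_psi|exact: cF].
pose K := wronsk k S S1.
have dK (x : R) : 0 <= x -> is_derive x 1 K (psi k x * (S2 x - pot k x * S x)).
  by move=> x0; apply: der_wronsk; [exact: dS|exact: dS1].
have FS1 x : 0 <= x -> F x <= pot k x * S x - S2 x.
  by move=> /FS; apply: le_trans; exact: ler_norm.
have FS2 x : 0 <= x -> - F x <= pot k x * S x - S2 x.
  by move=> /FS; apply: le_trans; rewrite -normrN; exact: ler_norm.
have Kmono a b : 0 <= a -> a <= b -> K b <= K a.
  move=> a0 ab; rewrite -lerN2.
  apply: (@der_nondecreasing _ (fun x => - K x)
    (fun x => psi k x * (pot k x * S x - S2 x)) a b _ _ ab).
    move=> x /andP[ax _]; have x0 := le_trans a0 ax.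
    by apply: (is_derive_eq (derN (dK x x0))); ring.
  move=> x /andP[ax _]; have x0 := le_trans a0 ax.
  by rewrite mulr_ge0 ?(ltW (psi_gt0 _ _))// (le_trans _ (FS x x0)).
have K0 x : 0 <= x -> 0 <= K x.
  move=> x0; rewrite leNgt; apply/negP => Kx.
  have [|X hX] := vS (- K x / 2); first by rewrite divr_gt0// oppr_gt0.
  have h1 := Kmono x (Num.max X x) x0; rewrite le_max lexx orbT in h1.
  have := hX (Num.max X x); rewrite le_max lexx => /(_ isT).
  rewrite -/(K _) ler_norml => /andP[+ _]; have := h1 isT; lra.
have PKm a b : 0 <= a -> a <= b -> P a - K a <= P b - K b.
  move=> a0 ab; apply: (@der_nondecreasing _ (fun x => P x - K x)
    (fun x => psi k x * (F x + (pot k x * S x - S2 x))) a b _ _ ab).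
    move=> x /andP[ax _]; have x0 := le_trans a0 ax.
    by apply: (is_derive_eq (derB (dP x) (dK x x0))); ring.
  move=> x /andP[ax _]; have x0 := le_trans a0 ax.
  by rewrite mulr_ge0 ?(ltW (psi_gt0 _ _))//; have := FS2 x x0; lra.
have PKp a b : 0 <= a -> a <= b -> P b + K b <= P a + K a.
  move=> a0 ab; rewrite -lerN2; apply: (@der_nondecreasing _ (fun x => - (P x + K x))
    (fun x => psi k x * ((pot k x * S x - S2 x) - F x)) a b _ _ ab).
    move=> x /andP[ax _]; have x0 := le_trans a0 ax.
    by apply: (is_derive_eq (derN (derD (dP x) (dK x x0)))); ring.
  move=> x /andP[ax _]; have x0 := le_trans a0 ax.
  by rewrite mulr_ge0 ?(ltW (psi_gt0 _ _))//; have := FS1 x x0; lra.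
have PK a b : 0 <= a -> 0 <= b -> P a - K a <= P b + K b.
  move=> a0 b0; have am : a <= Num.max a b by rewrite le_max lexx.
  have bm : b <= Num.max a b by rewrite le_max lexx orbT.
  have := PKm _ _ a0 am; have := PKp _ _ b0 bm; have := K0 _ (le_trans a0 am); lra.
(* P - K increases and P + K decreases, so this supremum serves as the value of P at +oo, and C - P
   is the Wronskian that decays there. *)
pose A := [set y | exists2 x, 0 <= x & y = P x - K x].
have Asup : has_sup A.
  split; first by exists (P 0 - K 0), 0.
  by exists (P 0 + K 0) => _ [x x0 ->]; exact: PK.
pose C := sup A.
have Clo x : 0 <= x -> P x - K x <= C.
  by move=> x0; apply: ub_le_sup; [exact: Asup.2|exists x].
have Cup x : 0 <= x -> C <= P x + K x.
  by move=> x0; apply: ge_sup; [exact: Asup.1|move=> _ [y y0 ->]; exact: PK].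
pose I x := C - P x.
have IK x : 0 <= x -> `|I x| <= K x.
  by move=> x0; rewrite ler_norml; have := Clo x x0; have := Cup x x0; rewrite /I; lra.
have dI (x : R) : is_derive x 1 I (- (psi k x * F x)) by rewrite /I; der; ring.
have [z [z0 dz]] : exists z, z 0 = 0 /\ forall x, is_derive x 1 z (I x / psi k x ^+ 2).
  apply: primitive_exists => x.
  have := derM (dI x) (derV _ (derX 2 (der_psi k x))).
  by move=> /(_ (expf_neq0 _ (psi_neq0 _ _)))/der_continuous.
(* Variation of constants: h / psi has derivative I / psi^2. *)
pose h x := psi k x * z x; pose h1 x := - 2 * k * tk k x * h x + I x / psi k x.
have dh x : is_derive x 1 h (h1 x).
  by rewrite /h; der; rewrite /h1 /h; field; exact: psi_neq0.
have Wh x : wronsk k h h1 x = I x.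
  by rewrite /wronsk /h1; field; exact: psi_neq0.
have dh1 x : is_derive x 1 h1 (pot k x * h x - F x).
  rewrite /h1; der; first exact: psi_neq0.
  rewrite /h1 /pot; have := psi_neq0 k x; move: (h x) (I x) (F x).
  by rewrite /psi => a b c n0; field.
exists h, h1; split; first split => //.
- by rewrite /h z0 mulr0.
- by apply: (@vanishing_le _ _ 0 _ vS) => x x0; rewrite Wh; exact: IK.
move=> x x0; rewrite Wh; split; last exact: IK.
have dSq (y : R) : 0 <= y -> is_derive y 1 (fun y => S y / psi k y) (K y / psi k y ^+ 2).
  by move=> y0; exact: der_div_psi (dS y y0).
have hz : `|z x| <= S x / psi k x.
  rewrite ler_norml; apply/andP; split.
    rewrite lerNl; apply: (@der_le _ (fun y => - z y) (fun y => S y / psi k y)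
      (fun y => - (I y / psi k y ^+ 2)) (fun y => K y / psi k y ^+ 2) 0 x x0).
    - by rewrite z0 S0 mul0r oppr0.
    - by move=> y /andP[y0 _]; exact: dSq.
    - move=> y /andP[y0 _]; rewrite -mulNr ler_wpM2r ?invr_ge0 ?sqr_ge0//.
      by rewrite (le_trans _ (IK y y0))// -normrN ler_norm.
  apply: (@der_le _ z (fun y => S y / psi k y)
    (fun y => I y / psi k y ^+ 2) (fun y => K y / psi k y ^+ 2) 0 x x0).
  - by rewrite z0 S0 mul0r.
  - by move=> y /andP[y0 _]; exact: dSq.
  - move=> y /andP[y0 _]; rewrite ler_wpM2r ?invr_ge0 ?sqr_ge0//.
    by rewrite (le_trans _ (IK y y0))// ler_norm.
rewrite /h normrM gtr0_norm ?psi_gt0//.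
by rewrite mulrC -ler_pdivlMr ?psi_gt0.
Qed.

Lemma sol_le k F S S1 S2 h h1 : continuous F -> majorant k S S1 S2 ->
  (forall x, 0 <= x -> `|F x| <= pot k x * S x - S2 x) -> sol k F h h1 ->
  forall x, 0 <= x -> `|h x| <= S x /\ `|wronsk k h h1 x| <= wronsk k S S1 x.
Proof.
move=> cF mS FS sh; have [g [g1 [sg gS]]] := sol_exists cF mS FS.
have /funext eh : h =1 g by move=> x; have [] := sol_unique sh sg x.
have /funext eh1 : h1 =1 g1 by move=> x; have [] := sol_unique sh sg x.
by rewrite eh eh1.
Qed.

End kink.

(** * Weights and majorants *)

#[export] Hint Resolve der_tk der_psi : der.

(** Small enough that the derivatives of the weight [om] cost less than the slack of the two
    supersolutions below. *)
HB.lock Definition al {R : realType} : R := 1 / 100.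

Section majorants.
Context {R : realType}.
Implicit Types (k x a b c e : R).

Lemma al_gt0 : 0 < al :> R.
Proof. by rewrite al.unlock divr_gt0. Qed.

Lemma al_le : al <= 1 / 100 :> R.
Proof. by rewrite al.unlock. Qed.

(* A decay weight common to all components, whose [psi (k i)] decay at different rates. *)
Definition om x : R := (1 + al * x)^-1.

Lemma om_den_gt0 x : 0 <= x -> 0 < 1 + al * x.
Proof. by move=> x0; rewrite ltr_pwDl// mulr_ge0// ltW// al_gt0. Qed.

Lemma om_gt0 x : 0 <= x -> 0 < om x.
Proof. by move=> x0; rewrite invr_gt0 om_den_gt0. Qed.

Lemma om_le1 x : 0 <= x -> om x <= 1.
Proof.
by move=> x0; rewrite invf_le1 ?om_den_gt0// lerDl mulr_ge0// ltW// al_gt0.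
Qed.

Lemma om0 : om 0 = 1.
Proof. by rewrite /om mulr0 addr0 invr1. Qed.

Lemma der_om x : 0 <= x -> is_derive x 1 om (- (al * om x ^+ 2)).
Proof.
move=> x0; have n0 : 1 + al * x != 0 by rewrite gt_eqF// om_den_gt0.
by rewrite /om; der; [exact: n0|field; exact: n0].
Qed.

Lemma vanishing_om : vanishing om.
Proof.
move=> e e0; have ae : 0 < al * e by rewrite mulr_gt0// al_gt0.
exists (1 / (al * e)) => x; rewrite ler_pdivrMr// => hx.
have x0 : 0 <= x by rewrite -(pmulr_lge0 _ ae); lra.
rewrite (ger0_norm (ltW (om_gt0 x0))).
by rewrite /om -[leLHS]mul1r ler_pdivrMr ?om_den_gt0//; lra.
Qed.

(** Ansatz for supersolutions: a cubic in tanh (k x) without constant term, times the weight. [Sq1]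
    and [Sq2] are its two derivatives. *)
Definition Sq k a b c x : R :=
  om x * (a * tk k x + b * tk k x ^+ 2 + c * tk k x ^+ 3).
Definition Sq1 k a b c x : R :=
  om x * (k * (1 - tk k x ^+ 2) * (a + 2 * b * tk k x + 3 * c * tk k x ^+ 2))
  - al * om x ^+ 2 * (a * tk k x + b * tk k x ^+ 2 + c * tk k x ^+ 3).
Definition Sq2 k a b c x : R :=
  let t := tk k x in let q1 := a + 2 * b * t + 3 * c * t ^+ 2 in
  om x * k ^+ 2 * ((1 - t ^+ 2) ^+ 2 * (2 * b + 6 * c * t) - 2 * t * (1 - t ^+ 2) * q1)
  - 2 * al * om x ^+ 2 * k * (1 - t ^+ 2) * q1
  + 2 * al ^+ 2 * om x ^+ 3 * (a * t + b * t ^+ 2 + c * t ^+ 3).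

Lemma der_Sq k a b c x : 0 <= x -> is_derive x 1 (Sq k a b c) (Sq1 k a b c x).
Proof. by move=> x0; have := der_om x0 => ?; rewrite /Sq; der; rewrite /Sq1 ?/psi; ring. Qed.

Lemma der_Sq1 k a b c x : 0 <= x -> is_derive x 1 (Sq1 k a b c) (Sq2 k a b c x).
Proof. by move=> x0; have := der_om x0 => ?; rewrite /Sq1; der; rewrite /Sq2 /psi; ring. Qed.

Lemma poly3_norm_le a b c t : 0 <= t <= 1 -> `|a * t + b * t ^+ 2 + c * t ^+ 3| <= `|a| + `|b| + `|c|.
Proof.
move=> /andP[t0 t1]; have H (y : R) n : `|y * t ^+ n| <= `|y|.
  by rewrite normrM ler_piMr// ger0_norm ?exprn_ge0// exprn_ile1.
apply: le_trans (ler_normD _ _) _; rewrite lerD ?H//.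
apply: le_trans (ler_normD _ _) _; rewrite lerD ?H//.
exact: (H a 1%N).
Qed.

Definition Sq_cst k a b c : R := (`|a| + `|b| + `|c|) + k * (`|a| + `|2 * b| + `|3 * c|).

Lemma Sq_norm_le k a b c x : 0 < k -> 0 <= x ->
  `|Sq k a b c x| <= Sq_cst k a b c * om x /\ `|Sq1 k a b c x| <= Sq_cst k a b c * om x.
Proof.
move=> k0 x0.
have C1 : 0 <= `|a| + `|b| + `|c| by rewrite !addr_ge0.
have C2 : 0 <= k * (`|a| + `|2 * b| + `|3 * c|) by apply: mulr_ge0; [exact: ltW|rewrite !addr_ge0].
have o1 := om_le1 x0; have o0 := om_gt0 x0.
have t0 := tk_ge0 (ltW k0) x0; have /ltW t1 := tk_lt1 k x.
have h1 := poly3_norm_le a b c (t := tk k x); rewrite t0 t1 in h1; have {}h1 := h1 isT.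
split.
  rewrite /Sq normrM (ger0_norm (ltW o0)) mulrC ler_wpM2r ?(ltW o0)//.
  by apply: le_trans h1 _; rewrite lerDl.
have h2 : `|a + 2 * b * tk k x + 3 * c * tk k x ^+ 2| <= `|a| + `|2 * b| + `|3 * c|.
  apply: le_trans (ler_normD _ _) _; apply: lerD.
    apply: le_trans (ler_normD _ _) _; rewrite lerD2l normrM ler_piMr// ger0_norm//.
  by rewrite normrM ler_piMr// ger0_norm ?exprn_ge0// exprn_ile1.
rewrite /Sq1 /Sq_cst; apply: le_trans (ler_normB _ _) _; rewrite [leLHS]addrC [leRHS]mulrDl; apply: lerD.
  have a0 := @al_gt0; have a1 := @al_le.
  have -> : al * om x ^+ 2 * (a * tk k x + b * tk k x ^+ 2 + c * tk k x ^+ 3) =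
    (al * om x) * (a * tk k x + b * tk k x ^+ 2 + c * tk k x ^+ 3) * om x by ring.
  rewrite normrM (ger0_norm (ltW o0)); apply: ler_wpM2r; first exact: ltW.
  rewrite normrM; apply: le_trans h1; apply: ler_piMl => //.
  by rewrite ger0_norm; [nra|apply: mulr_ge0; exact: ltW].
rewrite normrM (ger0_norm (ltW o0)) mulrC; apply: ler_wpM2r; first exact: ltW.
have p0 := psi_gt0 k x; have p1 := psi_le1 k x; rewrite -/(psi k x).
rewrite -mulrA normrM (ger0_norm (ltW k0)); apply: ler_wpM2l; first exact: ltW.
by rewrite normrM (ger0_norm (ltW p0)); apply: le_trans h2; exact: ler_piMl.
Qed.

Lemma majorant_Sq k a b c : 0 < k -> majorant k (Sq k a b c) (Sq1 k a b c) (Sq2 k a b c).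
Proof.
move=> k0; split; first by rewrite /Sq tk0 !expr0n/= !mulr0 !addr0 mulr0.
- exact: der_Sq.
- exact: der_Sq1.
have C0 : 0 <= Sq_cst k a b c.
  by have [+ _] := Sq_norm_le a b c k0 (lexx 0); rewrite om0 mulr1; exact: le_trans.
by apply: (@vanishing_wronsk _ _ _ _ (Sq_cst k a b c) k0) => x x0;
  have [h1 h2] := Sq_norm_le a b c k0 x0; [apply: le_trans h1 _|apply: le_trans h2 _];
  rewrite ler_piMr// om_le1.
Qed.

(** Both Wronskians carry the positive factor psi. Dividing by it turns the comparison of Wronskians
    into decay of the derivative. *)
Lemma wronsk_norm_le k h h1 a b c x : 0 < k -> 0 <= x ->
  `|wronsk k h h1 x| <= wronsk k (Sq k a b c) (Sq1 k a b c) x ->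
  `|h1 x| <= 2 * k * `|h x| + (1 + 2 * k) * Sq_cst k a b c * om x.
Proof.
move=> k0 x0; have t0 := tk_ge0 (ltW k0) x0; have /ltW t1 := tk_lt1 k x.
have p0 := psi_gt0 k x; rewrite /wronsk normrM (gtr0_norm p0) ler_pM2l//.
have [s1 s2] := Sq_norm_le a b c k0 x0; move=> h0.
have -> : h1 x = (h1 x + 2 * k * tk k x * h x) - 2 * k * tk k x * h x by ring.
have n1 (y : R) : `|2 * k * tk k x * y| <= 2 * k * `|y|.
  rewrite -mulrA normrM ger0_norm; last lra.
  apply: ler_wpM2l; first lra.
  by rewrite normrM (ger0_norm t0); exact: ler_piMl.
apply: le_trans (ler_normB _ _) _; rewrite [leLHS]addrC; apply: lerD; first exact: n1.
apply: le_trans h0 _; apply: le_trans (ler_norm _) _; apply: le_trans (ler_normD _ _) _.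
have := n1 (Sq k a b c x); nra.
Qed.

(** All rates that occur satisfy 0.115 <= k^2 <= 0.13; the wider window has simpler ends. *)
Definition kink_rate k := 0 < k /\ 11 / 100 <= k ^+ 2 <= 14 / 100.

(** Without the weight, - q'' + pot q for q = t - t^3 / 3, t = tanh (k x), equals k^2 t (2 - 4/3 t^2
    + 2 t^4), and the bracket has minimum 16/9. The factor 57/100 slightly exceeds 9/16, and the
    surplus pays for the derivatives of [om]. *)
Lemma majorant_odd k e x : kink_rate k -> 0 <= e -> 0 <= x ->
  k ^+ 2 * e * (tk k x * om x) <=
  pot k x * Sq k (57 / 100 * e) 0 (- (19 / 100 * e)) x
  - Sq2 k (57 / 100 * e) 0 (- (19 / 100 * e)) x.
Proof.
move=> [k0 /andP[k1 k2]] e0 x0.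
have o1 := om_le1 x0; have o0 := om_gt0 x0.
have t0 := tk_ge0 (ltW k0) x0; have /ltW t1 := tk_lt1 k x.
rewrite /pot /Sq /Sq2; move: (om x) o0 o1 (tk k x) t0 t1 => o o0 o1 t t0 t1.
rewrite -subr_ge0.
have -> : k ^+ 2 * (6 * t ^+ 2 - 2) * (o * (57 / 100 * e * t + 0 * t ^+ 2 + - (19 / 100 * e) * t ^+ 3))
   - (o * k ^+ 2 * ((1 - t ^+ 2) ^+ 2 * (2 * 0 + 6 * - (19 / 100 * e) * t)
      - 2 * t * (1 - t ^+ 2) * (57 / 100 * e + 2 * 0 * t + 3 * - (19 / 100 * e) * t ^+ 2))
   - 2 * al * o ^+ 2 * k * (1 - t ^+ 2) * (57 / 100 * e + 2 * 0 * t + 3 * - (19 / 100 * e) * t ^+ 2)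
   + 2 * al ^+ 2 * o ^+ 3 * (57 / 100 * e * t + 0 * t ^+ 2 + - (19 / 100 * e) * t ^+ 3))
   - k ^+ 2 * e * (t * o) =
   e * o * (t * (k ^+ 2 * (14 / 100 - 76 / 100 * t ^+ 2 + 114 / 100 * (t ^+ 2) ^+ 2)
     - 2 * al ^+ 2 * o ^+ 2 * (19 / 100) * (3 - t ^+ 2))
     + 2 * al * o * k * (57 / 100) * (1 - t ^+ 2) ^+ 2) by field.
have eo : 0 <= e * o by apply: mulr_ge0; [|exact: ltW].
have ak : 0 <= al * o * k.
  by apply: mulr_ge0; [apply: mulr_ge0; exact: ltW al_gt0 || exact: ltW|exact: ltW].
apply: mulr_ge0; first exact: eo.
apply: addr_ge0; last first.
  apply: mulr_ge0; last exact: sqr_ge0.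
  lra.
apply: mulr_ge0; first exact: t0.
have o2 : o ^+ 2 <= 1 by rewrite exprn_ile1// ltW.
have u0 : 0 <= t ^+ 2 by rewrite sqr_ge0.
have h : 13 / 10 / 100 <= 14 / 100 - 76 / 100 * t ^+ 2 + 114 / 100 * (t ^+ 2) ^+ 2.
  have := sqr_ge0 (t ^+ 2 - 1 / 3); nra.
have h2 : 11 / 100 * (13 / 10 / 100) <= k ^+ 2 * (14 / 100 - 76 / 100 * t ^+ 2 + 114 / 100 * (t ^+ 2) ^+ 2).
  by apply: ler_pM; lra.
have a2 : 0 <= al ^+ 2 :> R by rewrite sqr_ge0.
have a3 : al ^+ 2 <= (1 / 100) ^+ 2 :> R by have := @al_gt0; have := @al_le; nra.
have h3 : o ^+ 2 * (3 - t ^+ 2) <= 1 * 3.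
  have := sqr_ge0 o; have : t ^+ 2 <= 1 by rewrite exprn_ile1.
  by move=> *; apply: ler_pM => //; lra.
have h4 : al ^+ 2 * (o ^+ 2 * (3 - t ^+ 2)) <= (1 / 100) ^+ 2 * (1 * 3).
  have t2 : t ^+ 2 <= 1 by rewrite exprn_ile1.
  by apply: ler_pM; [exact: a2|apply: mulr_ge0; [exact: sqr_ge0|lra]|exact: a3|exact: h3].
lra.
Qed.

(** For q = 3/2 t - 1/2 t^2, equal to 1 at t = 1, the unweighted operator gives k^2 (6 t^3 - 3 t^2 +
    1). Unlike the odd case this is positive at 0, as needed for a forcing that does not vanish
    there. *)
Lemma majorant_even k e x : kink_rate k -> 0 <= e -> 0 <= x ->
  e * om x * (1 / 5 * tk k x ^+ 2 + 1 / 25) <=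
  pot k x * Sq k (3 / 2 * e) (- (1 / 2 * e)) 0 x - Sq2 k (3 / 2 * e) (- (1 / 2 * e)) 0 x.
Proof.
move=> [k0 /andP[k1 k2]] e0 x0.
have o1 := om_le1 x0; have o0 := om_gt0 x0.
have t0 := tk_ge0 (ltW k0) x0; have /ltW t1 := tk_lt1 k x.
rewrite /pot /Sq /Sq2; move: (om x) o0 o1 (tk k x) t0 t1 => o o0 o1 t t0 t1.
rewrite -subr_ge0.
have -> : k ^+ 2 * (6 * t ^+ 2 - 2) * (o * (3 / 2 * e * t + - (1 / 2 * e) * t ^+ 2 + 0 * t ^+ 3)) -
  (o * k ^+ 2 * ((1 - t ^+ 2) ^+ 2 * (2 * - (1 / 2 * e) + 6 * 0 * t) -
    2 * t * (1 - t ^+ 2) * (3 / 2 * e + 2 * - (1 / 2 * e) * t + 3 * 0 * t ^+ 2))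
    - 2 * al * o ^+ 2 * k * (1 - t ^+ 2) * (3 / 2 * e + 2 * - (1 / 2 * e) * t + 3 * 0 * t ^+ 2)
    + 2 * al ^+ 2 * o ^+ 3 * (3 / 2 * e * t + - (1 / 2 * e) * t ^+ 2 + 0 * t ^+ 3))
  - e * o * (1 / 5 * t ^+ 2 + 1 / 25) =
  e * o * (k ^+ 2 * (6 * t ^+ 3 - 3 * t ^+ 2 + 1) - 1 / 5 * t ^+ 2 - 1 / 25
   - 2 * al ^+ 2 * o ^+ 2 * (3 / 2 * t - 1 / 2 * t ^+ 2)
   + 2 * al * o * k * (1 - t ^+ 2) * (3 / 2 - t)) by field.
have u1 : t ^+ 2 <= 1 by rewrite exprn_ile1.
have u0 : 0 <= t ^+ 2 by rewrite sqr_ge0.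
have eo : 0 <= e * o by apply: mulr_ge0; [|exact: ltW].
have ak : 0 <= al * o * k.
  by apply: mulr_ge0; [apply: mulr_ge0; exact: ltW al_gt0 || exact: ltW|exact: ltW].
apply: mulr_ge0; first exact: eo.
apply: addr_ge0; last first.
  apply: mulr_ge0; [apply: mulr_ge0; [lra|lra]|lra].
have o2 : o ^+ 2 <= 1 by rewrite exprn_ile1// ltW.
have h3 : o ^+ 2 * (3 / 2 * t - 1 / 2 * t ^+ 2) <= 1 * 1.
  by apply: ler_pM; rewrite ?sqr_ge0//; nra.
have v0 : 0 <= 6 * t ^+ 3 - 3 * t ^+ 2 + 1.
  have : 0 <= t ^+ 3 by rewrite exprn_ge0.
  nra.
have a2 : 0 <= al ^+ 2 :> R by rewrite sqr_ge0.
have a3 : al ^+ 2 <= (1 / 100) ^+ 2 :> R by have := @al_gt0; have := @al_le; nra.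
have h5 : al ^+ 2 * (o ^+ 2 * (3 / 2 * t - 1 / 2 * t ^+ 2)) <= (1 / 100) ^+ 2 * (1 * 1).
  by apply: ler_pM; [exact: a2|apply: mulr_ge0; [exact: sqr_ge0|nra]|exact: a3|exact: h3].
have h2 : 11 / 100 * (6 * t ^+ 3 - 3 * t ^+ 2 + 1) <= k ^+ 2 * (6 * t ^+ 3 - 3 * t ^+ 2 + 1).
  by rewrite ler_wpM2r.
have h4 : 1 / 5 * t ^+ 2 + 41 / 10 / 100 <= 11 / 100 * (6 * t ^+ 3 - 3 * t ^+ 2 + 1).
  have h6 := mulr_ge0 t0 (sqr_ge0 (t - 11 / 20)).
  have h7 := sqr_ge0 (t - 51 / 100).
  lra.
lra.
Qed.

End majorants.

(** * Fixed points of contractions in a weighted supremum norm *)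

Section picard.
Context {R : realType} {Y : Type}.
Variables (m : Y -> R) (P : (Y -> R) -> Prop) (T : (Y -> R) -> Y -> R) (C : R).
Let B (u : Y -> R) := forall y, `|u y| <= 2 * C * m y.
Hypothesis m_ge0 : forall y, 0 <= m y.
Hypothesis C_ge0 : 0 <= C.
Hypothesis P0 : P (fun=> 0).
Hypothesis PT : forall u, P u -> B u -> P (T u).
Hypothesis T0 : forall y, `|T (fun=> 0) y| <= C * m y.
Hypothesis contr : forall u v d, P u -> P v -> B u -> B v -> 0 <= d ->
  (forall y, `|u y - v y| <= d * m y) -> forall y, `|T u y - T v y| <= d / 2 * m y.
Hypothesis P_closed : forall (u_ : nat -> Y -> R) u, (forall n, P (u_ n)) ->
  (forall n y, `|u_ n y - u y| <= 2 * C * (1 / 2) ^+ n * m y) -> P u.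

Lemma geometric_small (K x : R) : (forall n, `|x| <= K * (1 / 2) ^+ n) -> x = 0.
Proof.
move=> h; apply/eqP/negPn/negP => x0; have {}x0 : 0 < `|x| by rewrite normr_gt0.
have K0 : 0 < K by have := h 0%N; rewrite expr0 mulr1; exact: lt_le_trans.
pose n := Num.truncn (K / `|x|).
have hn : K / `|x| < n.+1%:R by exact: truncnS_gt.
have := h n.+1; apply/negP; rewrite -ltNge.
have n2 : n.+1%:R <= 2 ^+ n.+1 :> R by rewrite -natrX ler_nat ltnW// ltn_expl.
rewrite div1r exprVn ltr_pdivrMr ?exprn_gt0//.
rewrite ltr_pdivrMr// in hn; apply: lt_le_trans hn _.
by rewrite mulrC ler_wpM2l.
Qed.

Let u_ n := iter n T (fun=> 0).
Let q n : R := (1 / 2) ^+ n.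

Let q_ge0 n : 0 <= q n. Proof. by rewrite exprn_ge0// divr_ge0. Qed.
Let qS n : q n.+1 = q n / 2. Proof. by rewrite /q exprSr mulrA mulr1. Qed.

Let u_props n : [/\ P (u_ n), forall y, `|u_ n y| <= 2 * C * (1 - q n) * m y, P (u_ n.+1) &
  forall y, `|u_ n.+1 y - u_ n y| <= C * q n * m y].
Proof.
have BB k : (forall y, `|u_ k y| <= 2 * C * (1 - q k) * m y) -> B (u_ k).
  move=> h y; apply: le_trans (h y) _; rewrite ler_wpM2r// ler_piMr//; first by rewrite mulr_ge0.
  by rewrite gerBl.
have b0 : B (u_ 0%N) by move=> y; rewrite normr0 mulr_ge0// mulr_ge0.
elim: n => [|n [Pn bn PSn cn]].
  split => //.
  - by move=> y; rewrite /q expr0 subrr mulr0 mul0r normr0.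
  - exact: PT P0 b0.
  - by move=> y; rewrite /q expr0 mulr1 subr0; exact: T0.
have bS y : `|u_ n.+1 y| <= 2 * C * (1 - q n.+1) * m y.
  have -> : u_ n.+1 y = (u_ n.+1 y - u_ n y) + u_ n y by rewrite subrK.
  apply: le_trans (ler_normD _ _) _; apply: le_trans (lerD (cn y) (bn y)) _.
  by rewrite qS; lra.
split => //; first exact: PT PSn (BB _ bS).
move=> y; rewrite qS mulrA.
apply: (@contr (u_ n.+1) (u_ n) (C * q n)) => //; [exact: BB|exact: BB|exact: mulr_ge0].
Qed.

(** Contraction principle with factor 1/2 on the ball of radius 2 C. No function space is built: at
    each point the iterates lie in nested intervals, and the limit is the supremum of their lower
    ends. [P] carries continuity and parity through the iteration. *)
Lemma picard : exists u, [/\ P u, B u & forall y, T u y = u y].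
Proof.
have step n y : `|u_ n.+1 y - u_ n y| <= C * q n * m y by have [] := u_props n.
pose lo n y := u_ n y - 2 * C * q n * m y; pose up n y := u_ n y + 2 * C * q n * m y.
have lo_up n y : lo n y <= up n y.
  rewrite /lo /up; have : 0 <= 2 * C * q n * m y by rewrite !mulr_ge0.
  lra.
have loS n k y : lo n y <= lo (n + k)%N y.
  elim: k => [|k IH]; first by rewrite addn0.
  apply: le_trans IH _; rewrite addnS /lo qS.
  have := step (n + k)%N y; rewrite ler_norml => /andP[+ _]; lra.
have upS n k y : up (n + k)%N y <= up n y.
  elim: k => [|k IH]; first by rewrite addn0.
  apply: le_trans _ IH; rewrite addnS /up qS.
  have := step (n + k)%N y; rewrite ler_norml => /andP[_ +]; lra.
have lu n k y : lo n y <= up k y.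
  apply: le_trans (loS n k y) _; apply: le_trans (lo_up _ _) _.
  by rewrite addnC; exact: upS.
pose A y := [set z | exists n, z = lo n y].
have supA y : has_sup (A y).
  by split; [exists (lo 0%N y), 0%N|exists (up 0%N y) => _ [n ->]].
pose u y := sup (A y).
have du n y : `|u_ n y - u y| <= 2 * C * q n * m y.
  have h1 : lo n y <= u y by apply: ub_le_sup; [exact: (supA y).2|exists n].
  have h2 : u y <= up n y by apply: ge_sup; [exact: (supA y).1|move=> _ [k ->]].
  rewrite ler_norml; move: h1 h2; rewrite /lo /up; lra.
have Pu : P u by apply: (P_closed _ du) => n; have [] := u_props n.
have Bn n : B (u_ n).
  move=> y; have [_ h _ _] := u_props n; apply: le_trans (h y) _.
  by rewrite ler_wpM2r// ler_piMr ?mulr_ge0// gerBl.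
have Bu : B u.
  by move=> y; have := du 0%N y; rewrite /q expr0 mulr1 /u_/= sub0r normrN.
exists u; split => // y; apply/eqP; rewrite -subr_eq0; apply/eqP.
apply: (@geometric_small (2 * C * m y)) => n.
have [Pn _ _ _] := u_props n.
have dT : `|T u y - T (u_ n) y| <= 2 * C * q n / 2 * m y.
  apply: contr => //; first by rewrite !mulr_ge0.
  by move=> z; rewrite distrC.
have -> : T u y - u y = (T u y - T (u_ n) y) + (u_ n.+1 y - u y).
  by rewrite /u_/= addrA subrK.
apply: le_trans (ler_normD _ _) _; apply: le_trans (lerD dT (du n.+1 y)) _.
by rewrite qS /q; lra.
Qed.

End picard.

Lemma uniform_limit_continuous {R : realType} (u_ : nat -> R -> R) (u : R -> R) (K : R) :
  (forall n, continuous (u_ n)) ->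
  (forall n x, `|u_ n x - u x| <= K * (1 / 2) ^+ n) -> continuous u.
Proof.
move=> cu hu x; apply/cvgrPdist_lt => e e0.
have K0 : 0 <= K by have := hu 0%N x; rewrite expr0 mulr1; exact: le_trans.
have [n hn] : exists n, K * (1 / 2) ^+ n < e / 3.
  pose n := Num.truncn (3 * K / e); exists n.+1.
  have hn : 3 * K / e < n.+1%:R by exact: truncnS_gt.
  have n2 : n.+1%:R <= 2 ^+ n.+1 :> R by rewrite -natrX ler_nat ltnW// ltn_expl.
  rewrite div1r exprVn ltr_pdivrMr ?exprn_gt0//.
  rewrite ltr_pdivrMr// in hn; nra.
have /cvgrPdist_lt/(_ (e / 3)) := cu n x.
move=> /(_ (divr_gt0 e0 (ltr0n _ 3))); apply: filterS => y hy.
have := hu n x; have := hu n y; move: hy hn.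
rewrite !ltr_norml !ler_norml; lra.
Qed.

(** * The coupled system in the variables v = 2 u - 1 *)

Section coefficients.
Context {R : realType}.
Implicit Types (s t : sign) (i j : 'I_3) (x : R).

Lemma forall3 (Q : 'I_3 -> Prop) : Q 0 -> Q 1 -> Q 2 -> forall i, Q i.
Proof.
move=> q0 q1 q2 [[|[|[|//]]] h].
- by rewrite (_ : Ordinal h = 0)//; exact: val_inj.
- by rewrite (_ : Ordinal h = 1)//; exact: val_inj.
- by rewrite (_ : Ordinal h = 2)//; exact: val_inj.
Qed.

Lemma sum3 (V : nmodType) (F : 'I_3 -> V) : \sum_(i < 3) F i = F 0 + F 1 + F 2.
Proof.
rewrite !big_ord_recr big_ord0 /= add0r.
by congr (F _ + F _ + F _); exact: val_inj.
Qed.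

Definition cpl s t i j : R :=
  let c12 := signr s * (4 / 100) in let c23 := signr t * (2 / 100) in
  nth 0 (nth [::] [:: [:: 0; c12; 0]; [:: c12; 0; c23]; [:: 0; c23; 0]] i) j.

Definition bb i : R := nth 0 [:: 1; 98 / 100; 96 / 100] i.

Definition be s t i : R := bb i + \sum_(j < 3) cpl s t i j.

Definition kk s t i : R := Num.sqrt (be s t i / 8).

(** Bound for the corrections. For two positive couplings the first two rates coincide, so only the
    mismatch across c23 drives the corrections; the smaller value enters the estimates at
    [mid_rate]. *)
Definition eps s t : R := if (s, t) is (Plus, Plus) then 1 / 5 / 100 else 2 / 5 / 100.

Lemma cpl_sym s t i j : cpl s t i j = cpl s t j i.
Proof. by move: i j; apply: forall3; apply: forall3. Qed.

Ltac cases := rewrite /eps /be !sum3 /cpl /bb /signr /=.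

Lemma be_bounds s t i : 92 / 100 <= be s t i <= 104 / 100.
Proof. move: i; case: s; case: t; apply: forall3; cases; lra. Qed.

Lemma cpl_sum_le s t i : \sum_(j < 3) `|cpl s t i j| <= 6 / 100.
Proof.
by move: i; case: s; case: t; apply: forall3; cases; do 3?[case: ler0P => ?]; lra.
Qed.

Lemma eps_bounds s t : 1 / 5 / 100 <= eps s t <= 2 / 5 / 100.
Proof. by case: s; case: t; rewrite /eps; lra. Qed.

(** The left side measures the residual of the uncorrected kinks. The constant 59/10 is such that
    59/10 * (102/100) / (4 * 184/100) <= 9/11 and 9/11 * 61/100 < 1/2, which places the first
    iterate in half of the ball of radius [eps]. *)
Lemma mismatch_le s t i :
  \sum_(j < 3) `|cpl s t i j| * `|be s t i - be s t j| <= be s t i / 8 * (59 / 10) * eps s t.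
Proof.
by move: i; case: s; case: t; apply: forall3; cases; rewrite -!normrM ?mul0r ?normr0 ?add0r ?addr0;
  do 2?[case: ler0P => ?]; lra.
Qed.

Lemma kk2 s t i : kk s t i ^+ 2 = be s t i / 8.
Proof. by rewrite sqr_sqrtr//; have := be_bounds s t i; lra. Qed.

Lemma kk_gt0 s t i : 0 < kk s t i.
Proof. by rewrite sqrtr_gt0; have := be_bounds s t i; lra. Qed.

Lemma kk_rate s t i : kink_rate (kk s t i).
Proof. by split; [exact: kk_gt0|rewrite kk2; have := be_bounds s t i; lra]. Qed.

Definition k0 : R := Num.sqrt (1 / 8).

Lemma k02 : k0 ^+ 2 = 1 / 8.
Proof. by rewrite sqr_sqrtr//; lra. Qed.

Lemma k0_gt0 : 0 < k0.
Proof. by rewrite sqrtr_gt0; lra. Qed.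

(** The kink for b = 1 without coupling, a yardstick common to the three components. *)
Definition tau x := tk k0 x.

Lemma tk_homo (k k' x : R) : k <= k' -> 0 <= x -> tk k x <= tk k' x.
Proof. by move=> kk' x0; rewrite th_le// ler_wpM2r. Qed.

(** By concavity of tanh, tanh (k x) / k decreases in k. *)
Lemma tk_ratio (k k' x : R) : 0 < k -> k <= k' -> 0 <= x -> k * tk k' x <= k' * tk k x.
Proof.
move=> p kk' x0; have p' : 0 < k' by exact: lt_le_trans kk'.
have := @th_scale R (k / k') (k' * x); rewrite mulrA divfK ?gt_eqF//.
rewrite divr_ge0 ?(ltW p) ?(ltW p')// ler_pdivrMr// mul1r kk' mulr_ge0 ?(ltW p')//.
move=> /(_ isT isT); rewrite -/(tk k' x) -/(tk k x).
by rewrite mulrAC ler_pdivrMr// [_ * k']mulrC.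
Qed.

(** The constants enclose the square roots of 92/100 and 104/100. *)
Lemma kk_k0 s t i : 23 / 24 * k0 <= kk s t i <= 102 / 100 * k0.
Proof.
have := be_bounds s t i; have := kk2 s t i; have := k02; have := k0_gt0; have := kk_gt0 s t i.
move: (kk _ _ _) k0 (be _ _ _) => k l b k0 l0 l2 k2 hb.
apply/andP; split; rewrite -(@ler_pXn2r _ 2)// ?nnegrE; lra || nra.
Qed.

Lemma tk_tau s t i x : 0 <= x -> 23 / 24 * tau x <= tk (kk s t i) x <= 102 / 100 * tau x.
Proof.
move=> x0; have /andP[h1 h2] := kk_k0 s t i; have l0 := k0_gt0; have k0p := kk_gt0 s t i.
have t0 : 0 <= tau x by rewrite tk_ge0// ltW.
have [le|/ltW le] := leP k0 (kk s t i).
- have := tk_homo le x0; have := tk_ratio l0 le x0; rewrite -/(tau x) => a b.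
  have c : k0 * tk (kk s t i) x <= k0 * (102 / 100 * tau x) by nra.
  by rewrite ler_pM2l// in c; lra.
- have := tk_homo le x0; have := tk_ratio k0p le x0; rewrite -/(tau x) => a b.
  have c : k0 * (23 / 24 * tau x) <= k0 * tk (kk s t i) x by nra.
  by rewrite ler_pM2l// in c; lra.
Qed.

Lemma tau_ge0 x : 0 <= x -> 0 <= tau x.
Proof. by move=> x0; rewrite tk_ge0// ltW// k0_gt0. Qed.

Lemma tau_lt1 x : tau x < 1. Proof. exact: tk_lt1. Qed.

(* [psi] absorbs the linear factor coming from the mismatch of two kink widths. *)
Lemma psi_lin_le (k x : R) : kink_rate k -> 0 <= x -> 2 * (k * x) * psi k x <= om x.
Proof.
move=> [kp /andP[k1 k2]] x0; rewrite /om -[leRHS]mul1r ler_pdivlMr ?om_den_gt0//.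
have h := psi_le (ltW kp) x0; apply: le_trans h; rewrite mulrAC [leRHS]mulrC ler_wpM2r ?(ltW (psi_gt0 _ _))//.
have a0 := @al_gt0 R; have a1 := @al_le R.
have kl : 33 / 100 <= k by nra.
have ax : al * x <= 8 / 250 * (k * x).
  rewrite mulrA ler_wpM2r//; lra.
have y0 : 0 <= k * x by rewrite mulr_ge0// ltW.
move: (k * x) (al * x) y0 ax => y z y0 zy.
have h1 : 2 * y * (1 + z) <= 2 * y * (1 + 8 / 250 * y) by rewrite ler_wpM2l; lra.
apply: le_trans h1 _.
have := sqr_ge0 (y ^+ 2 - 4 / 5); have := sqr_ge0 (y - 9 / 10); nra.
Qed.

(** The tangent estimate at the smaller rate produces (k' - k) x psi, and the factor x is absorbed
    by the decay of psi, leaving [om]. *)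
Lemma tk_sqr_sub_le (k k' x : R) : kink_rate k -> kink_rate k' -> k <= k' -> 0 <= x ->
  tk k' x ^+ 2 - tk k x ^+ 2 <= (k' - k) / k * om x.
Proof.
move=> hk hk' le x0; have [kp _] := hk.
have t0 := tk_ge0 (ltW kp) x0; have t1 := tk_homo le x0; have /ltW t2 := tk_lt1 k' x.
have h : tk k' x - tk k x <= (k' * x - k * x) * psi k x.
  by apply: th_sub_le; [rewrite mulr_ge0// ltW|rewrite ler_wpM2r].
have h2 := psi_lin_le hk x0.
have h3 : tk k' x - tk k x <= (k' - k) / k * (k * x * psi k x).
  have -> : (k' - k) / k * (k * x * psi k x) = (k' * x - k * x) * psi k x; last by [].
  by field; rewrite gt_eqF.
have -> : tk k' x ^+ 2 - tk k x ^+ 2 = (tk k' x - tk k x) * (tk k' x + tk k x) by ring.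
have dk : 0 <= (k' - k) / k by rewrite divr_ge0 ?subr_ge0 ?(ltW kp).
apply: (@le_trans _ _ ((tk k' x - tk k x) * 2)); first by rewrite ler_wpM2l; lra.
apply: (@le_trans _ _ ((k' - k) / k * (k * x * psi k x) * 2)); first by rewrite ler_wpM2r.
by rewrite -mulrA ler_wpM2l//; lra.
Qed.

(** With 8 k^2 = be, the relative difference of the rates is at most the difference of the be
    divided by 2 be, and 184/100 is twice the lower bound of be. *)
Lemma tk_sqr_dist s t i j x : 0 <= x ->
  `|tk (kk s t i) x ^+ 2 - tk (kk s t j) x ^+ 2| <= `|be s t i - be s t j| / (184 / 100) * om x.
Proof.
move=> x0.
wlog ij : i j / kk s t i <= kk s t j.
  move=> h; have [/h//|/ltW/h] := leP (kk s t i) (kk s t j).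
  by rewrite distrC (distrC (be s t j)).
have h := tk_sqr_sub_le (kk_rate s t i) (kk_rate s t j) ij x0.
have ki := kk_gt0 s t i; have o0 := om_gt0 x0.
have tij : 0 <= tk (kk s t j) x ^+ 2 - tk (kk s t i) x ^+ 2.
  rewrite subr_ge0 lerXn2r ?nnegrE ?tk_ge0 ?(ltW (kk_gt0 _ _ _))//; exact: tk_homo.
rewrite distrC ger0_norm//; apply: le_trans h _; rewrite ler_wpM2r ?(ltW o0)//.
have bij : be s t i <= be s t j.
  have : kk s t i ^+ 2 <= kk s t j ^+ 2 by rewrite lerXn2r ?nnegrE ?(ltW (kk_gt0 _ _ _)).
  by rewrite !kk2; lra.
rewrite distrC ger0_norm ?subr_ge0//.
rewrite ler_pdivrMr// mulrAC ler_pdivlMr; last lra.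
have := kk2 s t i; have := kk2 s t j; have /andP[bi _] := be_bounds s t i.
move: (kk s t i) (kk s t j) (be s t i) (be s t j) ij ki bi bij => k l b c kl k0 b0 bc hc hb.
have e : (l - k) * (l + k) = (c - b) / 8 by rewrite -subr_sqr hc hb; field.
have e2 : (l - k) * (2 * k) <= (c - b) / 8 by rewrite -e ler_wpM2l; lra.
have : (l - k) * (2 * k) * k <= (c - b) / 8 * k by apply: ler_wpM2r; [exact: ltW|exact: e2].
have -> : (l - k) * (2 * k) * k = (l - k) * 2 * k ^+ 2 by ring.
rewrite hb; nra.
Qed.

End coefficients.

(** * The solution operator of the scalar problem *)

Section kink_operator.
Context {R : realType}.
Implicit Types (k x K : R) (F : R -> R).

(* Junk value 0 if [F] has no solution vanishing at 0 with a decaying Wronskian; there is at most one. *)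
Definition Tk k F : R -> R := xget (fun=> 0) [set h | exists h1, sol k F h h1].

Lemma TkP k F h h1 : sol k F h h1 -> exists g1, sol k F (Tk k F) g1.
Proof. by move=> s; apply: (xgetPex (fun=> 0) (P := [set h | exists h1, sol k F h h1])); exists h, h1. Qed.

(** The factor 24/23 in [e] passes from tau to tanh at the rate of component i. Coming back costs
    102/100, and 24/23 * 57/100 * 102/100 < 61/100. *)
Lemma Tk_odd_bound s t i F K : continuous F -> 0 <= K ->
  (forall x, 0 <= x -> `|F x| <= K * (tau x * om x)) ->
  let k := kk s t i in let e := K * (24 / 23) / k ^+ 2 in
  exists h1, sol k F (Tk k F) h1 /\ forall x, 0 <= x ->
    `|Tk k F x| <= K * (61 / 100) / k ^+ 2 * (tau x * om x) /\
    `|wronsk k (Tk k F) h1 x| <=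
      wronsk k (Sq k (57 / 100 * e) 0 (- (19 / 100 * e))) (Sq1 k (57 / 100 * e) 0 (- (19 / 100 * e))) x.
Proof.
move=> cF K0 FK k e; have hk := @kk_rate R s t i; have [kp _] := hk.
have k2 : 0 < k ^+ 2 by rewrite exprn_gt0.
have e0 : 0 <= e by apply: divr_ge0; [lra|exact: ltW].
have mj := majorant_Sq (57 / 100 * e) 0 (- (19 / 100 * e)) kp.
have FS x : 0 <= x -> `|F x| <= pot k x * Sq k (57 / 100 * e) 0 (- (19 / 100 * e)) x
   - Sq2 k (57 / 100 * e) 0 (- (19 / 100 * e)) x.
  move=> x0; apply: le_trans (FK x x0) _; refine (le_trans _ (majorant_odd hk e0 x0)).
  have -> : k ^+ 2 * e = K * (24 / 23) by rewrite /e; field; rewrite gt_eqF.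
  rewrite -mulrA; apply: ler_wpM2l; first exact: K0.
  rewrite mulrA; apply: ler_wpM2r; first exact/ltW/om_gt0.
  by have /andP[h _] := tk_tau s t i x0; have := tau_ge0 x0; rewrite -/k; lra.
have [h [h1 [sh _]]] := sol_exists cF mj FS.
have [g1 sg] := TkP sh; exists g1; split; first exact: sg.
move=> x x0.
have [b1 b2] := sol_le cF mj FS sg x0; split; last exact: b2.
apply: le_trans b1 _; rewrite /Sq.
have o0 := om_gt0 x0; have t0 := tk_ge0 (ltW kp) x0; have /andP[_ h2] := tk_tau s t i x0.
have -> : K * (61 / 100) / k ^+ 2 * (tau x * om x) = om x * (K / k ^+ 2 * (61 / 100 * tau x)) by ring.
apply: ler_wpM2l; first exact: ltW.
have Kk : 0 <= K / k ^+ 2 by rewrite divr_ge0// ltW.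
have -> : 57 / 100 * e * tk k x + 0 * tk k x ^+ 2 + - (19 / 100 * e) * tk k x ^+ 3 =
  K / k ^+ 2 * (24 / 23 * (57 / 100 * tk k x - 19 / 100 * tk k x ^+ 3)) by rewrite /e; field; rewrite gt_eqF.
apply: ler_wpM2l; first exact: Kk.
have t3 : 0 <= tk k x ^+ 3 by rewrite exprn_ge0.
by have := tau_ge0 x0; rewrite -/k in h2; lra.
Qed.

End kink_operator.

(** * Lipschitz constants of the nonlinear terms *)

Section cubic_estimates.
Context {R : realType}.
Implicit Types (v w d : R).

(** The difference splits into multiples of v - v' and u - u' with coefficients at most 61/20 and
    51/25. The range 251/250 is 1 plus the largest correction 1/250. *)
Lemma coupling_lip v v' u u' d : 0 <= v <= 251 / 250 -> 0 <= v' <= 251 / 250 ->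
  0 <= u <= 251 / 250 -> 0 <= u' <= 251 / 250 -> `|v - v'| <= d -> `|u - u'| <= d ->
  `|v * (v ^+ 2 - u ^+ 2) - v' * (v' ^+ 2 - u' ^+ 2)| <= 51 / 10 * d.
Proof.
move=> /andP[v0 v1] /andP[w0 w1] /andP[u0 u1] /andP[z0 z1] hv hu.
have d0 : 0 <= d by exact: le_trans hv.
have -> : v * (v ^+ 2 - u ^+ 2) - v' * (v' ^+ 2 - u' ^+ 2) =
  (v ^+ 2 + v * v' + v' ^+ 2 - u ^+ 2) * (v - v') - v' * (u + u') * (u - u') by ring.
apply: le_trans (ler_normB _ _) _; rewrite !(normrM _ (_ - _)).
have a1 : `|v ^+ 2 + v * v' + v' ^+ 2 - u ^+ 2| <= 61 / 20 by rewrite ler_norml; apply/andP; split; nra.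
have a2 : `|v' * (u + u')| <= 51 / 25 by rewrite ger0_norm; nra.
apply: (@le_trans _ _ (61 / 20 * d + 51 / 25 * d)); last lra.
by apply: lerD; (apply: ler_pM; [exact: normr_ge0|exact: normr_ge0| |]); assumption.
Qed.

Lemma cubic_lip c a a' d : 0 <= c <= 1 -> `|a| <= 1 / 250 -> `|a'| <= 1 / 250 -> `|a - a'| <= d ->
  `|(3 * c * a ^+ 2 + a ^+ 3) - (3 * c * a' ^+ 2 + a' ^+ 3)| <= 5 / 200 * d.
Proof.
move=> /andP[c0 c1] ha ha' h.
have -> : (3 * c * a ^+ 2 + a ^+ 3) - (3 * c * a' ^+ 2 + a' ^+ 3) =
  (3 * c * (a + a') + (a ^+ 2 + a * a' + a' ^+ 2)) * (a - a') by ring.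
rewrite normrM; apply: ler_pM; [exact: normr_ge0|exact: normr_ge0| |exact: h].
apply: le_trans (ler_normD _ _) _.
have h1 : `|3 * c * (a + a')| <= 3 * 1 * (2 / 250).
  rewrite normrM; apply: ler_pM; [exact: normr_ge0|exact: normr_ge0|by rewrite ger0_norm; lra|].
  by apply: le_trans (ler_normD _ _) _; lra.
have h2 : `|a ^+ 2 + a * a' + a' ^+ 2| <= 1 / 100 / 100.
  by move: ha ha'; rewrite !ler_norml => /andP[? ?] /andP[? ?]; apply/andP; split; nra.
lra.
Qed.

End cubic_estimates.

(** * The equation for the corrections of the kinks *)

Section wave.
Context {R : realType} (s t : sign).
Local Notation k := (@kk R s t).
Local Notation c := (@cpl R s t).
Implicit Types (i j : 'I_3) (x : R).

Definition profile (w : 'I_3 -> R -> R) i x : R := tk (k i) x + w i x.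

(* With [v = t + w], the standing wave equation [v'' + (v/4) (sum A (1 - v^2)) = 0]
   reads [- w'' + pot w = forcing w]. *)
Definition forcing (w : 'I_3 -> R -> R) i x : R :=
  - (2 * k i ^+ 2 * (3 * tk (k i) x * w i x ^+ 2 + w i x ^+ 3))
  + \sum_(j < 3) c i j / 4 * (profile w i x * (profile w i x ^+ 2 - profile w j x ^+ 2)).

(** Weight for odd corrections: [tau] gives the zero at the origin, [om] the decay. *)
Definition wt x : R := tau `|x| * om `|x|.

Lemma wt_ge0 x : 0 <= wt x.
Proof. by rewrite mulr_ge0 ?tau_ge0// ltW// om_gt0. Qed.

Lemma wt_le_tau x : wt x <= tau `|x|.
Proof. by rewrite /wt ler_piMr ?tau_ge0// om_le1. Qed.

Lemma wt_le1 x : wt x <= 1.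
Proof. by apply: le_trans (wt_le_tau x) _; exact/ltW/tau_lt1. Qed.

Lemma profile_bounds (w : 'I_3 -> R -> R) i x : 0 <= x -> `|w i x| <= eps s t * wt x ->
  95 / 100 * tau x <= profile w i x <= 251 / 250.
Proof.
move=> x0; rewrite /profile; have := wt_le_tau x; have := wt_ge0 x; rewrite ger0_norm// => m0 m1.
have /andP[t1 t2] := tk_tau s t i x0; have /ltW t3 := tk_lt1 (k i) x.
have /andP[e0 e1] := @eps_bounds R s t; have /ltW := tau_lt1 x.
rewrite ler_norml => t4 /andP[h1 h2].
have h3 : eps s t * wt x <= 1 / 250 * tau x by apply: ler_pM; lra.
apply/andP; split; lra.
Qed.

(** The cubic terms contribute 28/100 * 5/200 and the couplings 6/100 * 1/4 * 51/10. Multiplied by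
    the gain 61/100 / k^2 of the solution operator, with k^2 >= 11/100, the constant 21/250 stays
    below 1/2. *)
Lemma forcing_lip (w w' : 'I_3 -> R -> R) i x d : 0 <= x ->
  (forall j, `|w j x| <= eps s t * wt x) -> (forall j, `|w' j x| <= eps s t * wt x) ->
  (forall j, `|w j x - w' j x| <= d) ->
  `|forcing w i x - forcing w' i x| <= 21 / 250 * d.
Proof.
move=> x0 hw hw' hd; have d0 : 0 <= d by exact: le_trans (hd 0).
have tx : 0 <= tau x by exact: tau_ge0.
have pb (u : 'I_3 -> R -> R) j : (forall j, `|u j x| <= eps s t * wt x) -> 0 <= profile u j x <= 251 / 250.
  move=> hu; have /andP[h1 ->] := profile_bounds x0 (hu j); rewrite andbT.
  by apply: le_trans h1; apply: mulr_ge0; lra.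
have we (u : 'I_3 -> R -> R) j : (forall j, `|u j x| <= eps s t * wt x) -> `|u j x| <= 1 / 250.
  move=> /(_ j) hu; apply: le_trans hu _; have /andP[e0 e1] := @eps_bounds R s t.
  by have := wt_le1 x; have := wt_ge0 x; nra.
rewrite /forcing opprD addrACA -sumrB; apply: le_trans (ler_normD _ _) _.
have [kp /andP[k1 k2]] := @kk_rate R s t i.
have h1 : `|- (2 * k i ^+ 2 * (3 * tk (k i) x * w i x ^+ 2 + w i x ^+ 3)) -
  - (2 * k i ^+ 2 * (3 * tk (k i) x * w' i x ^+ 2 + w' i x ^+ 3))| <= 28 / 100 * (5 / 200 * d).
  rewrite opprK addrC -mulrBr normrM distrC; apply: ler_pM; [exact: normr_ge0|exact: normr_ge0|by rewrite ger0_norm; lra|].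
  by apply: cubic_lip; [rewrite tk_ge0 ?(ltW kp)// ltW// tk_lt1|exact: we|exact: we|exact: hd].
have h2 : `|\sum_(j < 3) (c i j / 4 * (profile w i x * (profile w i x ^+ 2 - profile w j x ^+ 2)) -
      c i j / 4 * (profile w' i x * (profile w' i x ^+ 2 - profile w' j x ^+ 2)))| <= 6 / 100 * (1 / 4 * (51 / 10 * d)).
  apply: le_trans (ler_norm_sum _ _ _) _.
  apply: (@le_trans _ _ ((\sum_(j < 3) `|c i j|) * (1 / 4 * (51 / 10 * d)))); last first.
    by apply: ler_wpM2r; [lra|exact: cpl_sum_le].
  rewrite mulr_suml; apply: ler_sum => j _.
  rewrite -mulrBr normrM normrM -mulrA; apply: ler_wpM2l; first exact: normr_ge0.
  apply: ler_pM; [exact: normr_ge0|exact: normr_ge0|by rewrite ger0_norm; lra|].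
  have dp l : `|profile w l x - profile w' l x| <= d.
    by rewrite /profile opprD addrACA subrr add0r.
  by apply: coupling_lip; [exact: pb|exact: pb|exact: pb|exact: pb|exact: dp|exact: dp].
lra.
Qed.

(** At w = 0 only the coupling is left. It is proportional to differences of squared kinks, hence to
    the mismatch of the be, with a factor tanh that vanishes at 0. *)
Lemma forcing0_le i x : 0 <= x ->
  `|forcing (fun _ _ => 0) i x| <= k i ^+ 2 * (9 / 11) * eps s t * wt x.
Proof.
move=> x0; have o0 := om_gt0 x0; have tx := tau_ge0 x0; have [kp _] := @kk_rate R s t i.
rewrite /forcing /profile !expr0n/= !mulr0 !addr0 mulr0 oppr0 add0r.
apply: le_trans (ler_norm_sum _ _ _) _.
have /andP[_ t2] := tk_tau s t i x0; have t0 := tk_ge0 (ltW kp) x0.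
apply: (@le_trans _ _ (\sum_(j < 3) (`|c i j| * `|be s t i - be s t j|) * (1 / 4 * (102 / 100) / (184 / 100) * wt x))).
  apply: ler_sum => j _; rewrite addr0 normrM normrM.
  have -> : `|c i j| * `|be s t i - be s t j| * (1 / 4 * (102 / 100) / (184 / 100) * wt x) =
    `|c i j| * ((1 / 4) * ((102 / 100 * tau x) * (`|be s t i - be s t j| / (184 / 100) * om x))).
    by rewrite /wt (ger0_norm x0); field.
  rewrite -mulrA; apply: ler_wpM2l; first exact: normr_ge0.
  apply: ler_pM; [exact: normr_ge0|exact: normr_ge0|by rewrite ger0_norm; lra|].
  rewrite normrM; apply: ler_pM; [exact: normr_ge0|exact: normr_ge0|by rewrite ger0_norm; [exact: t2|exact: t0]|].
  exact: tk_sqr_dist.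
rewrite -mulr_suml; have h := @mismatch_le R s t i; rewrite kk2.
have m0 := wt_ge0 x; have := @be_bounds R s t i; have := @eps_bounds R s t => /andP[e0 _] /andP[b0 _].
apply: (@le_trans _ _ (be s t i / 8 * (59 / 10) * eps s t * (1 / 4 * (102 / 100) / (184 / 100) * wt x))).
  by apply: ler_wpM2r; [lra|exact: h].
have p : 0 <= be s t i / 8 * eps s t * wt x by apply: mulr_ge0; [apply: mulr_ge0; lra|exact: m0].
lra.
Qed.

End wave.

(** * Existence of the standing wave *)

Section wave_existence.
Context {R : realType} (s t : sign).
Local Notation k := (@kk R s t).
Implicit Types (i j : 'I_3) (x : R) (w : 'I_3 -> R -> R).

Lemma profile_continuous w i : continuous (w i) -> continuous (profile s t w i).
Proof. by move=> cw; rewrite /profile; cont; exact: continuous_tk. Qed.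

Lemma forcing_continuous w i : (forall j, continuous (w j)) -> continuous (forcing s t w i).
Proof.
by move=> cw; rewrite /forcing; cont; by [exact: continuous_tk|exact: cw|exact: profile_continuous].
Qed.

Lemma forcing_odd w i : (forall j x, w j (- x) = - w j x) ->
  forall x, forcing s t w i (- x) = - forcing s t w i x.
Proof.
move=> ow x; rewrite /forcing /profile opprD -sumrN; congr (_ + _).
  by rewrite tkN ow; ring.
by apply: eq_bigr => j _; rewrite !tkN !ow; ring.
Qed.

(** The bound on w1 at 0 serves to make v' positive there, and the decay of w1 makes v' square
    integrable. *)
Definition wave_data (w w1 : 'I_3 -> R -> R) := forall i,
  [/\ forall x, w i (- x) = - w i x,
      forall x, is_derive x 1 (w i) (w1 i x),
      forall x, is_derive x 1 (w1 i) (pot (k i) x * w i x - forcing s t w i x),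
      forall x, 0 <= x -> `|w i x| <= eps s t * (tau x * om x) &
      `|w1 i 0| <= 1 / 2 * k i /\ exists C, forall x, 0 <= x -> `|w1 i x| <= C * om x].

Lemma wave_exists : exists w w1, wave_data w w1.
Proof.
pose P (u : 'I_3 * R -> R) := forall i, continuous (fun x => u (i, x)) /\
  forall x, u (i, - x) = - u (i, x).
pose cur (u : 'I_3 * R -> R) i x := u (i, x).
pose T (u : 'I_3 * R -> R) y := Tk (k y.1) (forcing s t (cur u) y.1) y.2.
pose C := eps s t / 2 : R.
have C2 : 2 * C = eps s t by rewrite /C; field.
have /andP[e0 e1] := @eps_bounds R s t.
have C0 : 0 <= C by rewrite /C; lra.
have cF u i : P u -> continuous (forcing s t (cur u) i).
  by move=> Pu; apply: forcing_continuous => j; exact: (Pu j).1.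
have oF u i : P u -> forall x, forcing s t (cur u) i (- x) = - forcing s t (cur u) i x.
  by move=> Pu; apply: forcing_odd => j; exact: (Pu j).2.
pose m (y : 'I_3 * R) := wt y.2.
have P0 : P (fun=> 0).
  by move=> i; split; [exact: cst_continuous|move=> x; rewrite oppr0].
have wtE (x : R) : 0 <= x -> wt x = tau x * om x by move=> x0; rewrite /wt ger0_norm.
have k2 i : 0 < k i ^+ 2 by rewrite exprn_gt0// kk_gt0.
have kb i : 11 / 100 <= k i ^+ 2 <= 14 / 100 by have [] := @kk_rate R s t i.
have F0 i x : 0 <= x -> `|forcing s t (cur (fun=> 0)) i x| <= (k i ^+ 2 * (9 / 11) * eps s t) * (tau x * om x).
  by move=> x0; rewrite -wtE//; exact: forcing0_le.
(* A crude bound on the whole ball. It makes [Tk] applicable and later controls the derivative of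
   the fixed point. *)
have FB u i : P u -> (forall y, `|u y| <= 2 * C * m y) ->
    forall x, 0 <= x -> `|forcing s t (cur u) i x| <= (k i ^+ 2 / 100) * (tau x * om x).
  move=> Pu Bu x x0.
  have h1 : `|forcing s t (cur u) i x - forcing s t (cur (fun=> 0)) i x| <= 21 / 250 * (eps s t * wt x).
    apply: forcing_lip => // j.
    - by rewrite -C2; exact: Bu (j, x).
    - by rewrite normr0 mulr_ge0 ?wt_ge0//; lra.
    - by rewrite subr0 -C2; exact: Bu (j, x).
  have := F0 i x x0; have w0 := wt_ge0 x; rewrite -wtE// => h2.
  have := ler_normD (forcing s t (cur u) i x - forcing s t (cur (fun=> 0)) i x) (forcing s t (cur (fun=> 0)) i x).
  rewrite subrK => h3; apply: le_trans h3 _; apply: le_trans (lerD h1 h2) _.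
  rewrite mulrA -mulrDl; apply: ler_wpM2r => //; have /andP[b0 b1] := kb i; nra.
have K0 i : 0 <= k i ^+ 2 / 100 by have := k2 i; lra.
have solT u i : P u -> (forall y, `|u y| <= 2 * C * m y) ->
    exists h1, sol (k i) (forcing s t (cur u) i) (fun x => T u (i, x)) h1.
  by move=> Pu Bu; have [h1 [sh _]] := @Tk_odd_bound R s t i _ _ (cF u i Pu) (K0 i) (FB u i Pu Bu); exists h1.
(* The estimates hold on the half-line; oddness carries them to negative x. *)
have symm u i x (K : R) : P u -> (forall y, `|u y| <= 2 * C * m y) ->
   (forall x, 0 <= x -> `|T u (i, x)| <= K * (tau x * om x)) -> `|T u (i, x)| <= K * wt x.
  move=> Pu Bu h; have [x0|x0] := leP 0 x; first by rewrite wtE//; exact: h.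
  have [h1 sh] := solT u i Pu Bu.
  have xn : 0 <= - x by rewrite oppr_ge0 ltW.
  have := h (- x) xn; rewrite (sol_odd (oF u i Pu) sh) normrN.
  by rewrite /wt (ltr0_norm x0).
have m0 y : 0 <= m y by exact: wt_ge0.
have B0 : forall y, `|(fun=> 0 : R) y| <= 2 * C * m y.
  by move=> y; rewrite normr0 mulr_ge0// C2; lra.
have T0 y : `|T (fun=> 0) y| <= C * m y.
  case: y => i x; apply: symm => // {}x x0.
  have Ke : 0 <= k i ^+ 2 * (9 / 11) * eps s t by have := k2 i => ?; apply: mulr_ge0; lra.
  have [h1 [_ /(_ x x0)[h _]]] := @Tk_odd_bound R s t i _ _ (cF _ i P0) Ke (F0 i).
  apply: le_trans h _; apply: ler_wpM2r.
    by apply: mulr_ge0; [exact: tau_ge0|exact/ltW/om_gt0].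
  have -> : k i ^+ 2 * (9 / 11) * eps s t * (61 / 100) / k i ^+ 2 = (9 / 11) * (61 / 100) * eps s t.
    by field; rewrite gt_eqF// kk_gt0.
  rewrite /C; lra.
have PT u : P u -> (forall y, `|u y| <= 2 * C * m y) -> P (T u).
  move=> Pu Bu i; have [h1 sh] := solT u i Pu Bu; split.
    by have [_ dh _ _] := sh; move=> x; exact: der_continuous (dh x).
  exact: (sol_odd (oF u i Pu) sh).
have contr u v d : P u -> P v -> (forall y, `|u y| <= 2 * C * m y) ->
    (forall y, `|v y| <= 2 * C * m y) -> 0 <= d ->
    (forall y, `|u y - v y| <= d * m y) -> forall y, `|T u y - T v y| <= d / 2 * m y.
  move=> Pu Pv Bu Bv d0 uv [i x].
  have [hu su] := solT u i Pu Bu; have [hv sv] := solT v i Pv Bv.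
  wlog x0 : x / 0 <= x.
    move=> H; have [/H//|x0] := leP 0 x.
    have xn : 0 <= - x by rewrite oppr_ge0 ltW.
    have := H _ xn; rewrite (sol_odd (oF u i Pu) su) (sol_odd (oF v i Pv) sv) -opprD normrN.
    by rewrite /m /wt normrN.
  pose F x := forcing s t (cur u) i x - forcing s t (cur v) i x.
  have cFF : continuous F by rewrite /F; cont; exact: cF.
  have FK z : 0 <= z -> `|F z| <= 21 / 250 * d * (tau z * om z).
    move=> z0; rewrite -wtE// -mulrA; apply: forcing_lip => // j.
    - by rewrite -C2; exact: Bu (j, z).
    - by rewrite -C2; exact: Bv (j, z).
    - exact: uv (j, z).
  have K1 : 0 <= 21 / 250 * d by apply: mulr_ge0; lra.
  have [h1 [sF /(_ x x0)[bF _]]] := @Tk_odd_bound R s t i _ _ cFF K1 FK.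
  have [e _] := sol_unique (sol_sub su sv) sF x.
  rewrite /m/= wtE//; move: e; rewrite /= => ->; apply: le_trans bF _.
  apply: ler_wpM2r; first by apply: mulr_ge0; [exact: tau_ge0|exact/ltW/om_gt0].
  by rewrite ler_pdivrMr//; have := kb i => /andP[b0 b1]; nra.
have Pcl (u_ : nat -> 'I_3 * R -> R) u : (forall n, P (u_ n)) ->
    (forall n y, `|u_ n y - u y| <= 2 * C * (1 / 2) ^+ n * m y) -> P u.
  move=> Pu_ hu.
  have hu' n y : `|u_ n y - u y| <= 2 * C * (1 / 2) ^+ n.
    apply: le_trans (hu n y) _; apply: ler_piMr; last exact: wt_le1.
    by apply: mulr_ge0; [rewrite C2; lra|apply: exprn_ge0; lra].
  move=> i; split.
    apply: (@uniform_limit_continuous R (fun n x => u_ n (i, x)) _ (2 * C)) => [n|n x].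
      exact: (Pu_ n i).1.
    exact: hu'.
  move=> x; apply/eqP; rewrite -addr_eq0; apply/eqP.
  apply: (@geometric_small R (2 * (2 * C))) => n.
  have -> : u (i, - x) + u (i, x) = - (u_ n (i, - x) - u (i, - x)) - (u_ n (i, x) - u (i, x)).
    by rewrite (Pu_ n i).2; ring.
  apply: le_trans (ler_normB _ _) _; rewrite normrN.
  by have := hu' n (i, - x); have := hu' n (i, x); lra.
have [u [Pu Bu Tu]] := picard m0 C0 P0 PT T0 contr Pcl.
have H i : exists w1 : R -> R, sol (k i) (forcing s t (cur u) i) (cur u i) w1 /\
    (`|w1 0| <= 1 / 2 * k i /\ exists C, forall x, 0 <= x -> `|w1 x| <= C * om x).
  have [h1 [sh bh]] := @Tk_odd_bound R s t i _ _ (cF u i Pu) (K0 i) (FB u i Pu Bu).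
  have e : Tk (k i) (forcing s t (cur u) i) = cur u i by apply/funext => x; exact: Tu (i, x).
  rewrite e in sh bh; exists h1; split => //.
  have kp := @kk_gt0 R s t i.
  set e' := k i ^+ 2 / 100 * (24 / 23) / k i ^+ 2 in bh.
  have ee : e' = 1 / 100 * (24 / 23) by rewrite /e'; field; rewrite gt_eqF.
  split.
    have [_ ] := bh 0 (lexx 0); rewrite /wronsk /Sq /Sq1 psi0 !tk0 om0 !mul1r ee.
    have [h0 _ _ _] := sh; rewrite h0 !expr0n/= !mulr0 !addr0 subr0 !mulr0 !subr0 => h.
    by apply: le_trans h _; have := kp; lra.
  eexists => x x0; have [b1 /(wronsk_norm_le kp x0) b2] := bh x x0.
  apply: le_trans b2 _.
  have o0 := om_gt0 x0.
  have b3 : `|cur u i x| <= 1 * om x.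
    apply: le_trans (Bu (i, x)) _; rewrite C2 /m/= /wt (ger0_norm x0) mulrA.
    apply: ler_wpM2r; first exact: ltW.
    by have := tau_ge0 x0; have /ltW := tau_lt1 x; nra.
  have b4 : 2 * k i * `|cur u i x| <= 2 * k i * (1 * om x).
    by apply: ler_wpM2l => //; rewrite mulr_ge0// ltW.
  by apply: le_trans (lerD b4 (lexx _)) _; rewrite mulrA -mulrDl; exact: lexx.
have [w1 hw1] := choice H.
exists (cur u), w1 => i; have [[h0 dh dh1 _] b] := hw1 i; split => //.
  exact: (Pu i).2.
by move=> x x0; have := Bu (i, x); rewrite C2 /m/= wtE.
Qed.

End wave_existence.

(** * Linearization about the wave *)

Section linearization.
Context {R : realType} (s t : sign) (w w1 : 'I_3 -> R -> R).
Hypothesis hw : wave_data s t w w1.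
Local Notation k := (@kk R s t).
Local Notation c := (@cpl R s t).
Local Notation v := (profile s t w).
Implicit Types (i j : 'I_3) (x lam : R).

Definition diag_coef i x : R :=
  1 / 4 * (bb i * (1 - 3 * v i x ^+ 2) + \sum_(j < 3) c i j * (1 - v j x ^+ 2)).

(** The Hessian of the potential along the wave, expressed in v; [hessian_wave] identifies the
    two. *)
Definition hs i j x : R := (if i == j then diag_coef i x else 0) - c i j / 2 * (v i x * v j x).

(** What the couplings and the corrections change on the diagonal, compared with the scalar operator
    of component i. *)
Definition pert i x : R := diag_coef i x + pot (k i) x.

Lemma hs_sym i j x : hs i j x = hs j i x.
Proof. by rewrite /hs cpl_sym [v i x * _]mulrC eq_sym; case: eqP => // ->. Qed.

Lemma hs_sum i (u : 'I_3 -> R) x : \sum_(j < 3) hs i j x * u j =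
  (pert i x - pot (k i) x) * u i - \sum_(j < 3) c i j / 2 * (v i x * v j x) * u j.
Proof.
rewrite /pert addrK -sumrN.
rewrite (bigD1 i)//= [in RHS](bigD1 i)//= {1}/hs eqxx mulrBl -addrA; congr (_ + (_ + _)).
by apply: eq_bigr => j ji; rewrite /hs eq_sym (negbTE ji) sub0r mulNr.
Qed.

(** By the choice of k the constant terms cancel. What remains is quadratic in the odd functions v
    and tanh, hence O(tau^2). *)
Lemma pertE i x : pert i x = - (3 / 4 * be s t i * (v i x ^+ 2 - tk (k i) x ^+ 2)) +
  \sum_(j < 3) c i j / 4 * (3 * v i x ^+ 2 - v j x ^+ 2).
Proof.
by rewrite /pert /diag_coef /pot kk2 /be !sum3; field.
Qed.

Lemma profile_odd i x : v i (- x) = - v i x.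
Proof. by have [ow _ _ _ _] := hw i; rewrite /profile tkN ow opprD. Qed.

Lemma hs_even i j x : hs i j (- x) = hs i j x.
Proof.
rewrite /hs /diag_coef !profile_odd mulrNN !sqrrN; congr (_ - _); case: eqP => // _.
by congr (_ * (_ + _)); apply: eq_bigr => l _; rewrite profile_odd sqrrN.
Qed.

Lemma continuous_profile i : continuous (v i).
Proof. by apply: profile_continuous => x; have [_ dw _ _ _] := hw i; exact: der_continuous (dw x). Qed.

Lemma continuous_diag_coef i : continuous (diag_coef i).
Proof. by rewrite /diag_coef; cont; exact: continuous_profile. Qed.

Lemma continuous_pert i : continuous (pert i).
Proof. by rewrite /pert /pot; cont; by [exact: continuous_diag_coef|exact: continuous_tk]. Qed.

Lemma continuous_hs i j : continuous (hs i j).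
Proof.
rewrite /hs; apply: contB; last by cont; exact: continuous_profile.
by case: eqP => _; [exact: continuous_diag_coef|exact: contC].
Qed.

Lemma w_le i x : 0 <= x -> `|w i x| <= eps s t * tau x.
Proof.
move=> x0; have [_ _ _ h _] := hw i; apply: le_trans (h x x0) _.
have /andP[e0 _] := @eps_bounds R s t; apply: ler_wpM2l; first lra.
by rewrite ler_piMr ?tau_ge0// om_le1.
Qed.

Lemma profile_tau i x : 0 <= x -> 95 / 100 * tau x <= v i x <= 103 / 100 * tau x.
Proof.
move=> x0; have /andP[t1 t2] := tk_tau s t i x0; have := w_le i x0; have t0 := tau_ge0 x0.
have /andP[e0 e1] := @eps_bounds R s t; have et : eps s t * tau x <= 1 / 100 * tau x by nra.
have et2 : eps s t * tau x <= 2 / 250 * tau x by nra.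
rewrite ler_norml => /andP[h1 h2]; rewrite /profile; apply/andP; split; lra.
Qed.

Lemma sqr_diff_le i x : 0 <= x ->
  `|v i x ^+ 2 - tk (k i) x ^+ 2| <= eps s t * (41 / 20) * tau x ^+ 2.
Proof.
move=> x0; have /andP[t1 t2] := tk_tau s t i x0; have hx := w_le i x0; have t0 := tau_ge0 x0.
have -> : v i x ^+ 2 - tk (k i) x ^+ 2 = w i x * (2 * tk (k i) x + w i x) by rewrite /profile; ring.
have /andP[e0 e1] := @eps_bounds R s t; have et : eps s t * tau x <= 1 / 100 * tau x by nra.
have -> : eps s t * (41 / 20) * tau x ^+ 2 = (eps s t * tau x) * (41 / 20 * tau x) by ring.
rewrite normrM; apply: ler_pM; [exact: normr_ge0|exact: normr_ge0|exact: hx|].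
by move: hx; rewrite !ler_norml => /andP[h1 h2]; apply/andP; split; lra.
Qed.

(** The subtracted sum consists of the couplings times positive functions, while the rest is of
    order [eps]. This separation yields the sign of [pert] in the outer components. *)
Lemma pert_main i x : 0 <= x ->
  `|pert i x - \sum_(j < 3) c i j / 4 * (3 * v i x ^+ 2 - v j x ^+ 2)| <=
  3 / 4 * be s t i * (eps s t * (41 / 20)) * tau x ^+ 2.
Proof.
move=> x0; rewrite pertE addrK normrN normrM.
have /andP[b0 _] := @be_bounds R s t i.
have b1 : 0 <= 3 / 4 * be s t i :> R by lra.
by rewrite (ger0_norm b1) -[leRHS]mulrA; apply: ler_wpM2l => //; exact: sqr_diff_le.
Qed.

Lemma pert_le i x : 0 <= x -> `|pert i x| <= 1 / 24 * tau x ^+ 2.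
Proof.
move=> x0; rewrite pertE; apply: le_trans (ler_normD _ _) _; rewrite normrN.
have := sqr_diff_le i x0; have t0 := tau_ge0 x0; have T0 := sqr_ge0 (tau x).
have /andP[b0 b1] := @be_bounds R s t i; have /andP[e0 e1] := @eps_bounds R s t => hd.
have h1 : `|3 / 4 * be s t i * (v i x ^+ 2 - tk (k i) x ^+ 2)| <= (78 / 100) * (1 / 250 * (41 / 20) * tau x ^+ 2).
  rewrite normrM; apply: ler_pM; [exact: normr_ge0|exact: normr_ge0| |].
    by rewrite ger0_norm; lra.
  apply: le_trans hd _; apply: ler_wpM2r => //; lra.
have h2 : `|\sum_(j < 3) c i j / 4 * (3 * v i x ^+ 2 - v j x ^+ 2)| <= 6 / 100 * (1 / 4 * (229 / 100 * tau x ^+ 2)).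
  apply: le_trans (ler_norm_sum _ _ _) _.
  apply: (@le_trans _ _ ((\sum_(j < 3) `|c i j|) * (1 / 4 * (229 / 100 * tau x ^+ 2)))); last first.
    by apply: ler_wpM2r; [lra|exact: cpl_sum_le].
  rewrite mulr_suml; apply: ler_sum => j _; rewrite !normrM -mulrA; apply: ler_wpM2l => //.
  apply: ler_pM; [exact: normr_ge0|exact: normr_ge0|by rewrite ger0_norm; lra|].
  have /andP[p1 p2] := profile_tau i x0; have /andP[q1 q2] := profile_tau j x0.
  by rewrite ler_norml; apply/andP; split; nra.
lra.
Qed.

Definition lin_rhs lam (h : 'I_3 -> R -> R) i x : R :=
  lam * h i x - \sum_(j < 3) hs i j x * h j x.

Definition lin_sol lam (h h1 : 'I_3 -> R -> R) := forall i x, 0 <= x ->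
  is_derive x 1 (h i) (h1 i x) /\ is_derive x 1 (h1 i) (lin_rhs lam h i x).

Definition lin_force lam (u : 'I_3 -> R -> R) i x : R :=
  (pert i x - lam) * u i x - \sum_(j < 3) c i j / 2 * (v i x * v j x) * u j x.

(** Half of the right side of [majorant_even], so the fixed point map contracts by 1/2. The term
    1/25 is twice the largest lam, and 1/5 exceeds twice the size of the perturbation and
    couplings. *)
Lemma lin_force_le lam u i x d : 0 <= lam <= 1 / 50 -> 0 <= x -> 0 <= d ->
  (forall j, `|u j x| <= d) -> `|lin_force lam u i x| <= 1 / 2 * (1 / 5 * tk (k i) x ^+ 2 + 1 / 25) * d.
Proof.
move=> /andP[l0 l1] x0 d0 hu; rewrite /lin_force; apply: le_trans (ler_normB _ _) _.
have t0 := tau_ge0 x0; have /andP[t1 _] := tk_tau s t i x0.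
have T1 : tau x ^+ 2 <= 109 / 100 * tk (k i) x ^+ 2 by nra.
have T0 := sqr_ge0 (tau x).
have h1 : `|(pert i x - lam) * u i x| <= (1 / 24 * tau x ^+ 2 + 1 / 50) * d.
  rewrite normrM; apply: ler_pM; [exact: normr_ge0|exact: normr_ge0| |exact: hu].
  by apply: le_trans (ler_normB _ _) _; apply: lerD; [exact: pert_le|rewrite ger0_norm].
have h2 : `|\sum_(j < 3) c i j / 2 * (v i x * v j x) * u j x| <= 6 / 100 * (1 / 2 * (107 / 100 * tau x ^+ 2) * d).
  apply: le_trans (ler_norm_sum _ _ _) _.
  apply: (@le_trans _ _ ((\sum_(j < 3) `|c i j|) * (1 / 2 * (107 / 100 * tau x ^+ 2) * d))); last first.
    by apply: ler_wpM2r; [apply: mulr_ge0 => //; lra|exact: cpl_sum_le].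
  rewrite mulr_suml; apply: ler_sum => j _.
  have -> : c i j / 2 * (v i x * v j x) * u j x = c i j * (1 / 2 * (v i x * v j x) * u j x) by field.
  rewrite normrM; apply: ler_wpM2l; first exact: normr_ge0.
  rewrite normrM; apply: ler_pM; [exact: normr_ge0|exact: normr_ge0| |exact: hu].
  have /andP[p1 p2] := profile_tau i x0; have /andP[q1 q2] := profile_tau j x0.
  by rewrite ger0_norm; nra.
apply: le_trans (lerD h1 h2) _.
have -> : (1 / 24 * tau x ^+ 2 + 1 / 50) * d + 6 / 100 * (1 / 2 * (107 / 100 * tau x ^+ 2) * d) =
  ((1 / 24 * tau x ^+ 2 + 1 / 50) + 6 / 100 * (1 / 2 * (107 / 100 * tau x ^+ 2))) * d by ring.
by apply: ler_wpM2r => //; lra.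
Qed.

End linearization.

(** * Decaying solutions on the half-line *)

Section dirichlet.
Context {R : realType} (s t : sign) (w w1 : 'I_3 -> R -> R).
Hypothesis hw : wave_data s t w w1.
Local Notation k := (@kk R s t).
Implicit Types (i j : 'I_3) (x lam : R).

Lemma Tk_even_bound (l : R) (F : R -> R) d : kink_rate l -> continuous F -> 0 <= d ->
  (forall x, 0 <= x -> `|F x| <= 1 / 2 * (1 / 5 * tk l x ^+ 2 + 1 / 25) * (d * om x)) ->
  let e := d / 2 in
  exists h1, sol l F (Tk l F) h1 /\ forall x, 0 <= x ->
    `|Tk l F x| <= d / 2 * om x /\
    `|wronsk l (Tk l F) h1 x| <=
      wronsk l (Sq l (3 / 2 * e) (- (1 / 2 * e)) 0) (Sq1 l (3 / 2 * e) (- (1 / 2 * e)) 0) x.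
Proof.
move=> hk cF d0 FK e; have [kp _] := hk.
have e0 : 0 <= e by rewrite /e; lra.
have mj := majorant_Sq (3 / 2 * e) (- (1 / 2 * e)) 0 kp.
have FS x : 0 <= x -> `|F x| <= pot l x * Sq l (3 / 2 * e) (- (1 / 2 * e)) 0 x
   - Sq2 l (3 / 2 * e) (- (1 / 2 * e)) 0 x.
  move=> x0; refine (le_trans _ (majorant_even hk e0 x0)); apply: le_trans (FK x x0) _.
  by rewrite /e; lra.
have [h [h1 [sh _]]] := sol_exists cF mj FS.
have [g1 sg] := TkP sh; exists g1; split; first exact: sg.
move=> x x0; have [b1 b2] := sol_le cF mj FS sg x0; split; last exact: b2.
apply: le_trans b1 _; rewrite /Sq [leRHS]mulrC.
have o0 := om_gt0 x0; have t0 := tk_ge0 (ltW kp) x0; have /ltW t1 := tk_lt1 l x.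
apply: ler_wpM2l; first exact: ltW.
have -> : 3 / 2 * e * tk l x + - (1 / 2 * e) * tk l x ^+ 2 + 0 * tk l x ^+ 3 =
  e * (1 - (1 - tk l x) * (2 - tk l x) / 2) by field.
rewrite -/e; apply: ler_piMr => //; nra.
Qed.

Lemma psi_om (l x : R) : kink_rate l -> 0 <= x -> psi l x <= 2 * om x.
Proof.
move=> [kp /andP[k1 k2]] x0.
have h := psi_le (ltW kp) x0; have p0 := psi_gt0 l x.
rewrite /om ler_pdivlMr ?om_den_gt0//.
have a1 := @al_le R; have kl : 33 / 100 <= l by nra.
have ax : al * x <= l * x by rewrite ler_wpM2r//; lra.
have y0 : 0 <= l * x by rewrite mulr_ge0// ltW.
move: (l * x) (al * x) y0 ax h => y z y0 zy h.
have h2 : 1 + z <= 2 * (1 + y ^+ 2 / 2) ^+ 2 by have := sqr_ge0 (y - 1); nra.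
apply: (@le_trans _ _ (psi l x * (2 * (1 + y ^+ 2 / 2) ^+ 2))); last lra.
by rewrite ler_wpM2l// ltW.
Qed.

Lemma Tk0 (l : R) : Tk l (fun=> 0) = fun=> 0.
Proof.
have s0 : sol l (fun=> 0) (fun=> 0) (fun=> 0 : R).
  split => //; [by move=> x; exact: derC|by move=> x; rewrite mulr0 subrr; exact: derC|].
  move=> e e0; exists 0 => x _; rewrite /wronsk mulr0 addr0 mulr0 normr0; exact: ltW.
have [g1 sg] := TkP s0; apply/funext => x.
by have [] := sol_unique sg s0 x.
Qed.

(** The boundary values are carried by a_i psi, which solves the scalar problem, and the remainder
    vanishes at 0. Since psi <= 2 om, the first iterate has norm at most 2 and the solution at most
    4. *)
Lemma dirichlet_exists lam (a : 'I_3 -> R) : 0 <= lam <= 1 / 50 ->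
  (forall i, `|a i| <= 1) ->
  exists h h1, [/\ lin_sol s t w lam h h1, forall i, h i 0 = a i,
    forall i x, 0 <= x -> `|h i x| <= 4 * om x &
    forall i, exists C, forall x, 0 <= x -> `|h1 i x| <= C * om x].
Proof.
move=> hl a1.
pose P (u : 'I_3 * R -> R) := forall i, continuous (fun x => u (i, x)) /\
  forall x, u (i, - x) = u (i, x).
pose cur (u : 'I_3 * R -> R) i x := u (i, x).
pose F u i := lin_force s t w lam (cur u) i.
pose H u i x := a i * psi (k i) x + Tk (k i) (F u i) x.
(* Only x >= 0 matters. The even extension provides the continuous function on the whole line that
   the solution operator expects, and its corner at 0 is harmless. *)
pose T u (y : 'I_3 * R) := H u y.1 `|y.2|.
pose m (y : 'I_3 * R) := om `|y.2|.
have cF u i : P u -> continuous (F u i).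
  move=> Pu; have cu j : continuous (cur u j) by exact: (Pu j).1.
  rewrite /F /lin_force; cont; by [exact: continuous_pert hw i|exact: continuous_profile hw _|exact: cu].
have rate i : kink_rate (k i) by exact: kk_rate.
have FB u i d : P u -> 0 <= d -> (forall y, `|u y| <= d * m y) ->
   forall x, 0 <= x -> `|F u i x| <= 1 / 2 * (1 / 5 * tk (k i) x ^+ 2 + 1 / 25) * (d * om x).
  move=> Pu d0 Bu x x0; apply: (lin_force_le hw) => //.
    by apply: mulr_ge0 => //; exact/ltW/om_gt0.
  by move=> j; have := Bu (j, x); rewrite /m/= (ger0_norm x0).
have m0 y : 0 <= m y by exact/ltW/om_gt0.
have P0 : P (fun=> 0) by move=> i; split => //; exact: contC.
have PT u : P u -> (forall y, `|u y| <= 2 * 2 * m y) -> P (T u).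
  move=> Pu Bu i; have d4 : 0 <= 2 * 2 :> R by lra.
  have [h1 [[_ dh _ _] _]] := Tk_even_bound (rate i) (cF u i Pu) d4 (FB u i _ Pu d4 Bu).
  split; last by move=> x; rewrite /T/= normrN.
  apply: (@cont_comp _ (H u i) Num.norm); last exact: norm_continuous.
  rewrite /H; cont; first exact: continuous_psi.
  by move=> x; exact: der_continuous (dh x).
have T0 y : `|T (fun=> 0) y| <= 2 * m y.
  rewrite /T /H (_ : F (fun=> 0) y.1 = fun=> 0); last first.
    by apply/funext => x; rewrite /F /lin_force /cur mulr0 big1 ?subr0// => j _; rewrite mulr0.
  rewrite Tk0 addr0 normrM (gtr0_norm (psi_gt0 _ _)).
  apply: (@le_trans _ _ (1 * psi (k y.1) `|y.2|)).
    by apply: ler_wpM2r; [exact/ltW/psi_gt0|exact: a1].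
  by rewrite mul1r; exact: psi_om.
have contr u z d : P u -> P z -> (forall y, `|u y| <= 2 * 2 * m y) ->
    (forall y, `|z y| <= 2 * 2 * m y) -> 0 <= d ->
    (forall y, `|u y - z y| <= d * m y) -> forall y, `|T u y - T z y| <= d / 2 * m y.
  move=> Pu Pz Bu Bz d0 uz [i x].
  have d4 : 0 <= 2 * 2 :> R by lra.
  have [hu [su _]] := Tk_even_bound (rate i) (cF u i Pu) d4 (FB u i _ Pu d4 Bu).
  have [hz [sz _]] := Tk_even_bound (rate i) (cF z i Pz) d4 (FB z i _ Pz d4 Bz).
  pose uz' y := u y - z y.
  have Puz : P uz'.
    move=> j; split; first by rewrite /uz'; cont; [exact: (Pu j).1|exact: (Pz j).1].
    by move=> y; rewrite /uz' (Pu j).2 (Pz j).2.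
  have [g [sg hg]] := Tk_even_bound (rate i) (cF _ i Puz) d0 (FB _ i _ Puz d0 uz).
  have FE : F uz' i = fun x => F u i x - F z i x.
    apply/funext => y; rewrite /F /lin_force /cur /uz' !sum3; ring.
  have := sol_sub su sz; rewrite -FE => suz; have [e _] := sol_unique suz sg `|x|.
  rewrite /T /H/= opprD addrACA subrr add0r; move: e => /= ->.
  by have [] := hg `|x| (normr_ge0 x).
have Pcl (u_ : nat -> 'I_3 * R -> R) u : (forall n, P (u_ n)) ->
    (forall n y, `|u_ n y - u y| <= 2 * 2 * (1 / 2) ^+ n * m y) -> P u.
  move=> Pu_ hu.
  have hu' n y : `|u_ n y - u y| <= 2 * 2 * (1 / 2) ^+ n.
    apply: le_trans (hu n y) _; apply: ler_piMr; last exact: om_le1.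
    by apply: mulr_ge0; [lra|apply: exprn_ge0; lra].
  move=> i; split.
    apply: (@uniform_limit_continuous R (fun n x => u_ n (i, x)) _ (2 * 2)) => [n|n x].
      exact: (Pu_ n i).1.
    exact: hu'.
  move=> x; apply/eqP; rewrite -subr_eq0; apply/eqP.
  apply: (@geometric_small R (2 * (2 * 2))) => n.
  have -> : u (i, - x) - u (i, x) = - (u_ n (i, - x) - u (i, - x)) + (u_ n (i, x) - u (i, x)).
    by rewrite (Pu_ n i).2; ring.
  apply: le_trans (ler_normD _ _) _; rewrite normrN.
  by have := hu' n (i, - x); have := hu' n (i, x); lra.
have C0 : 0 <= 2 :> R by lra.
have [u [Pu Bu Tu]] := picard m0 C0 P0 PT T0 contr Pcl.
have d4 : 0 <= 2 * 2 :> R by lra.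
have Hsol i : exists h1 : R -> R, (forall x, is_derive x 1 (H u i) (h1 x)) /\
    (forall x, is_derive x 1 h1 (pot (k i) x * H u i x - F u i x)) /\
    (H u i 0 = a i) /\ exists C, forall x, 0 <= x -> `|h1 x| <= C * om x.
  have [g1 [[g0 dg dg1 _] hg]] := Tk_even_bound (rate i) (cF u i Pu) d4 (FB u i _ Pu d4 Bu).
  exists (fun x => a i * (- 2 * k i * tk (k i) x * psi (k i) x) + g1 x).
  have kp := @kk_gt0 R s t i.
  split; first by move=> x; rewrite /H; der; ring.
  split; first by move=> x; rewrite /H; der; rewrite /pot /psi; ring.
  split; first by rewrite /H psi0 g0 mulr1 addr0.
  eexists => x x0; have [b1 /(wronsk_norm_le kp x0) b2] := hg x x0.
  have o0 := om_gt0 x0.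
  apply: le_trans (ler_normD _ _) _; apply: le_trans (lerD _ b2) _.
    rewrite normrM; apply: (@le_trans _ _ (1 * (2 * k i * (2 * om x)))).
      apply: ler_pM; [exact: normr_ge0|exact: normr_ge0|exact: a1|].
      rewrite -mulrA normrM; apply: ler_pM; [exact: normr_ge0|exact: normr_ge0| |].
        by rewrite mulNr normrN ger0_norm; lra.
      have t0 := tk_ge0 (ltW kp) x0; have /ltW t1 := tk_lt1 (k i) x.
      rewrite ger0_norm; last by apply: mulr_ge0 => //; exact/ltW/psi_gt0.
      by apply: le_trans (psi_om (rate i) x0); apply: ler_piMl => //; exact/ltW/psi_gt0.
    exact: lexx.
  have b4 : 2 * k i * `|Tk (k i) (F u i) x| <= 2 * k i * (2 * 2 / 2 * om x).
    by apply: ler_wpM2l => //; lra.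
  by apply: le_trans (lerD (lexx _) (lerD b4 (lexx _))) _; rewrite mulrA !mulrA -!mulrDl; exact: lexx.
have [h1 hh1] := choice Hsol.
have HE i x : 0 <= x -> H u i x = u (i, x).
  by move=> x0; rewrite -Tu /T/= (ger0_norm x0).
exists (fun i => H u i), h1; split.
- move=> i x x0; have [d1 [d2 _]] := hh1 i; split; first exact: d1.
  apply: (is_derive_eq (d2 x)); rewrite /lin_rhs hs_sum /F /lin_force /cur.
  under [in RHS]eq_bigr do rewrite HE//.
  by rewrite HE//; ring.
- by move=> i; have [_ [_ []]] := hh1 i.
- move=> i x x0; rewrite HE//; have := Bu (i, x); rewrite /m/= (ger0_norm x0).
  by rewrite (_ : 2 * 2 = 4 :> R); [exact: id|ring].
- by move=> i; have [_ [_ []]] := hh1 i.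
Qed.

End dirichlet.

(** * Lower bounds for the quadratic form *)

Section minorants.
Context {R : realType}.
Implicit Types (k a x nu : R) (h low : R -> R).

(** The integral of h'^2 + pot h^2 over the half-line is at least that of [low], stated pointwise up
    to the derivative of [Bd]. The last two conditions make the boundary terms disappear at 0 and,
    for square integrable h, far out. *)
Definition minorant k h (h1 : R -> R) low := exists Bd Bd1 C,
  [/\ forall x, 0 <= x -> is_derive x 1 Bd (Bd1 x),
      forall x, 0 <= x -> Bd1 x + low x <= h1 x ^+ 2 + pot k x * h x ^+ 2,
      Bd 0 = 0 &
      forall x, 0 <= x -> `|Bd x| <= C * (h x ^+ 2 + psi k x ^+ 2)].

Lemma minorant_le k h h1 low low' : (forall x, 0 <= x -> low' x <= low x) ->
  minorant k h h1 low -> minorant k h h1 low'.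
Proof.
move=> ll [Bd [Bd1 [C [d1 d2 d3 d4]]]]; exists Bd, Bd1, C; split => // x x0.
by apply: le_trans (d2 x x0); rewrite lerD2l ll.
Qed.

Lemma minorant_mix k h h1 low low' c : 0 <= c <= 1 -> minorant k h h1 low ->
  minorant k h h1 low' -> minorant k h h1 (fun x => c * low x + (1 - c) * low' x).
Proof.
move=> /andP[c0 c1] [B [B1 [C [d1 d2 d3 d4]]]] [B' [B1' [C' [e1 e2 e3 e4]]]].
have c2 : 0 <= 1 - c by rewrite subr_ge0.
exists (fun x => c * B x + (1 - c) * B' x), (fun x => c * B1 x + (1 - c) * B1' x),
  (c * C + (1 - c) * C'); split.
- by move=> x x0; have := d1 x x0 => ?; have := e1 x x0 => ?; der; ring.
- move=> x x0; have := ler_wpM2l c0 (d2 x x0); have := ler_wpM2l c2 (e2 x x0); lra.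
- by rewrite d3 e3; ring.
- move=> x x0; have h1' := ler_wpM2l c0 (d4 x x0); have h2' := ler_wpM2l c2 (e4 x x0).
  apply: le_trans (ler_normD _ _) _; rewrite !normrM (ger0_norm c0) (ger0_norm c2); lra.
Qed.

(* Completing the square with the logarithmic derivative of sech^nu. *)
Lemma minorant_sech k nu h h1 : 0 < k -> 0 <= nu ->
  (forall x, 0 <= x -> is_derive x 1 h (h1 x)) ->
  minorant k h h1 (fun x => k ^+ 2 * ((6 - nu * (nu + 1)) * tk k x ^+ 2 - (2 - nu)) * h x ^+ 2).
Proof.
move=> k0 nu0 dh.
exists (fun x => - (nu * k) * tk k x * h x ^+ 2),
  (fun x => - (nu * k) * (k * (1 - tk k x ^+ 2) * h x ^+ 2 + tk k x * (2 * h x * h1 x))), (nu * k); split.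
- by move=> x x0; have := dh x x0 => ?; der; rewrite /psi; ring.
- move=> x x0; rewrite /pot -subr_ge0.
  have -> : h1 x ^+ 2 + k ^+ 2 * (6 * tk k x ^+ 2 - 2) * h x ^+ 2 -
   (- (nu * k) * (k * (1 - tk k x ^+ 2) * h x ^+ 2 + tk k x * (2 * h x * h1 x)) +
    k ^+ 2 * ((6 - nu * (nu + 1)) * tk k x ^+ 2 - (2 - nu)) * h x ^+ 2) =
   (h1 x + nu * k * tk k x * h x) ^+ 2 by ring.
  exact: sqr_ge0.
- by rewrite tk0 mulr0 mul0r.
- move=> x x0; have t0 := tk_ge0 (ltW k0) x0; have /ltW t1 := tk_lt1 k x.
  have nk : 0 <= nu * k by rewrite mulr_ge0// ltW.
  have th0 : 0 <= tk k x * h x ^+ 2 by apply: mulr_ge0 => //; exact: sqr_ge0.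
  rewrite -mulrA mulNr normrN (ger0_norm (mulr_ge0 nk th0)); apply: ler_wpM2l => //.
  have := sqr_ge0 (h x); have := sqr_ge0 (psi k x); nra.
Qed.

(** The case nu = 2 of sech^nu is psi itself, whose energy is zero. *)
Lemma minorant0 k h h1 : 0 < k -> (forall x, 0 <= x -> is_derive x 1 h (h1 x)) ->
  minorant k h h1 (fun=> 0).
Proof.
move=> k0 dh; have h2 : 0 <= 2 :> R by lra.
by apply: minorant_le (minorant_sech k0 h2 dh) => x _; lra.
Qed.

(* Gap of the odd sector: [k (1 / (t + 1/20) - 2 t - 1/10)] is a regular approximation of
   the logarithmic derivative of the odd bound state, and it may be used
   for g because g vanishes at 0. *)
Lemma minorant_gap k a h h1 : 0 < k -> h 0 = a ->
  (forall x, 0 <= x -> is_derive x 1 h (h1 x)) ->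
  minorant k h h1 (fun x => 5 / 2 * k ^+ 2 * (h x - a * psi k x) ^+ 2).
Proof.
move=> k0 h0 dh.
pose g x := h x - a * psi k x.
pose g1 x := h1 x + a * (2 * k * tk k x * psi k x).
pose p x := (tk k x + 1 / 20)^-1.
pose r2 x := k * (p x - 2 * tk k x - 1 / 10).
pose r21 x := - (k ^+ 2 * (1 - tk k x ^+ 2) * (p x ^+ 2 + 2)).
have tp x : 0 <= x -> 0 < tk k x + 1 / 20.
  by move=> x0; have := tk_ge0 (ltW k0) x0; lra.
have dg x : 0 <= x -> is_derive x 1 g (g1 x).
  by move=> x0; have := dh x x0 => ?; rewrite /g; der; rewrite /g1; ring.
have dr x : 0 <= x -> is_derive x 1 r2 (r21 x).
  move=> x0; have n0 : tk k x + 1 / 20 != 0 by rewrite gt_eqF// tp.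
  by rewrite /r2 /p; der; [exact: n0|rewrite /r21 /p /psi -!exprVn; ring].
(* With h = a psi + g, the logarithmic derivative of psi is used for h^2 - g^2 and [r2] for g^2. All
   these terms vanish at 0 because g does. *)
exists (fun x => (- 2 * k * tk k x) * h x ^+ 2 - (- 2 * k * tk k x) * g x ^+ 2 + r2 x * g x ^+ 2),
  (fun x => - 2 * k ^+ 2 * (1 - tk k x ^+ 2) * (h x ^+ 2 - g x ^+ 2) +
   (- 2 * k * tk k x) * (2 * h x * h1 x - 2 * g x * g1 x) + r21 x * g x ^+ 2 + r2 x * (2 * g x * g1 x)),
  (2 * k + (4 + 2 * a ^+ 2) * (2 * k + k * 23)); split.
- move=> x x0; have := dh x x0 => ?; have := dg x x0 => ?; have := dr x x0 => ?.
  by der; rewrite /psi; ring.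
- move=> x x0; have := tp x x0; have t0 := tk_ge0 (ltW k0) x0; have /ltW t1 := tk_lt1 k x => tpx.
  rewrite -/(g x).
  (* The odd bound state sech * tanh has eigenvalue 3 k^2. The shift 1/20, which removes the pole at
     0, lowers the constant to 5/2. *)
  have gap : 5 / 2 * k ^+ 2 <= pot k x - r21 x - r2 x ^+ 2.
    have px : p x * (tk k x + 1 / 20) = 1 by rewrite /p mulVf// gt_eqF.
    have p0 : 0 < p x by rewrite /p invr_gt0.
    rewrite -subr_ge0.
    have -> : pot k x - r21 x - r2 x ^+ 2 - 5 / 2 * k ^+ 2 = k ^+ 2 *
      (6 * tk k x ^+ 2 - 2 + (1 - tk k x ^+ 2) * (p x ^+ 2 + 2) - (p x - 2 * tk k x - 1 / 10) ^+ 2 - 5 / 2).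
      by rewrite /pot /r21 /r2; ring.
    apply: mulr_ge0; first exact: sqr_ge0.
    rewrite -(@pmulr_rge0 _ ((tk k x + 1 / 20) ^+ 2)) ?exprn_gt0//.
    move: (p x) px p0 => q qt q0; move: (tk k x) t0 t1 tpx qt => u u0 u1 up qt.
    have -> : (u + 1 / 20) ^+ 2 * (6 * u ^+ 2 - 2 + (1 - u ^+ 2) * (q ^+ 2 + 2) - (q - 2 * u - 1 / 10) ^+ 2 - 5 / 2) =
      (u + 1 / 20) ^+ 2 * (6 * u ^+ 2 - 2 - 5 / 2) + (1 - u ^+ 2) * ((q * (u + 1 / 20)) ^+ 2 + 2 * (u + 1 / 20) ^+ 2)
      - (q * (u + 1 / 20) - (2 * u + 1 / 10) * (u + 1 / 20)) ^+ 2 by ring.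
    rewrite qt expr1n; nra.
  rewrite -subr_ge0.
  have -> : h1 x ^+ 2 + pot k x * h x ^+ 2 -
    (- 2 * k ^+ 2 * (1 - tk k x ^+ 2) * (h x ^+ 2 - g x ^+ 2) +
    - 2 * k * tk k x * (2 * h x * h1 x - 2 * g x * g1 x) + r21 x * g x ^+ 2 +
    r2 x * (2 * g x * g1 x) + 5 / 2 * k ^+ 2 * g x ^+ 2) =
    (g1 x - r2 x * g x) ^+ 2 + (pot k x - r21 x - r2 x ^+ 2 - 5 / 2 * k ^+ 2) * g x ^+ 2.
    by rewrite /g1 /g /pot; ring.
  by apply: addr_ge0; [exact: sqr_ge0|apply: mulr_ge0; [lra|exact: sqr_ge0]].
- by rewrite /g h0 psi0 tk0 mulr1 subrr; ring.
- move=> x x0; have := tp x x0; have t0 := tk_ge0 (ltW k0) x0; have /ltW t1 := tk_lt1 k x => tpx.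
  have p1 : 0 < p x by rewrite /p invr_gt0.
  have p2 : p x <= 20.
    by rewrite /p invf_ple ?posrE//; lra.
  have g2 : g x ^+ 2 <= (4 + 2 * a ^+ 2) * (h x ^+ 2 + psi k x ^+ 2).
    have := sqr_ge0 (h x + a * psi k x); have := mulr_ge0 (sqr_ge0 a) (sqr_ge0 (h x)).
    have := sqr_ge0 (h x); have := sqr_ge0 (psi k x); rewrite /g; lra.
  have n1 (y c : R) : `|c| <= k * 23 -> `|c * y ^+ 2| <= k * 23 * y ^+ 2.
    by move=> hc; rewrite normrM (ger0_norm (sqr_ge0 _)); apply: ler_wpM2r => //; exact: sqr_ge0.
  have n2 (y : R) : `|- 2 * k * tk k x * y ^+ 2| <= 2 * k * y ^+ 2.
    rewrite normrM (ger0_norm (sqr_ge0 _)); apply: ler_wpM2r; first exact: sqr_ge0.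
    by rewrite ler_norml; apply/andP; split; nra.
  have r2n : `|r2 x| <= k * 23.
    by rewrite /r2 normrM (gtr0_norm k0); apply: ler_wpM2l; [exact: ltW|rewrite ler_norml; apply/andP; split; lra].
  apply: le_trans (ler_normD _ _) _; apply: le_trans (lerD (ler_normB _ _) (n1 (g x) _ r2n)) _.
  apply: le_trans (lerD (lerD (n2 (h x)) (n2 (g x))) (lexx _)) _.
  have h3 := ler_wpM2l (mulr_ge0 (ltW k0) (ler0n _ 25)) g2.
  have := mulr_ge0 (ltW k0) (sqr_ge0 (psi k x)).
  lra.
Qed.

End minorants.

(** * The quadratic form of the coupled linearization *)

Section forms.
Context {R : realType} (s t : sign) (w w1 : 'I_3 -> R -> R).
Hypothesis hw : wave_data s t w w1.
Local Notation k := (@kk R s t).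
Local Notation c := (@cpl R s t).
Local Notation v := (profile s t w).
Local Notation hess := (hs s t w).
Local Notation pi_ := (pert s t w).
Implicit Types (i j : 'I_3) (x lam : R).

(** Density of the energy form of lam minus the linearized operator. If (h, h1) solves the linear
    problem at lam, it is the derivative of the boundary term h1 g. *)
Definition bform lam (h h1 g g1 : 'I_3 -> R -> R) x : R :=
  \sum_(i < 3) (h1 i x * g1 i x - g i x * (\sum_(j < 3) hess i j x * h j x) + lam * (h i x * g i x)).

Definition form lam (h h1 : 'I_3 -> R -> R) := bform lam h h1 h h1.

Definition qform (h : 'I_3 -> R -> R) x : R :=
  pi_ 0 x * h 0 x ^+ 2 + pi_ 1 x * h 1 x ^+ 2 + pi_ 2 x * h 2 x ^+ 2
  - c 0 1 * (v 0 x * v 1 x) * h 0 x * h 1 x - c 1 2 * (v 1 x * v 2 x) * h 1 x * h 2 x.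

Lemma formE lam h h1 x : form lam h h1 x =
  \sum_(i < 3) (h1 i x ^+ 2 + pot (k i) x * h i x ^+ 2) - qform h x + lam * \sum_(i < 3) h i x ^+ 2.
Proof.
rewrite /form /bform; under eq_bigr do rewrite hs_sum.
by rewrite /qform !sum3 /cpl /=; field.
Qed.

(** Nonnegativity of the energy over the half-line, in the same pointwise form as [minorant]. *)
Definition nonneg_form lam (h h1 : 'I_3 -> R -> R) := exists (Bd Bd1 : R -> R) (C : R),
  [/\ forall x, 0 <= x -> is_derive x 1 Bd (Bd1 x),
      forall x, 0 <= x -> Bd1 x <= form lam h h1 x, Bd 0 = 0 &
      forall x, 0 <= x -> `|Bd x| <= C * \sum_(i < 3) (h i x ^+ 2 + psi (k i) x ^+ 2)].

Lemma nonneg_form_minorants lam h h1 (low : 'I_3 -> R -> R) :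
  (forall i, minorant (k i) (h i) (h1 i) (low i)) ->
  (forall x, 0 <= x -> qform h x <= lam * \sum_(i < 3) h i x ^+ 2 + \sum_(i < 3) low i x) ->
  nonneg_form lam h h1.
Proof.
move=> /choice[Bd /choice[Bd1 /choice[C hB]]] hq.
exists (fun x => \sum_(i < 3) Bd i x), (fun x => \sum_(i < 3) Bd1 i x), (\sum_(i < 3) `|C i|); split.
- move=> x x0; have [d0 _ _ _] := hB 0; have [d1 _ _ _] := hB 1; have [d2 _ _ _] := hB 2.
  rewrite (_ : (fun x => _) = fun x => Bd 0 x + Bd 1 x + Bd 2 x); last by apply/funext => y; rewrite sum3.
  have := d0 x x0 => ?; have := d1 x x0 => ?; have := d2 x x0 => ?.
  by der; rewrite sum3.
- move=> x x0; rewrite formE.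
  have : \sum_(i < 3) (Bd1 i x + low i x) <= \sum_(i < 3) (h1 i x ^+ 2 + pot (k i) x * h i x ^+ 2).
    by apply: ler_sum => i _; have [_ h2 _ _] := hB i; exact: h2.
  rewrite big_split /=; have := hq x x0; lra.
- by rewrite big1// => i _; have [] := hB i.
- move=> x x0; apply: le_trans (ler_norm_sum _ _ _) _; rewrite mulr_suml; apply: ler_sum => i _.
  have [_ _ _ h4] := hB i; apply: le_trans (h4 x x0) _.
  have p j : 0 <= h j x ^+ 2 + psi (k j) x ^+ 2 by apply: addr_ge0; exact: sqr_ge0.
  apply: (@le_trans _ _ (`|C i| * (h i x ^+ 2 + psi (k i) x ^+ 2))).
    by apply: ler_wpM2r => //; exact: ler_norm.
  apply: ler_wpM2l => //; rewrite (bigD1 i)//= lerDl; apply: sumr_ge0 => j _; exact: p.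
Qed.

(** Young's inequality. The weight m is free, so that a cross term can be shifted from an outer
    component to the middle one. *)
Lemma cross_le (a y T h g m M : R) : `|a| <= M -> 0 <= y <= 107 / 100 * T -> 0 < m ->
  - a * y * h * g <= M * (107 / 200 * T) * (m * h ^+ 2 + g ^+ 2 / m).
Proof.
move=> ha /andP[y0 y1] m0.
have h1 : - a * y * h * g <= M * (107 / 100 * T) * `|h * g|.
  apply: le_trans (ler_norm _) _; rewrite -mulrA normrM; apply: ler_wpM2r; first exact: normr_ge0.
  by rewrite normrM normrN; apply: ler_pM; [exact: normr_ge0|exact: normr_ge0|exact: ha|rewrite ger0_norm].
apply: le_trans h1 _.
have M0 : 0 <= M by exact: le_trans ha.
have -> : M * (107 / 200 * T) * (m * h ^+ 2 + g ^+ 2 / m) = M * (107 / 100 * T) * ((m * h ^+ 2 + g ^+ 2 / m) / 2).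
  by field; rewrite gt_eqF.
apply: ler_wpM2l; first by apply: mulr_ge0 => //; exact: le_trans y1.
have e1 : m * h ^+ 2 + g ^+ 2 / m = (m * h - g) ^+ 2 / m + 2 * (h * g) by field; rewrite gt_eqF.
have e2 : m * h ^+ 2 + g ^+ 2 / m = (m * h + g) ^+ 2 / m - 2 * (h * g) by field; rewrite gt_eqF.
have p1 : 0 <= (m * h - g) ^+ 2 / m by apply: divr_ge0; [exact: sqr_ge0|exact: ltW].
have p2 : 0 <= (m * h + g) ^+ 2 / m by apply: divr_ge0; [exact: sqr_ge0|exact: ltW].
by rewrite ler_norml; apply/andP; split; [lra|lra].
Qed.

Lemma vv_bounds i j x : 0 <= x ->
  9 / 10 * tau x ^+ 2 <= v i x * v j x <= 107 / 100 * tau x ^+ 2.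
Proof.
move=> x0; have /andP[p1 p2] := profile_tau hw i x0; have /andP[q1 q2] := profile_tau hw j x0.
have t0 := tau_ge0 x0; apply/andP; split.
  apply: (@le_trans _ _ ((95 / 100 * tau x) * (95 / 100 * tau x))); last by apply: ler_pM; lra.
  by have := sqr_ge0 (tau x); lra.
apply: (@le_trans _ _ ((103 / 100 * tau x) * (103 / 100 * tau x))); first by apply: ler_pM; lra.
by have := sqr_ge0 (tau x); lra.
Qed.

Lemma c01_norm : `|c 0 1| <= 1 / 25.
Proof. by rewrite /cpl /= /signr; case: s; rewrite ler_norml; lra. Qed.

Lemma c12_norm : `|c 1 2| <= 1 / 50.
Proof. by rewrite /cpl /= /signr; case: t; rewrite ler_norml; lra. Qed.

Lemma cube_bounds i j x : 0 <= x ->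
  41 / 25 * tau x ^+ 2 <= 3 * v i x ^+ 2 - v j x ^+ 2 <= 229 / 100 * tau x ^+ 2.
Proof.
move=> x0; have /andP[p1 p2] := profile_tau hw i x0; have /andP[q1 q2] := profile_tau hw j x0.
by have t0 := tau_ge0 x0; apply/andP; split; nra.
Qed.

(** The coupling contributes at most - 1/100 * 41/25 and the corrections at most 3/4 * 96/100 *
    1/250 * 41/20, leaving - 1/100. *)
Lemma pert0_minus x : s = Minus -> 0 <= x -> pi_ 0 x <= - (1 / 100) * tau x ^+ 2.
Proof.
move=> sM x0; have := pert_main hw 0 x0; have /andP[a1 a2] := cube_bounds 0 1 x0.
rewrite sum3 {1 2 3}/cpl /= !mul0r ?add0r ?addr0 sM; rewrite sM in a1.
have -> : be Minus t 0 = 96 / 100 :> R by rewrite /be sum3 /cpl /bb /=; lra.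
have T0 := sqr_ge0 (tau x); have /andP[_ e1] := @eps_bounds R Minus t.
have h : 3 / 4 * (96 / 100) * (eps Minus t * (41 / 20)) * tau x ^+ 2 <= 3 / 4 * (96 / 100) * (1 / 250 * (41 / 20)) * tau x ^+ 2.
  by apply: ler_wpM2r => //; lra.
by rewrite /signr ler_norml => /andP[_ h2]; lra.
Qed.

Lemma pert2_minus x : t = Minus -> 0 <= x -> pi_ 2 x <= - (1 / 5 / 100) * tau x ^+ 2.
Proof.
move=> tM x0; have := pert_main hw 2 x0; have /andP[a1 a2] := cube_bounds 2 1 x0.
rewrite sum3 {1 2 3}/cpl /= !mul0r ?add0r ?addr0 tM; rewrite tM in a1.
have -> : be s Minus 2 = 94 / 100 :> R by rewrite /be sum3 /cpl /bb /=; lra.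
have T0 := sqr_ge0 (tau x); have /andP[_ e1] := @eps_bounds R s Minus.
have h : 3 / 4 * (94 / 100) * (eps s Minus * (41 / 20)) * tau x ^+ 2 <= 3 / 4 * (94 / 100) * (1 / 250 * (41 / 20)) * tau x ^+ 2.
  by apply: ler_wpM2r => //; lra.
by rewrite /signr ler_norml => /andP[_ h2]; lra.
Qed.

Definition pinned i := [|| i == 1, (i == 0) && (if s is Plus then true else false)
  | (i == 2) && (if t is Plus then true else false)].

(** A pinned component has the gap 5/2 k^2 >= 23/80, and an unpinned one has a negative [pert],
    which improves the form. Each outer component passes at most 1/16 h_1^2 to the middle one, where
    1/24 + 1/16 + 1/16 stays below 23/80. *)
Lemma nonneg_form_pinned h h1 : (forall i x, 0 <= x -> is_derive x 1 (h i) (h1 i x)) ->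
  (forall i, pinned i -> h i 0 = 0) -> nonneg_form 0 h h1.
Proof.
move=> dh hZ.
apply: (@nonneg_form_minorants 0 h h1
    (fun i => if pinned i then fun x => 5 / 2 * k i ^+ 2 * (h i x - 0 * psi (k i) x) ^+ 2 else fun=> 0)).
  move=> i; have kp := @kk_gt0 R s t i.
  case: ifP => p; last exact: (minorant0 kp (dh i)).
  exact: (minorant_gap kp (hZ i p) (dh i)).
move=> x x0; rewrite mul0r add0r sum3.
have kb i : 23 / 80 * h i x ^+ 2 <= 5 / 2 * k i ^+ 2 * (h i x - 0 * psi (k i) x) ^+ 2.
  rewrite mul0r subr0 kk2; apply: ler_wpM2r; first exact: sqr_ge0.
  by have /andP[b0 _] := @be_bounds R s t i; lra.
have T0 := sqr_ge0 (tau x); have T1 : tau x ^+ 2 <= 1.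
  by rewrite exprn_ile1 ?tau_ge0// ltW// tau_lt1.
have V i j : 0 <= v i x * v j x <= 107 / 100 * tau x ^+ 2.
  by have /andP[h2 ->] := vv_bounds i j x0; rewrite andbT; lra.
have P i : pi_ i x * h i x ^+ 2 <= 1 / 24 * tau x ^+ 2 * h i x ^+ 2.
  by apply: ler_wpM2r; [exact: sqr_ge0|apply: le_trans (ler_norm _) _; exact: pert_le hw i x x0].
have TH i : tau x ^+ 2 * h i x ^+ 2 <= h i x ^+ 2.
  by apply: ler_piMl => //; exact: sqr_ge0.
have TH0 i : 0 <= tau x ^+ 2 * h i x ^+ 2 by apply: mulr_ge0 => //; exact: sqr_ge0.
have H1 := kb 1; have P1 := P 1; have TH1 := TH 1; have TP1 := TH0 1.
have -> : pinned 1 = true by [].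
have c0 : pi_ 0 x * h 0 x ^+ 2 - c 0 1 * (v 0 x * v 1 x) * h 0 x * h 1 x <=
    (if pinned 0 then fun x => 5 / 2 * k 0 ^+ 2 * (h 0 x - 0 * psi (k 0) x) ^+ 2 else fun=> 0) x + 1 / 16 * h 1 x ^+ 2.
  (* For a negative coupling the outer component offers only 1/100 tau^2: the weight satisfies 1/25
     * 107/200 * 9/20 < 1/100, and its inverse keeps the other share below 1/16. *)
  have m0 : 0 < 9 / 20 :> R by lra.
  have := cross_le (h 0 x) (h 1 x) c01_norm (V 0 1) m0.
  have := TH 0; have := TH0 0; have := P 0; have := kb 0.
  have [E|E] : s = Plus \/ s = Minus by case: s; [left|right].
    have -> : pinned 0 by rewrite /pinned E.
    lra.
  have -> : pinned 0 = false by rewrite /pinned E.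
  have := ler_wpM2r (sqr_ge0 (h 0 x)) (pert0_minus E x0); lra.
have c2 : pi_ 2 x * h 2 x ^+ 2 - c 1 2 * (v 1 x * v 2 x) * h 1 x * h 2 x <=
    (if pinned 2 then fun x => 5 / 2 * k 2 ^+ 2 * (h 2 x - 0 * psi (k 2) x) ^+ 2 else fun=> 0) x + 1 / 16 * h 1 x ^+ 2.
  (* The same balance with |c23| = 1/50 and the weaker gain 1/500. *)
  have m0 : 0 < 9 / 50 :> R by lra.
  have := cross_le (h 2 x) (h 1 x) c12_norm (V 1 2) m0.
  have := TH 2; have := TH0 2; have := P 2; have := kb 2.
  have [E|E] : t = Plus \/ t = Minus by case: t; [left|right].
    have -> : pinned 2 by rewrite /pinned E.
    lra.
  have -> : pinned 2 = false by rewrite /pinned E.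
  have := ler_wpM2r (sqr_ge0 (h 2 x)) (pert2_minus E x0); lra.
rewrite /qform /=; move: c0 c2 => /=; lra.
Qed.

Lemma tau_tk_sqr i x : 0 <= x -> tau x ^+ 2 <= 109 / 100 * tk (k i) x ^+ 2.
Proof. by move=> x0; have t0 := tau_ge0 x0; have /andP[t1 _] := tk_tau s t i x0; nra. Qed.

(** For nu = 37/20 the negative part is k^2 (2 - nu) <= 13/100 * 3/20 = 39/2000, which is lam. The
    remaining multiple of tanh^2 exceeds the perturbation and both cross terms. *)
Lemma nonneg_form_top h h1 : (forall i x, 0 <= x -> is_derive x 1 (h i) (h1 i x)) ->
  nonneg_form (39 / 20 / 100) h h1.
Proof.
move=> dh; pose nu : R := 37 / 20.
have nu0 : 0 <= nu by rewrite /nu; lra.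
apply: (@nonneg_form_minorants _ h h1 (fun i x => k i ^+ 2 * ((6 - nu * (nu + 1)) * tk (k i) x ^+ 2 - (2 - nu)) * h i x ^+ 2)).
  by move=> i; exact: (minorant_sech (kk_gt0 s t i) nu0 (dh i)).
move=> x x0; rewrite mulr_sumr -big_split /=.
have T0 := sqr_ge0 (tau x).
have V i j : 0 <= v i x * v j x <= 107 / 100 * tau x ^+ 2.
  by have /andP[h2 ->] := vv_bounds i j x0; rewrite andbT; lra.
have P i : pi_ i x * h i x ^+ 2 <= 1 / 24 * tau x ^+ 2 * h i x ^+ 2.
  by apply: ler_wpM2r; [exact: sqr_ge0|apply: le_trans (ler_norm _) _; exact: pert_le hw i x x0].
have L i : 76 / 10 / 100 * tau x ^+ 2 * h i x ^+ 2 <=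
    39 / 20 / 100 * h i x ^+ 2 + k i ^+ 2 * ((6 - nu * (nu + 1)) * tk (k i) x ^+ 2 - (2 - nu)) * h i x ^+ 2.
  rewrite -mulrDl; apply: ler_wpM2r; first exact: sqr_ge0.
  have /andP[b0 b1] := @be_bounds R s t i; have := tau_tk_sqr i x0; rewrite kk2 /nu.
  have := sqr_ge0 (tk (k i) x); move: (tk _ _ ^+ 2) (tau x ^+ 2) T0 (be s t i) b0 b1 => u T T0 b b0 b1 u0 Tu.
  nra.
have m0 : 0 < 1 :> R by lra.
have X0 := cross_le (h 0 x) (h 1 x) c01_norm (V 0 1) m0.
have X2 := cross_le (h 1 x) (h 2 x) c12_norm (V 1 2) m0.
have TH0 i : 0 <= tau x ^+ 2 * h i x ^+ 2 by apply: mulr_ge0 => //; exact: sqr_ge0.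
rewrite sum3 /qform.
have := L 0; have := L 1; have := L 2; have := P 0; have := P 1; have := P 2.
have := TH0 0; have := TH0 1; have := TH0 2; lra.
Qed.

End forms.

(** * A sharper form bound for two positive couplings *)

Section both_plus.
Context {R : realType} (w w1 : 'I_3 -> R -> R).
Hypothesis hw : wave_data Plus Plus w w1.
Local Notation k := (@kk R Plus Plus).
Local Notation c := (@cpl R Plus Plus).
Local Notation v := (profile Plus Plus w).
Local Notation pi_ := (pert Plus Plus w).
Implicit Types (i j : 'I_3) (x lam : R).

Lemma be_pp : [/\ be Plus Plus 0 = 104 / 100 :> R, be Plus Plus 1 = 104 / 100 :> R &
  be Plus Plus 2 = 98 / 100 :> R].
Proof. by rewrite /be !sum3 /cpl /bb /signr /=; split; lra. Qed.

Lemma kk_pp01 : k 0 = k 1.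
Proof. by have [b0 b1 _] := be_pp; rewrite /kk b0 b1. Qed.

Lemma pert_pp i x : 0 <= x ->
  `|pi_ i x - \sum_(j < 3) c i j / 4 * (3 * v i x ^+ 2 - v j x ^+ 2)| <= 32 / 100 / 100 * tau x ^+ 2.
Proof.
move=> x0; apply: le_trans (pert_main hw i x0) _.
apply: ler_wpM2r; first exact: sqr_ge0.
by have /andP[b0 b1] := @be_bounds R Plus Plus i; rewrite /eps; lra.
Qed.

Lemma pert_pp_bounds x : 0 <= x -> [/\ 131 / 100 / 100 * tau x ^+ 2 <= pi_ 0 x <= 262 / 100 / 100 * tau x ^+ 2,
  213 / 100 / 100 * tau x ^+ 2 <= pi_ 1 x <= 377 / 100 / 100 * tau x ^+ 2 &
  49 / 100 / 100 * tau x ^+ 2 <= pi_ 2 x <= 147 / 100 / 100 * tau x ^+ 2].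
Proof.
move=> x0; have T0 := sqr_ge0 (tau x).
have := pert_pp 0 x0; have := pert_pp 1 x0; have := pert_pp 2 x0; rewrite !sum3 /cpl /signr /=.
rewrite !mul0r !add0r !addr0 !ler_norml => /andP[a1 a2] /andP[b1 b2] /andP[c1 c2].
have /andP[d1 d2] := cube_bounds hw 0 1 x0; have /andP[e1 e2] := cube_bounds hw 1 0 x0.
have /andP[f1 f2] := cube_bounds hw 1 2 x0; have /andP[g1 g2] := cube_bounds hw 2 1 x0.
by split; apply/andP; split; lra.
Qed.

Lemma tau_tk_pp x : 0 <= x -> [/\ tau x ^+ 2 <= tk (k 0) x ^+ 2, tau x ^+ 2 <= tk (k 1) x ^+ 2 &
  98 / 100 * tau x ^+ 2 <= tk (k 2) x ^+ 2].
Proof.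
move=> x0; have [b0 b1 b2] := be_pp; have t0 := tau_ge0 x0; have l0 := @k0_gt0 R; have l2 := @k02 R.
have kp i : 0 < k i := kk_gt0 Plus Plus i.
have A i : be Plus Plus i = 104 / 100 :> R -> tau x ^+ 2 <= tk (k i) x ^+ 2.
  move=> bi; have kl : k0 <= k i by rewrite -(@ler_pXn2r _ 2) ?nnegrE ?ltW// kk2 bi l2; lra.
  by have h : tau x <= tk (k i) x := tk_homo kl x0; nra.
split; [exact: A|exact: A|].
have k2l : k 2 <= k0 by rewrite -(@ler_pXn2r _ 2) ?nnegrE ?ltW// kk2 b2 l2; lra.
have h : k 2 * tau x <= k0 * tk (k 2) x := tk_ratio (kp 2) k2l x0.
have h2 : (k 2 * tau x) ^+ 2 <= (k0 * tk (k 2) x) ^+ 2.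
  rewrite lerXn2r ?nnegrE ?mulr_ge0 ?tk_ge0 ?(ltW (kp 2)) ?(ltW l0)//.
by move: h2; rewrite !exprMn kk2 b2 l2; lra.
Qed.

(** A positive c12 favours h_0 = h_1: the cross term is a gain in h_0^2 + h_1^2 minus a multiple of
    (h_0 - h_1)^2. The latter is paid by one fifth of the odd gap, while the other four fifths use
    sech^nu with nu close to 2, so that a small lam suffices. *)
Lemma nonneg_form_mid h h1 : (forall i x, 0 <= x -> is_derive x 1 (h i) (h1 i x)) ->
  h 0 0 = h 1 0 -> nonneg_form Plus Plus w (63 / 100 / 100) h h1.
Proof.
move=> dh ha; have [b0 b1 b2] := be_pp.
pose a := h 1 0; pose g i x := h i x - a * psi (k i) x.
pose nu : R := 97 / 50; pose nu' : R := 391 / 200.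
have nu0 : 0 <= nu by rewrite /nu; lra.
have nu0' : 0 <= nu' by rewrite /nu'; lra.
have kp i : 0 < k i := kk_gt0 Plus Plus i.
pose sech (n : R) i x := k i ^+ 2 * ((6 - n * (n + 1)) * tk (k i) x ^+ 2 - (2 - n)) * h i x ^+ 2.
pose mix i x := 1 / 5 * (5 / 2 * k i ^+ 2 * g i x ^+ 2) + (1 - 1 / 5) * sech nu i x.
apply: (@nonneg_form_minorants _ _ _ _ _ h h1 (fun i => if i == 2 then sech nu' i else mix i)).
  move=> i; case: ifP => [_|i2]; first exact: (minorant_sech (kp i) nu0' (dh i)).
  have hi : h i 0 = a.
    by move: i i2; apply: forall3 => //.
  have c5 : 0 <= (1 / 5 : R) <= 1 by apply/andP; split; lra.
  exact: (minorant_mix c5 (minorant_gap (kp i) hi (dh i)) (minorant_sech (kp i) nu0 (dh i))).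
move=> x x0; rewrite !sum3 /=.
have T0 := sqr_ge0 (tau x); have T1 : tau x ^+ 2 <= 1.
  by rewrite exprn_ile1 ?tau_ge0// ltW// tau_lt1.
have [/andP[_ p0] /andP[_ p1] /andP[_ p2]] := pert_pp_bounds x0.
have /andP[y1 y2] := vv_bounds hw 0 1 x0.
have V12 : 0 <= v 1 x * v 2 x <= 107 / 100 * tau x ^+ 2.
  by have /andP[h2 ->] := vv_bounds hw 1 2 x0; rewrite andbT; lra.
have m0 : 0 < 1 :> R by lra.
have X := cross_le (h 1 x) (h 2 x) (@c12_norm R Plus Plus) V12 m0.
have P0 := ler_wpM2r (sqr_ge0 (h 0 x)) p0; have P1 := ler_wpM2r (sqr_ge0 (h 1 x)) p1.
have P2 := ler_wpM2r (sqr_ge0 (h 2 x)) p2.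
(* Equal rates and equal values at 0 make the psi parts cancel, so the difference is controlled by
   the odd gap. *)
have gh : h 0 x - h 1 x = g 0 x - g 1 x by rewrite /g kk_pp01; ring.
have c01E : c 0 1 = 1 / 25 by rewrite /cpl /signr /=; lra.
have Y : - c 0 1 * (v 0 x * v 1 x) * h 0 x * h 1 x <=
  - (1 / 50 * (9 / 10 * tau x ^+ 2) * (h 0 x ^+ 2 + h 1 x ^+ 2)) +
    1 / 50 * (107 / 100) * (2 * g 0 x ^+ 2 + 2 * g 1 x ^+ 2).
  have -> : - c 0 1 * (v 0 x * v 1 x) * h 0 x * h 1 x =
     - (1 / 50 * (v 0 x * v 1 x) * (h 0 x ^+ 2 + h 1 x ^+ 2)) + 1 / 50 * (v 0 x * v 1 x) * (h 0 x - h 1 x) ^+ 2.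
    by rewrite c01E; field.
  rewrite gh; apply: lerD.
    by rewrite lerN2; apply: ler_wpM2r; [apply: addr_ge0; exact: sqr_ge0|lra].
  apply: ler_pM; [lra|exact: sqr_ge0|lra|].
  by have := sqr_ge0 (g 0 x + g 1 x); lra.
have [t0 t1 t2] := tau_tk_pp x0.
have S01 i : be Plus Plus i = 104 / 100 :> R -> tau x ^+ 2 <= tk (k i) x ^+ 2 ->
  (305 / 100 / 100 * tau x ^+ 2) * h i x ^+ 2 + 1 / 50 * (107 / 100) * (2 * g i x ^+ 2)
   <= 63 / 100 / 100 * h i x ^+ 2 + mix i x.
  move=> bi ti; rewrite /mix /sech kk2 bi.
  have q1 : (305 / 100 / 100 * tau x ^+ 2) * h i x ^+ 2 <=
    (63 / 100 / 100 + (1 - 1 / 5) * (104 / 100 / 8 * ((6 - nu * (nu + 1)) * tk (k i) x ^+ 2 - (2 - nu)))) * h i x ^+ 2.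
    by apply: ler_wpM2r; [exact: sqr_ge0|rewrite /nu; lra].
  have := sqr_ge0 (g i x); lra.
have S2 : (254 / 100 / 100 * tau x ^+ 2) * h 2 x ^+ 2 <= 63 / 100 / 100 * h 2 x ^+ 2 + sech nu' 2 x.
  rewrite /sech kk2 b2 -mulrDl; apply: ler_wpM2r; first exact: sqr_ge0.
  by rewrite /nu'; lra.
have S0 := S01 0 b0 t0; have S1 := S01 1 b1 t1.
have TH i : 0 <= tau x ^+ 2 * h i x ^+ 2 by apply: mulr_ge0 => //; exact: sqr_ge0.
have := TH 0; have := TH 1; have := TH 2.
rewrite /qform; lra.
Qed.

End both_plus.

(** * Translation mode *)

Section translation_mode.
Context {R : realType} (s t : sign) (w w1 : 'I_3 -> R -> R).
Hypothesis hw : wave_data s t w w1.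
Local Notation k := (@kk R s t).
Local Notation c := (@cpl R s t).
Local Notation v := (profile s t w).
Implicit Types (i j : 'I_3) (x lam : R).

Definition dprofile i x : R := k i * psi (k i) x + w1 i x.

(** The second derivative of v, read off from the wave equation, so that it can be differentiated
    once more. *)
Definition ddprofile i x : R :=
  - (v i x / 4) * (bb i * (1 - v i x ^+ 2) + \sum_(j < 3) c i j * (1 - v j x ^+ 2)).

Lemma der_profile i x : is_derive x 1 (v i) (dprofile i x).
Proof.
have [_ dw _ _ _] := hw i; have := dw x => ?.
by rewrite /profile /dprofile; der; rewrite /psi; ring.
Qed.

Lemma der_dprofile i x : is_derive x 1 (dprofile i) (ddprofile i x).
Proof.
have [_ _ dw1 _ _] := hw i; have := dw1 x => ?.
rewrite /dprofile; der; rewrite /ddprofile /forcing /pot /psi.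
have -> : \sum_(j < 3) c i j / 4 * (v i x * (v i x ^+ 2 - v j x ^+ 2)) =
  v i x / 4 * (\sum_(j < 3) c i j * (1 - v j x ^+ 2)) - v i x / 4 * (1 - v i x ^+ 2) * \sum_(j < 3) c i j.
  by rewrite !sum3; field.
have -> : \sum_(j < 3) c i j = 8 * k i ^+ 2 - bb i by rewrite kk2 /be; field.
by rewrite /profile; field.
Qed.

Lemma der_ddprofile i x : is_derive x 1 (ddprofile i) (lin_rhs s t w 0 dprofile i x).
Proof.
have d j := der_profile j x.
rewrite /ddprofile (_ : (fun x => _) = fun x => - (v i x / 4) * (bb i * (1 - v i x ^+ 2) +
   (c i 0 * (1 - v 0 x ^+ 2) + c i 1 * (1 - v 1 x ^+ 2) + c i 2 * (1 - v 2 x ^+ 2)))); last first.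
  by apply/funext => y; rewrite sum3.
by der; rewrite /lin_rhs hs_sum /pert addrK /diag_coef !sum3; field.
Qed.

Lemma lin_sol_dprofile : lin_sol s t w 0 dprofile ddprofile.
Proof. by move=> i x _; split; [exact: der_dprofile|exact: der_ddprofile]. Qed.

Lemma ddprofile0 i : ddprofile i 0 = 0.
Proof.
have := profile_odd hw i 0; rewrite oppr0 => /eqP; rewrite -addr_eq0 -mulr2n mulrn_eq0/= => /eqP v0.
by rewrite /ddprofile v0 mul0r oppr0 mul0r.
Qed.

Lemma dprofile_gt0 i : 0 < dprofile i 0.
Proof.
rewrite /dprofile psi0 mulr1; have [_ _ _ _ [h _]] := hw i; have := @kk_gt0 R s t i.
by move: h; rewrite ler_norml => /andP[h _]; lra.
Qed.

Lemma one_sub_profile_le i x : 0 <= x -> `|1 - v i x ^+ 2| <= 3 * om x.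
Proof.
move=> x0; have [_ _ _ hb _] := hw i; have := hb x x0; have p := psi_om (@kk_rate R s t i) x0.
have p0 := psi_gt0 (k i) x; have o0 := om_gt0 x0; have /andP[e0 e1] := @eps_bounds R s t.
have t0 := tau_ge0 x0; have /ltW t1 := tau_lt1 x; have o1 := om_le1 x0 => hwx.
have hwo : `|w i x| <= 1 / 100 * om x.
  apply: le_trans hwx _; rewrite mulrA; apply: ler_wpM2r; first exact: ltW.
  nra.
have tk0' := tk_ge0 (ltW (@kk_gt0 R s t i)) x0; have /ltW tk1' := tk_lt1 (k i) x.
have -> : 1 - v i x ^+ 2 = psi (k i) x - w i x * (2 * tk (k i) x + w i x) by rewrite /profile /psi; ring.
have h2 : `|w i x * (2 * tk (k i) x + w i x)| <= 1 / 100 * om x * 3.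
  rewrite normrM; apply: ler_pM; [exact: normr_ge0|exact: normr_ge0|exact: hwo|].
  by move: hwo; rewrite !ler_norml => /andP[a1 a2]; apply/andP; split; lra.
apply: le_trans (ler_normB _ _) _; rewrite (gtr0_norm p0); lra.
Qed.

Lemma dprofile_le i : exists C, forall x, 0 <= x -> `|dprofile i x| <= C * om x.
Proof.
have [_ _ _ _ [_ [C hC]]] := hw i; exists (k i * 2 + C) => x x0.
have kp := @kk_gt0 R s t i; rewrite /dprofile; apply: le_trans (ler_normD _ _) _.
rewrite mulrDl; apply: lerD; last exact: hC.
have p := psi_om (@kk_rate R s t i) x0; have p0 := psi_gt0 (k i) x.
by rewrite gtr0_norm ?mulr_gt0// -mulrA ler_pM2l.
Qed.

Lemma profile_norm_le i x : 0 <= x -> `|v i x| <= 2.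
Proof.
move=> x0; have /andP[h1 h2] := profile_tau hw i x0; have t0 := tau_ge0 x0.
have /ltW t1 := tau_lt1 x; rewrite ler_norml; apply/andP; split; lra.
Qed.

Lemma ddprofile_le i : exists C, forall x, 0 <= x -> `|ddprofile i x| <= C * om x.
Proof.
exists (2^-1 * (`|bb i| * 3 + \sum_(j < 3) `|c i j| * 3)) => x x0.
rewrite /ddprofile normrM -[leRHS]mulrA; apply: ler_pM; [exact: normr_ge0|exact: normr_ge0| |].
  rewrite normrN normrM (@ger0_norm R (4^-1)); last lra.
  by have := profile_norm_le i x0; lra.
apply: le_trans (ler_normD _ _) _; rewrite mulrDl; apply: lerD.
  rewrite normrM -mulrA; apply: ler_wpM2l; first exact: normr_ge0.
  exact: one_sub_profile_le.
apply: le_trans (ler_norm_sum _ _ _) _; rewrite mulr_suml; apply: ler_sum => j _.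
rewrite normrM -mulrA; apply: ler_wpM2l; first exact: normr_ge0.
exact: one_sub_profile_le.
Qed.

End translation_mode.

(** * Square integrability at infinity through primitives *)

Section tame.
Context {R : realType}.
Implicit Types (u : R -> R).

Lemma der_sum n (F dF : 'I_n -> R -> R) (x : R) : (forall i, is_derive x 1 (F i) (dF i x)) ->
  is_derive x 1 (fun y => \sum_(i < n) F i y) (\sum_(i < n) dF i x).
Proof.
elim: n F dF => [|n IH] F dF h.
  rewrite big_ord0 (_ : (fun y => _) = fun=> 0); first exact: derC.
  by apply/funext => y; rewrite big_ord0.
rewrite big_ord_recr /= (_ : (fun y => _) =
    fun y => \sum_(i < n) F (widen_ord (leqnSn n) i) y + F ord_max y).
  exact: (derD (IH (fun i => F (widen_ord (leqnSn n) i)) (fun i => dF (widen_ord (leqnSn n) i))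
    (fun i => h _)) (h ord_max)).
by apply/funext => y; rewrite big_ord_recr.
Qed.

(* [u] is square integrable at +oo, without measure theory: [u ^+ 2] is bounded by the derivative of
   a function bounded above. *)
Definition tame u := exists (D E : R -> R) (M : R), forall x, 0 <= x ->
  [/\ u x ^+ 2 <= D x, is_derive x 1 E (D x) & E x <= M].

Lemma tameD u u' : tame u -> tame u' -> tame (fun x => u x + u' x).
Proof.
move=> [D [E [M h]]] [D' [E' [M' h']]].
exists (fun x => 2 * D x + 2 * D' x), (fun x => 2 * E x + 2 * E' x), (2 * M + 2 * M').
move=> x x0; have [a1 a2 a3] := h x x0; have [b1 b2 b3] := h' x x0; split.
- by have := sqr_ge0 (u x - u' x); lra.
- by der; ring.
- lra.
Qed.

Lemma tameZ (a : R) u : tame u -> tame (fun x => a * u x).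
Proof.
move=> [D [E [M h]]]; exists (fun x => a ^+ 2 * D x), (fun x => a ^+ 2 * E x), (a ^+ 2 * M).
move=> x x0; have [a1 a2 a3] := h x x0; have p := sqr_ge0 a; split.
- by rewrite exprMn ler_wpM2l.
- by der; ring.
- by rewrite ler_wpM2l.
Qed.

Lemma tame_om u (C : R) : (forall x, 0 <= x -> `|u x| <= C * om x) -> tame u.
Proof.
move=> h; have a0 := @al_gt0 R; have an : al != 0 :> R by rewrite gt_eqF.
exists (fun x => C ^+ 2 * om x ^+ 2), (fun x => - (C ^+ 2 / al) * om x), 0 => x x0; split.
- rewrite -exprMn -real_normK ?num_real// lerXn2r ?nnegrE// ?h//.
  exact: le_trans (h x x0).
- by have := der_om x0 => ?; der; field.
- rewrite mulNr oppr_le0; apply: mulr_ge0; last exact/ltW/om_gt0.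
  by apply: divr_ge0; [exact: sqr_ge0|exact: ltW].
Qed.

Lemma tame_sum n (F : 'I_n -> R -> R) : (forall i, tame (F i)) -> tame (fun x => \sum_(i < n) F i x).
Proof.
elim: n F => [|n IH] F h.
  apply: (@tame_om _ 0) => x x0; by rewrite big_ord0 normr0 mul0r.
rewrite (_ : (fun y => _) = fun y => \sum_(i < n) F (widen_ord (leqnSn n) i) y + F ord_max y).
  by apply: tameD; [apply: IH => i; exact: h|exact: h].
by apply/funext => y; rewrite big_ord_recr.
Qed.

(** Otherwise the sum of the dominating densities stays above e^2 from some point on, and its
    bounded primitive would grow linearly. One N serves the whole finite family. *)
Lemma tame_small n (u : 'I_n -> R -> R) : (forall j, tame (u j)) ->
  forall e X : R, 0 < e -> exists N : R, [/\ 0 <= N, X <= N & forall j, `|u j N| <= e].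
Proof.
move=> /choice[D /choice[E /choice[M h]]] e X e0.
apply: contrapT => H.
pose X0 := Num.max X 0.
have X00 : 0 <= X0 by rewrite /X0 le_max lexx orbT.
have XX0 : X <= X0 by rewrite /X0 le_max lexx.
pose EE x := \sum_(j < n) E j x; pose DD x := \sum_(j < n) D j x.
have dE (x : R) : 0 <= x -> is_derive x 1 EE (DD x).
  by move=> x0; apply: der_sum => j; have [] := h j x x0.
have De (x : R) : X0 <= x -> e ^+ 2 <= DD x.
  move=> xX; have x0 := le_trans X00 xX.
  have [j hj] : exists j, e < `|u j x|.
    apply: contrapT => H2; apply: H; exists x; split => //; first exact: le_trans xX.
    by move=> j; rewrite leNgt; apply/negP => hj; apply: H2; exists j.
  have D0 l : 0 <= D l x by have [+ _ _] := h l x x0; apply: le_trans; exact: sqr_ge0.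
  apply: (@le_trans _ _ (D j x)); last first.
    by rewrite /DD (bigD1 j)//= lerDl; apply: sumr_ge0 => l _.
  have [+ _ _] := h j x x0; apply: le_trans.
  by rewrite -(@real_normK _ (u j x)) ?num_real// lerXn2r ?nnegrE ?(ltW e0) ?(ltW hj).
pose MM := \sum_(j < n) M j.
have EM (x : R) : 0 <= x -> EE x <= MM by move=> x0; apply: ler_sum => j _; have [] := h j x x0.
pose L := (MM - EE X0 + 1) / e ^+ 2.
have e2 : 0 < e ^+ 2 by rewrite exprn_gt0.
have L0 : 0 <= L by apply: divr_ge0; [have := EM X0 X00; lra|exact: ltW].
have XL : X0 <= X0 + L by rewrite lerDl.
have : e ^+ 2 * (X0 + L) - e ^+ 2 * X0 + EE X0 <= EE (X0 + L).
  apply: (@der_le _ (fun x => e ^+ 2 * x - e ^+ 2 * X0 + EE X0) EE (fun=> e ^+ 2) DD X0 (X0 + L) XL).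
  - by rewrite subrr add0r.
  - by move=> x _; der; ring.
  - by move=> x /andP[xX _]; apply: dE; exact: le_trans xX.
  - by move=> x /andP[xX _]; exact: De.
have -> : e ^+ 2 * (X0 + L) - e ^+ 2 * X0 + EE X0 = MM + 1.
  by rewrite /L; field; rewrite gt_eqF.
by have := EM (X0 + L) (le_trans X00 XL); lra.
Qed.

Lemma der_right_zero (Q : R -> R) (x d : R) : is_derive x 1 Q d -> (forall y, x <= y -> Q y = 0) -> d = 0.
Proof.
move=> dQ h; have [dv <-] := dQ.
rewrite /derive cvg_at_rightE//; apply: cvg_lim => //.
apply: (@cvg_trans _ ((fun=> 0 : R) @ 0^'+)); last exact: cvg_cst.
apply: near_eq_cvg; near=> z.
rewrite /= !h ?subrr ?scaler0// [_%:A]mulr1 lerDr; near: z; exact: nbhs_right_ge.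
Unshelve. all: by end_near. Qed.

End tame.

(** * Upper bound on the number of even eigenmodes *)

Lemma derE {R : realType} (f : R -> R) (x d d' : R) : is_derive x 1 f d -> d = d' -> is_derive x 1 f d'.
Proof. by move=> h <-. Qed.

Section upper_bound.
Context {R : realType} (s t : sign) (w w1 : 'I_3 -> R -> R).
Hypothesis hw : wave_data s t w w1.
Local Notation k := (@kk R s t).
Local Notation lsol := (lin_sol s t w).
Implicit Types (i : 'I_3) (x lam mu : R).

Definition wr (h h1 g g1 : 'I_3 -> R -> R) x : R :=
  \sum_(i < 3) (h1 i x * g i x - h i x * g1 i x).

(** Lagrange's identity: the Hessian terms cancel by symmetry. *)
Lemma der_wr lam mu h h1 g g1 x : lsol lam h h1 -> lsol mu g g1 -> 0 <= x ->
  is_derive x 1 (wr h h1 g g1) ((lam - mu) * \sum_(i < 3) h i x * g i x).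
Proof.
move=> sh sg x0; rewrite /wr.
apply: (@derE _ _ _ (\sum_(i < 3) (lin_rhs s t w lam h i x * g i x - h i x * lin_rhs s t w mu g i x))).
  apply: (@der_sum _ _ (fun i x => h1 i x * g i x - h i x * g1 i x)
    (fun i x => lin_rhs s t w lam h i x * g i x - h i x * lin_rhs s t w mu g i x)) => i.
  by have [d1 d2] := sh i x x0; have [e1 e2] := sg i x x0; der; ring.
rewrite /lin_rhs !sum3 (hs_sym _ _ _ 1 0) (hs_sym _ _ _ 2 0) (hs_sym _ _ _ 2 1); ring.
Qed.

Lemma der_energy lam h h1 g g1 x : (forall i, is_derive x 1 (h i) (h1 i x)) ->
  lsol lam g g1 -> 0 <= x ->
  is_derive x 1 (fun x => \sum_(i < 3) g1 i x * h i x) (bform s t w lam g g1 h h1 x).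
Proof.
move=> dh sg x0.
apply: (@derE _ _ _ (\sum_(i < 3) (lin_rhs s t w lam g i x * h i x + g1 i x * h1 i x))).
  apply: (@der_sum _ _ (fun i x => g1 i x * h i x)
    (fun i x => lin_rhs s t w lam g i x * h i x + g1 i x * h1 i x)) => i.
  by have := dh i => ?; have [e1 e2] := sg i x x0; der; ring.
by rewrite /bform; apply: eq_bigr => i _; rewrite /lin_rhs; ring.
Qed.

Section family.
Variables (n : nat) (F F1 : 'I_n -> 'I_3 -> R -> R) (lam : 'I_n -> R) (c : 'I_n -> R).
Hypothesis solF : forall j, lsol (lam j) (F j) (F1 j).
Hypothesis tameF : forall j i, tame (F j i).
Hypothesis tameF1 : forall j i, tame (F1 j i).
Hypothesis F10 : forall j i, F1 j i 0 = 0.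
Hypothesis lam_ge0 : forall j, 0 <= lam j.
Hypothesis lam_inj : injective lam.

Let h i x : R := \sum_(j < n) c j * F j i x.
Let h1 i x : R := \sum_(j < n) c j * F1 j i x.
Hypothesis hpin : forall i, pinned s t i -> h i 0 = 0.

Let dh i x : 0 <= x -> is_derive x 1 (h i) (h1 i x).
Proof.
move=> x0; apply: (@der_sum _ _ (fun j x => c j * F j i x) (fun j x => c j * F1 j i x)) => j.
by have [d _] := solF j i x0; der; ring.
Qed.

Let src i x : R := \sum_(j < n) c j * (lam j * F j i x).

Let dh1 i x : 0 <= x -> is_derive x 1 (h1 i) (src i x - \sum_(l < 3) hs s t w i l x * h l x).
Proof.
move=> x0.
apply: (@derE _ _ _ (\sum_(j < n) c j * lin_rhs s t w (lam j) (F j) i x)).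
  apply: (@der_sum _ _ (fun j x => c j * F1 j i x) (fun j x => c j * lin_rhs s t w (lam j) (F j) i x)) => j.
  by have [_ d] := solF j i x0; der; ring.
rewrite /src /h /lin_rhs !sum3 !mulr_sumr -!big_split -sumrN -big_split /=.
by apply: eq_bigr => j _; rewrite sum3; ring.
Qed.

Let tame_h i : tame (h i). Proof. by apply: tame_sum => j; exact: tameZ. Qed.
Let tame_h1 i : tame (h1 i). Proof. by apply: tame_sum => j; exact: tameZ. Qed.

(** Dividing by lam_j - lam_l turns the off-diagonal products of the energy into derivatives of
    Wronskians. This is the orthogonality of eigenfunctions for distinct eigenvalues, without
    integrals. *)
Let mix j l : R := c j * c l * lam j / (lam j - lam l).

Let cross x : R := \sum_(j < n) \sum_(l < n) (if l == j then 0 else mix j l * wr (F j) (F1 j) (F l) (F1 l) x).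

Let dcross x : 0 <= x -> is_derive x 1 cross
  (\sum_(i < 3) h i x * src i x - \sum_(j < n) c j ^+ 2 * lam j * \sum_(i < 3) F j i x ^+ 2).
Proof.
move=> x0; pose ip j l := \sum_(i < 3) F j i x * F l i x.
apply: (@derE _ _ _ (\sum_(j < n) \sum_(l < n) (if l == j then 0 else c j * c l * lam j * ip j l))).
  apply: (@der_sum _ _ (fun j x => \sum_(l < n) (if l == j then 0 else mix j l * wr (F j) (F1 j) (F l) (F1 l) x))
     (fun j _ => \sum_(l < n) (if l == j then 0 else c j * c l * lam j * ip j l))) => j.
  apply: (@der_sum _ _ (fun l x => (if l == j then 0 else mix j l * wr (F j) (F1 j) (F l) (F1 l) x))
     (fun l _ => (if l == j then 0 else c j * c l * lam j * ip j l))) => l.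
  case: eqP => [_|/eqP lj]; first exact: derC.
  have := der_wr (solF j) (solF l) x0 => d; der.
  rewrite /mix -/(ip j l); field.
  by rewrite subr_eq0; apply: contra lj => /eqP/lam_inj ->.
have -> : \sum_(i < 3) h i x * src i x = \sum_(j < n) \sum_(l < n) c j * c l * lam j * ip j l.
  transitivity (\sum_(i < 3) \sum_(j < n) \sum_(l < n) c j * c l * lam j * (F j i x * F l i x)).
    apply: eq_bigr => i _; rewrite mulrC /src mulr_suml; apply: eq_bigr => j _.
    by rewrite /h mulr_sumr; apply: eq_bigr => l _; ring.
  rewrite exchange_big; apply: eq_bigr => j _ /=; rewrite exchange_big; apply: eq_bigr => l _ /=.
  by rewrite -mulr_sumr.
rewrite -sumrB; apply: eq_bigr => j _.
rewrite (bigD1 j)//= eqxx add0r [in RHS](bigD1 j)//=.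
have -> : ip j j = \sum_(i < 3) F j i x ^+ 2 by apply: eq_bigr => i _; rewrite expr2.
have -> : c j * c j * lam j * (\sum_(i < 3) F j i x ^+ 2) = c j ^+ 2 * lam j * \sum_(i < 3) F j i x ^+ 2 by ring.
rewrite addrAC subrr add0r; apply: eq_bigr => l lj; by rewrite (negbTE lj).
Qed.

(** For the combination h, energy minus [Bd] minus Wronskian terms has a derivative of at least the
    sum of c_j^2 lam_j |F_j|^2. It vanishes at 0 by the Neumann conditions and is small at
    arbitrarily large arguments. Being nondecreasing it is 0 throughout, so every summand is 0. *)
Lemma pinned_comb j : 0 < lam j -> c j != 0 -> forall i x, 0 < x -> F j i x = 0.
Proof.
move=> lj cj.
have [Bd [Bd1 [C [dB hB B0 Bb]]]] := nonneg_form_pinned hw dh hpin.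
pose Q x := \sum_(i < 3) h1 i x * h i x - Bd x - cross x.
pose Q1 x := form s t w 0 h h1 x - Bd1 x + \sum_(j < n) c j ^+ 2 * lam j * \sum_(i < 3) F j i x ^+ 2.
have dQ x : 0 <= x -> is_derive x 1 Q (Q1 x).
  move=> x0; have d1 := dcross x0; have d2 := dB x x0.
  have d3 : is_derive x 1 (fun x => \sum_(i < 3) h1 i x * h i x)
      (form s t w 0 h h1 x + \sum_(i < 3) h i x * src i x).
    apply: (@derE _ _ _ (\sum_(i < 3) (h1 i x * h1 i x + h i x * (src i x - \sum_(l < 3) hs s t w i l x * h l x)))).
      apply: (@der_sum _ _ (fun i x => h1 i x * h i x)
       (fun i x => h1 i x * h1 i x + h i x * (src i x - \sum_(l < 3) hs s t w i l x * h l x))) => i.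
      by have := dh i x0 => ?; have := dh1 i x0 => ?; der; ring.
    by rewrite /form /bform -big_split /=; apply: eq_bigr => i _; ring.
  by rewrite /Q; der; rewrite /Q1; ring.
have termge0 x l : 0 <= c l ^+ 2 * lam l * \sum_(i < 3) F l i x ^+ 2.
  apply: mulr_ge0; first by apply: mulr_ge0 => //; exact: sqr_ge0.
  by apply: sumr_ge0 => i _; exact: sqr_ge0.
have Q1ge x : 0 <= x -> c j ^+ 2 * lam j * (\sum_(i < 3) F j i x ^+ 2) <= Q1 x.
  move=> x0; rewrite /Q1 (bigD1 j)//=; have := hB x x0.
  have : 0 <= \sum_(l < n | l != j) c l ^+ 2 * lam l * \sum_(i < 3) F l i x ^+ 2 by apply: sumr_ge0 => l _.
  lra.
have Qmono a b : 0 <= a -> a <= b -> Q a <= Q b.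
  move=> a0 ab; apply: (@der_nondecreasing _ Q Q1 a b _ _ ab) => x /andP[ax _].
    exact: dQ (le_trans a0 ax).
  exact: le_trans (termge0 x j) (Q1ge x (le_trans a0 ax)).
have wr0 j' l : wr (F j') (F1 j') (F l) (F1 l) 0 = 0.
  by rewrite /wr big1// => i _; rewrite !F10 mul0r mulr0 subrr.
have Q0 : Q 0 = 0.
  rewrite /Q B0 subr0 big1 ?sub0r => [|i _]; last by rewrite /h1 big1 ?mul0r// => l _; rewrite F10 mulr0.
  rewrite /cross big1 ?oppr0// => l _; rewrite big1// => l' _.
  by case: eqP => // _; rewrite wr0 mulr0.
have Qsmall N e : 0 <= N -> 0 <= e <= 1 -> (forall i, `|h i N| <= e /\ `|h1 i N| <= e) ->
   (forall j i, `|F j i N| <= e /\ `|F1 j i N| <= e) -> (forall i, psi (k i) N <= e) ->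
   Q N <= e * (3 + `|C| * 6 + \sum_(j < n) \sum_(l < n) `|mix j l| * 6).
  move=> N0 /andP[e0 e1] hN FN pN.
  have ee : e * e <= e by rewrite ler_piMl.
  have b1 : \sum_(i < 3) h1 i N * h i N <= e * 3.
    rewrite sum3; have b i : h1 i N * h i N <= e.
      apply: le_trans (ler_norm _) _; rewrite normrM; apply: le_trans ee.
      by have [a1 a2] := hN i; apply: ler_pM.
    have := b 0; have := b 1; have := b 2; lra.
  have b2 : - Bd N <= e * (`|C| * 6).
    apply: le_trans (ler_norm _) _; rewrite normrN; apply: le_trans (Bb N N0) _.
    apply: (@le_trans _ _ (`|C| * (\sum_(i < 3) (h i N ^+ 2 + psi (k i) N ^+ 2)))).
      apply: ler_wpM2r; last exact: ler_norm.
      by apply: sumr_ge0 => i _; apply: addr_ge0; exact: sqr_ge0.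
    rewrite mulrCA; apply: ler_wpM2l => //.
    have b i : h i N ^+ 2 + psi (k i) N ^+ 2 <= 2 * e.
      have p0 := psi_gt0 (k i) N; have := pN i; have [+ _] := hN i; rewrite ler_norml => /andP[? ?] ?; nra.
    rewrite sum3; have := b 0; have := b 1; have := b 2; lra.
  have b3 : - cross N <= e * \sum_(j < n) \sum_(l < n) `|mix j l| * 6.
    rewrite -sumrN mulr_sumr; apply: ler_sum => l _; rewrite -sumrN mulr_sumr; apply: ler_sum => l' _.
    have m6 : 0 <= e * (`|mix l l'| * 6) by apply: mulr_ge0 => //; apply: mulr_ge0.
    case: eqP => _; first by rewrite oppr0.
    apply: le_trans (ler_norm _) _; rewrite normrN normrM mulrCA; apply: ler_wpM2l => //.
    rewrite /wr; apply: le_trans (ler_norm_sum _ _ _) _.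
    have b i : `|F1 l i N * F l' i N - F l i N * F1 l' i N| <= 2 * e.
      have [a1 a2] := FN l i; have [a3 a4] := FN l' i.
      apply: le_trans (ler_normB _ _) _; rewrite !normrM.
      have c1 : `|F1 l i N| * `|F l' i N| <= e * e by apply: ler_pM.
      have c2 : `|F l i N| * `|F1 l' i N| <= e * e by apply: ler_pM.
      lra.
    rewrite sum3; have := b 0; have := b 1; have := b 2; lra.
  rewrite /Q; lra.
have Qle0 x : 0 <= x -> Q x <= 0.
  move=> x0; rewrite leNgt; apply/negP => Qx.
  pose K : R := 3 + `|C| * 6 + \sum_(j < n) \sum_(l < n) `|mix j l| * 6.
  have K0 : 0 < K.
    have : 0 <= \sum_(j < n) \sum_(l < n) `|mix j l| * 6.
      by apply: sumr_ge0 => l _; apply: sumr_ge0 => l' _; apply: mulr_ge0.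
    have : 0 <= `|C| * 6 by apply: mulr_ge0.
    rewrite /K; lra.
  pose e := Num.min 1 (Q x / 2 / K).
  have e0 : 0 < e by rewrite lt_min ltr01 divr_gt0// divr_gt0.
  have e1 : e <= 1 by rewrite ge_min lexx.
  pose T := ('I_n * 'I_3)%type.
  pose u (l : 'I_(n + n + 1)) x : R := 0.
  have [X HX] : exists X, forall i y, X <= y -> psi (k i) y <= e.
    have H i : exists X, forall y, X <= y -> psi (k i) y <= e.
      have [X hX] := vanishing_psi (@kk_gt0 R s t i) e0; exists X => y hy.
      by have := hX y hy; rewrite gtr0_norm// psi_gt0.
    have [X0 h0] := H 0; have [X1 h1'] := H 1; have [X2 h2] := H 2.
    exists (Num.max X0 (Num.max X1 X2)); apply: forall3 => y; rewrite !ge_max => /and3P[? ? ?].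
    - exact: h0.
    - exact: h1'.
    - exact: h2.
  (* h, the F_j and all their derivatives must be small at the same argument, hence one finite index
     type for all of them. *)
  pose G (l : 'I_#|{: option 'I_n * bool * 'I_3}|) : R -> R :=
    let: (o, b, i) := enum_val l in
    match o, b with None, true => h i | None, false => h1 i
    | Some l, true => F l i | Some l, false => F1 l i end.
  have tG l : tame (G l).
    by rewrite /G; case: (enum_val l) => [[[l'|] []] i].
  have [N [N0 NX GN]] := tame_small tG (Num.max X x) e0.
  move: NX; rewrite ge_max => /andP[NX Nx].
  have GE (p : option 'I_n * bool * 'I_3) : G (enum_rank p) N = (let: (o, b, i) := p in
    match o, b with None, true => h i N | None, false => h1 i N
    | Some l, true => F l i N | Some l, false => F1 l i N end).
    by rewrite /G enum_rankK; case: p => [[[l'|] []] i].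
  have := Qsmall N e N0; rewrite (ltW e0) e1 => /(_ isT) QN.
  have {}QN := QN (fun i => conj (eq_ind _ (fun y => `|y| <= e) (GN (enum_rank (None, true, i))) _ (GE _))
     (eq_ind _ (fun y => `|y| <= e) (GN (enum_rank (None, false, i))) _ (GE _)))
     (fun l i => conj (eq_ind _ (fun y => `|y| <= e) (GN (enum_rank (Some l, true, i))) _ (GE _))
     (eq_ind _ (fun y => `|y| <= e) (GN (enum_rank (Some l, false, i))) _ (GE _)))
     (fun i => HX i N NX).
  have := Qmono _ _ x0 Nx; rewrite leNgt => /negP; apply.
  apply: le_lt_trans QN _; rewrite -/K.
  have : e * K <= Q x / 2.
    by rewrite -ler_pdivlMr// /e ge_min lexx orbT.
  lra.
have QZ x : 0 <= x -> Q x = 0.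
  move=> x0; apply/eqP; rewrite eq_le Qle0//= -Q0; exact: Qmono.
move=> i x x0.
have Q1x : Q1 x = 0.
  by apply: (der_right_zero (dQ x (ltW x0))) => y xy; apply: QZ; exact: le_trans (ltW x0) xy.
have := Q1ge x (ltW x0); rewrite Q1x => H.
have cl : 0 < c j ^+ 2 * lam j by rewrite mulr_gt0// lt_neqAle eq_sym sqrf_eq0 cj sqr_ge0.
have S0 : \sum_(i < 3) F j i x ^+ 2 <= 0 by rewrite -(pmulr_rle0 _ cl).
have : F j i x ^+ 2 <= 0.
  apply: le_trans S0; rewrite (bigD1 i)//= lerDl; apply: sumr_ge0 => l _; exact: sqr_ge0.
by move=> h0; apply/eqP; rewrite -sqrf_eq0 eq_le h0 sqr_ge0.
Qed.

End family.

End upper_bound.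

Section eigenvalue_bound.
Context {R : realType} (s t : sign) (w w1 : 'I_3 -> R -> R).
Hypothesis hw : wave_data s t w w1.
Local Notation lsol := (lin_sol s t w).
Implicit Types (i : 'I_3) (x : R).

Lemma row_kernel (m : nat) (A : 'M[R]_(m.+1, m)) : exists2 c : 'rV_m.+1, c != 0 & c *m A = 0.
Proof.
have : kermx A != 0.
  by rewrite -mxrank_eq0 mxrank_ker subn_eq0 -ltnNge ltnS rank_leq_col.
by move=> /rowV0Pn[c /sub_kermxP cA c0]; exists c.
Qed.

(** The m modes and v' are m + 1 families with only m values at 0 to cancel, so a nontrivial
    combination exists; [Z] lists the components in which to cancel, with repetitions allowed. v'
    enters as a solution at lam = 0, for which [pinned_comb] claims nothing. *)
Lemma eigen_bound (m : nat) (Z : 'I_m -> 'I_3) (e e1 : 'I_m -> 'I_3 -> R -> R) (lam : 'I_m -> R) :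
  (forall i, pinned s t i -> exists l, Z l = i) ->
  (forall j, lsol (lam j) (e j) (e1 j)) -> (forall j i, tame (e j i)) ->
  (forall j i, tame (e1 j i)) -> (forall j i, e1 j i 0 = 0) -> (forall j, 0 < lam j) ->
  injective lam -> (forall j, exists i x, 0 < x /\ e j i x != 0) -> False.
Proof.
move=> hZ se te te1 e10 l0 linj enz.
pose F (j : 'I_m.+1) := if unlift ord_max j is Some j' then e j' else dprofile s t w1.
pose F1 (j : 'I_m.+1) := if unlift ord_max j is Some j' then e1 j' else ddprofile s t w.
pose la (j : 'I_m.+1) := if unlift ord_max j is Some j' then lam j' else 0.
pose A := \matrix_(j < m.+1, l < m) F j (Z l) 0.
have [c c0 cA] := row_kernel A.
have solF j : lsol (la j) (F j) (F1 j).
  rewrite /la /F /F1; case: unliftP => [j' _|_]; first exact: se.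
  exact: lin_sol_dprofile hw.
have tameF j i : tame (F j i).
  rewrite /F; case: unliftP => [j' _|_]; first exact: te.
  by have [C hC] := dprofile_le hw i; exact: tame_om hC.
have tameF1 j i : tame (F1 j i).
  rewrite /F1; case: unliftP => [j' _|_]; first exact: te1.
  by have [C hC] := ddprofile_le hw i; exact: tame_om hC.
have F10 j i : F1 j i 0 = 0.
  rewrite /F1; case: unliftP => [j' _|_]; first exact: e10.
  exact: ddprofile0 hw i.
have la0 j : 0 <= la j by rewrite /la; case: unliftP => [j' _|_] //; exact: ltW.
have la_inj : injective la.
  move=> j l; rewrite /la; case: unliftP => [j' ->|->]; case: unliftP => [l' ->|->] //.
  - by move=> /linj ->.
  - by move=> h; have := l0 j'; rewrite h ltxx.
  - by move=> h; have := l0 l'; rewrite -h ltxx.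
have pin i : pinned s t i -> \sum_(j < m.+1) c 0 j * F j i 0 = 0.
  move=> /hZ[l <-]; transitivity ((c *m A) 0 l); last by rewrite cA mxE.
  by rewrite mxE; apply: eq_bigr => j _; rewrite mxE.
have cj0 j' : c 0 (lift ord_max j') = 0.
  apply/eqP/negPn/negP => cn0.
  have la_lift : la (lift ord_max j') = lam j' by rewrite /la liftK.
  have lp : 0 < la (lift ord_max j') by rewrite la_lift.
  have H := pinned_comb hw solF tameF tameF1 F10 la0 la_inj pin lp cn0.
  have [i [x [x0]]] := enz j'; have := H i x x0.
  by rewrite /F liftK => ->; rewrite eqxx.
(* Only the coefficient of v' is left. It vanishes too, because the middle component is always
   pinned and v' is positive there at 0. *)
have p1 : pinned s t 1 by [].
have := pin 1 p1; rewrite (bigD1 ord_max)//= big1 => [|j jm]; last first.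
  by case: (unliftP ord_max j) jm => [j' ->|->]; rewrite ?eqxx// cj0 mul0r.
rewrite addr0 /F unlift_none => /eqP; rewrite mulf_eq0 => /orP[/eqP cm|].
  case/negP: c0; apply/eqP/rowP => j; rewrite mxE.
  by case: (unliftP ord_max j) => [j' ->|->].
by rewrite gt_eqF//; exact: dprofile_gt0 hw 1.
Qed.

End eigenvalue_bound.

(** * Absolute integrability at infinity *)

Section fading.
Context {R : realType}.
Implicit Types (u B : R -> R).

(* [B] is absolutely integrable at +oo, hence small at arbitrarily large arguments. *)
Definition fading B := exists (D E : R -> R) (M : R), forall x, 0 <= x ->
  [/\ `|B x| <= D x, is_derive x 1 E (D x) & E x <= M].

(** The square root of |B| is [tame]. *)
Lemma fading_small B : fading B -> forall e X : R, 0 < e ->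
  exists N, [/\ 0 <= N, X <= N & `|B N| <= e].
Proof.
move=> [D [E [M h]]] e X e0.
have tB : tame (fun x => Num.sqrt `|B x|).
  by exists D, E, M => x x0; have [a b d] := h x x0; split => //; rewrite sqr_sqrtr.
have e2 : 0 < Num.sqrt e by rewrite sqrtr_gt0.
have [N [N0 XN /(_ ord0) hN]] := tame_small (fun _ : 'I_1 => tB) X e2.
exists N; split => //; move: hN; rewrite ger0_norm ?sqrtr_ge0// => hN.
by rewrite -(ler_sqrt _ (ltW e0)).
Qed.

Lemma fadingD B B' : fading B -> fading B' -> fading (fun x => B x + B' x).
Proof.
move=> [D [E [M h]]] [D' [E' [M' h']]]; exists (fun x => D x + D' x), (fun x => E x + E' x), (M + M').
move=> x x0; have [a b d] := h x x0; have [a' b' d'] := h' x x0; split.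
- by apply: le_trans (ler_normD _ _) _; exact: lerD.
- by der; ring.
- exact: lerD.
Qed.

Lemma fadingZ (a : R) B : fading B -> fading (fun x => a * B x).
Proof.
move=> [D [E [M h]]]; exists (fun x => `|a| * D x), (fun x => `|a| * E x), (`|a| * M).
move=> x x0; have [b c d] := h x x0; split.
- by rewrite normrM ler_wpM2l.
- by der; ring.
- by rewrite ler_wpM2l.
Qed.

Lemma fading_le B B' : (forall x, 0 <= x -> `|B x| <= `|B' x|) -> fading B' -> fading B.
Proof.
move=> BB [D [E [M h]]]; exists D, E, M => x x0; have [a b d] := h x x0; split => //.
exact: le_trans (BB x x0) a.
Qed.

Lemma fadingN B : fading B -> fading (fun x => - B x).
Proof. by apply: fading_le => x _; rewrite normrN. Qed.

Lemma fading_sum n (F : 'I_n -> R -> R) : (forall i, fading (F i)) -> fading (fun x => \sum_(i < n) F i x).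
Proof.
elim: n F => [|n IH] F h.
  exists (fun=> 0), (fun=> 0), 0 => x x0; rewrite big_ord0 normr0; split => //; exact: derC.
rewrite (_ : (fun y => _) = fun y => \sum_(i < n) F (widen_ord (leqnSn n) i) y + F ord_max y).
  by apply: fadingD; [apply: IH => i; exact: h|exact: h].
by apply/funext => y; rewrite big_ord_recr.
Qed.

Lemma fadingM u u' : tame u -> tame u' -> fading (fun x => u x * u' x).
Proof.
move=> [D [E [M h]]] [D' [E' [M' h']]].
exists (fun x => D x + D' x), (fun x => E x + E' x), (M + M').
move=> x x0; have [a1 a2 a3] := h x x0; have [b1 b2 b3] := h' x x0; split.
- rewrite ler_norml; have := sqr_ge0 (u x - u' x); have := sqr_ge0 (u x + u' x) => ? ?.
  by have := sqr_ge0 (u x); have := sqr_ge0 (u' x) => ? ?; apply/andP; split; lra.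
- by der; ring.
- exact: lerD.
Qed.

Lemma tame_psi (l : R) : kink_rate l -> tame (psi l).
Proof.
move=> hl; apply: (@tame_om _ _ 2) => x x0; rewrite gtr0_norm ?psi_gt0//; exact: psi_om.
Qed.

Lemma fading_bound s t (h : 'I_3 -> R -> R) (Bd : R -> R) (C : R) : (forall i, tame (h i)) ->
  (forall x, 0 <= x -> `|Bd x| <= C * \sum_(i < 3) (h i x ^+ 2 + psi (kk s t i) x ^+ 2)) -> fading Bd.
Proof.
move=> th hB.
have F : fading (fun x => C * \sum_(i < 3) (h i x ^+ 2 + psi (kk s t i) x ^+ 2)).
  apply: fadingZ; apply: (@fading_sum _ (fun i x => h i x ^+ 2 + psi (kk s t i) x ^+ 2)) => i.
  by apply: fadingD; apply: fadingM => //; exact/tame_psi/kk_rate.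
by apply: fading_le F => x x0; apply: le_trans (hB x x0) _; exact: ler_norm.
Qed.

(** The substitute for integrating a nonnegative density over the half-line: - Q(0) plays the role
    of the integral. It is nonnegative, and positive if the density is positive at 0. *)
Lemma fading_nondecreasing (Q Q1 : R -> R) : (forall x : R, 0 <= x -> is_derive x 1 Q (Q1 x)) ->
  (forall x, 0 <= x -> 0 <= Q1 x) -> fading Q -> Q 0 <= 0 /\ (0 < Q1 0 -> Q 0 < 0).
Proof.
move=> dQ Q10 fQ.
have mono a b : 0 <= a -> a <= b -> Q a <= Q b.
  move=> a0 ab; apply: (@der_nondecreasing _ Q Q1 a b _ _ ab) => x /andP[ax _].
    exact: dQ (le_trans a0 ax).
  exact: Q10 (le_trans a0 ax).
have le0 x : 0 <= x -> Q x <= 0.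
  move=> x0; rewrite leNgt; apply/negP => Qx.
  have Qx2 : 0 < Q x / 2 by lra.
  have [N [N0 xN]] := fading_small fQ x Qx2; have := mono _ _ x0 xN.
  by rewrite ler_norml => h /andP[_ h2]; lra.
split; first exact: le0.
move=> Q1p; rewrite lt_neqAle le0// andbT; apply/eqP => Q00.
have z : Q1 0 = 0.
  apply: (der_right_zero (dQ 0 (lexx 0))) => y y0; apply/eqP; rewrite eq_le le0//=.
  by rewrite -Q00; exact: mono.
by rewrite z ltxx in Q1p.
Qed.

End fading.

(** * The boundary matrix *)

Section boundary_matrix.
Context {R : realType} (s t : sign) (w w1 : 'I_3 -> R -> R).
Hypothesis hw : wave_data s t w w1.
Local Notation k := (@kk R s t).
Local Notation lsol := (lin_sol s t w).
Local Notation fm := (form s t w).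
Local Notation bf := (bform s t w).
Implicit Types (i : 'I_3) (x lam mu : R) (a : 'cV[R]_3).

Definition spectral_range lam := 0 <= lam <= 1 / 50.

Definition decaying_basis (H H1 : R -> 'I_3 -> 'I_3 -> R -> R) := forall lam j, spectral_range lam ->
  [/\ lsol lam (H lam j) (H1 lam j), forall i, H lam j i 0 = (i == j)%:R,
      forall i x, 0 <= x -> `|H lam j i x| <= 4 * om x &
      forall i, exists C, forall x, 0 <= x -> `|H1 lam j i x| <= C * om x].

Lemma decaying_basis_exists : exists H H1, decaying_basis H H1.
Proof.
have E (p : R * 'I_3) : exists q : ('I_3 -> R -> R) * ('I_3 -> R -> R), spectral_range p.1 ->
  [/\ lsol p.1 q.1 q.2, forall i, q.1 i 0 = (i == p.2)%:R,
      forall i x, 0 <= x -> `|q.1 i x| <= 4 * om x &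
      forall i, exists C, forall x, 0 <= x -> `|q.2 i x| <= C * om x].
  have [hl|hl] := boolP (0 <= p.1 <= 1 / 50); last first.
    by exists (fun _ _ => 0, fun _ _ => 0) => h; rewrite -/(spectral_range _) h in hl.
  have a1 i : `|(i == p.2)%:R : R| <= 1 by case: eqP => _; rewrite ?normr1 ?normr0.
  have [h [h1 hh]] := dirichlet_exists hw hl a1.
  by exists (h, h1).
have [q hq] := choice E.
by exists (fun lam j => (q (lam, j)).1), (fun lam j => (q (lam, j)).2) => lam j; exact: hq (lam, j).
Qed.

Section fixed_basis.
Variables (H H1 : R -> 'I_3 -> 'I_3 -> R -> R).
Hypothesis basis : decaying_basis H H1.

(* Dirichlet-to-Neumann matrix of the half-line problem [u'' = (lam - hessian) u] *)
Definition dtn lam : 'M[R]_3 := \matrix_(i, j) - H1 lam j i 0.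

(** By integration by parts, [quad] of the boundary matrix is the energy of the decaying solution
    with boundary values a. *)
Definition quad (M : 'M[R]_3) a : R := \sum_(i < 3) (M *m a) i 0 * a i 0.

Definition ext lam a i x : R := \sum_(j < 3) a j 0 * H lam j i x.
Definition ext1 lam a i x : R := \sum_(j < 3) a j 0 * H1 lam j i x.

Lemma ext_sol lam a : spectral_range lam -> lsol lam (ext lam a) (ext1 lam a).
Proof.
move=> hl i x x0; have d j := (let: And4 h _ _ _ := basis j hl in h i x x0); split.
  apply: (@der_sum _ _ (fun j x => a j 0 * H lam j i x) (fun j x => a j 0 * H1 lam j i x)) => j.
  by have [d1 _] := d j; der; ring.
apply: (@derE _ _ _ (\sum_(j < 3) a j 0 * lin_rhs s t w lam (H lam j) i x)).
  apply: (@der_sum _ _ (fun j x => a j 0 * H1 lam j i x) (fun j x => a j 0 * lin_rhs s t w lam (H lam j) i x)) => j.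
  by have [_ d1] := d j; der; ring.
rewrite /lin_rhs /ext !sum3; ring.
Qed.

Lemma ext_der lam a i x : spectral_range lam -> 0 <= x -> is_derive x 1 (ext lam a i) (ext1 lam a i x).
Proof. by move=> hl x0; have [] := ext_sol a hl i x0. Qed.

Lemma tame_ext lam a i : spectral_range lam -> tame (ext lam a i).
Proof.
move=> hl; apply: (@tame_sum _ _ (fun j x => a j 0 * H lam j i x)) => j; apply: tameZ.
by have [_ _ h _] := basis j hl; exact: tame_om (h i).
Qed.

Lemma tame_ext1 lam a i : spectral_range lam -> tame (ext1 lam a i).
Proof.
move=> hl; apply: (@tame_sum _ _ (fun j x => a j 0 * H1 lam j i x)) => j; apply: tameZ.
by have [_ _ _ /(_ i)[C hC]] := basis j hl; exact: tame_om hC.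
Qed.

Lemma ext0 lam a i : spectral_range lam -> ext lam a i 0 = a i 0.
Proof.
move=> hl; rewrite /ext (bigD1 i)//= big1 => [|j ji].
  by have [_ -> _ _] := basis i hl; rewrite eqxx mulr1 addr0.
by have [_ -> _ _] := basis j hl; rewrite eq_sym (negbTE ji) mulr0.
Qed.

Lemma ext10 lam a i : ext1 lam a i 0 = - (dtn lam *m a) i 0.
Proof.
by rewrite mxE -sumrN; apply: eq_bigr => j _; rewrite mxE; ring.
Qed.

(** The difference is the integral of the Lagrange identity. Each of the three products is at most
    16 om^2, and om^2 has integral 1 / al. The indices are exchanged on one side: lam = mu then
    gives symmetry, and symmetry turns the estimate into Lipschitz continuity. *)
Lemma dtn_lipschitz lam mu i j : spectral_range lam -> spectral_range mu ->
  `|dtn lam i j - dtn mu j i| <= `|lam - mu| * (48 / al).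
Proof.
move=> hl hm.
have [sl hl0 bl cl] := basis j hl; have [sm hm0 bm cm] := basis i hm.
have an : al != 0 :> R by rewrite gt_eqF// al_gt0.
pose Q := wr (H lam j) (H1 lam j) (H mu i) (H1 mu i).
have dQ x : 0 <= x -> is_derive x 1 Q ((lam - mu) * \sum_(l < 3) H lam j l x * H mu i l x).
  by move=> x0; exact: (der_wr sl sm x0).
have fQ : fading Q.
  apply: (@fading_sum _ _ (fun l x => H1 lam j l x * H mu i l x - H lam j l x * H1 mu i l x)) => l.
  have [C hC] := cl l; have [C' hC'] := cm l.
  apply: fadingD; [|apply: fadingN]; apply: fadingM;
    by [exact: tame_om hC|exact: tame_om (bm l)|exact: tame_om (bl l)|exact: tame_om hC'].
have Q0 : Q 0 = - (dtn lam i j - dtn mu j i).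
  rewrite /Q /wr big_split /= (bigD1 i)//= hm0 eqxx mulr1 big1 => [|l li]; last first.
    by rewrite hm0 (negbTE li) mulr0.
  rewrite (bigD1 j)//= hl0 eqxx mul1r big1 => [|l lj]; last by rewrite hl0 (negbTE lj) mul0r oppr0.
  by rewrite !mxE; ring.
pose B x := `|lam - mu| * (- (48 / al) * om x).
pose B1 x := `|lam - mu| * (48 * om x ^+ 2).
have dB (x : R) : 0 <= x -> is_derive x 1 B (B1 x).
  by move=> x0; have := der_om x0 => ?; rewrite /B; der; rewrite /B1; field.
have Qb x : 0 <= x -> `|(lam - mu) * \sum_(l < 3) H lam j l x * H mu i l x| <= B1 x.
  move=> x0; rewrite normrM; apply: ler_wpM2l => //.
  apply: le_trans (ler_norm_sum _ _ _) _.
  have b l : `|H lam j l x * H mu i l x| <= 16 * om x ^+ 2.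
    have -> : 16 * om x ^+ 2 = (4 * om x) * (4 * om x) by ring.
    by rewrite normrM; apply: ler_pM => //; [exact: bl|exact: bm].
  by rewrite sum3; have := b 0; have := b 1; have := b 2; lra.
have BQ (sg : R) (N : R) : `|sg| = 1 -> 0 <= N -> sg * (Q N - Q 0) <= B N - B 0.
  move=> sg1 N0.
  apply: (@der_le _ (fun x => sg * (Q x - Q 0)) (fun x => B x - B 0)
    (fun x => sg * ((lam - mu) * \sum_(l < 3) H lam j l x * H mu i l x)) B1 0 N N0).
  - by rewrite !subrr mulr0.
  - by move=> x /andP[x0 _]; have := dQ x x0 => ?; der; ring.
  - by move=> x /andP[x0 _]; have := dB x x0 => ?; der; ring.
  - move=> x /andP[x0 _]; apply: le_trans (Qb x x0); apply: le_trans (ler_norm _) _.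
    by rewrite normrM sg1 mul1r.
have B0 : B 0 = - (`|lam - mu| * (48 / al)) by rewrite /B om0; ring.
have BN N : 0 <= N -> B N <= 0.
  move=> N0; rewrite /B; apply: mulr_ge0_le0 => //; rewrite mulNr oppr_le0.
  by apply: mulr_ge0; [apply: divr_ge0; [lra|exact/ltW/al_gt0]|exact/ltW/om_gt0].
rewrite -normrN -Q0; apply/ler_addgt0Pr => e e0.
have [N [N0 _ hN]] := fading_small fQ 0 e0.
have s1 := BQ 1 N (normr1 _) N0; have s2 := BQ (-1) N (normrN1 _) N0.
have := BN N N0; rewrite B0 in s1 s2; move: hN; rewrite !ler_norml => /andP[h2 h3] h4.
by apply/andP; split; lra.
Qed.

Lemma dtn_sym lam i j : spectral_range lam -> dtn lam i j = dtn lam j i.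
Proof.
move=> hl; have := dtn_lipschitz i j hl hl; rewrite subrr normr0 mul0r normr_le0 subr_eq0.
by move=> /eqP.
Qed.

Lemma quad_energy0 lam a : spectral_range lam ->
  \sum_(i < 3) ext1 lam a i 0 * ext lam a i 0 = - quad (dtn lam) a.
Proof.
by move=> hl; rewrite -sumrN; apply: eq_bigr => i _; rewrite ext0// ext10 mulNr.
Qed.

Lemma fading_energy lam a : spectral_range lam ->
  fading (fun x => \sum_(i < 3) ext1 lam a i x * ext lam a i x).
Proof.
move=> hl; apply: (@fading_sum _ _ (fun i x => ext1 lam a i x * ext lam a i x)) => i.
by apply: fadingM; [exact: tame_ext1|exact: tame_ext].
Qed.

(** The energy h1 h - B is nondecreasing and fades, and its value at 0 is minus [quad]. Strictness
    comes from h(0) = a being nonzero. *)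
Lemma quad_gt0 lam a (B B1 : R -> R) d : spectral_range lam -> a != 0 -> 0 < d ->
  (forall x, 0 <= x -> is_derive x 1 B (B1 x)) ->
  (forall x, 0 <= x -> B1 x + d * \sum_(i < 3) ext lam a i x ^+ 2 <= fm lam (ext lam a) (ext1 lam a) x) ->
  B 0 = 0 -> fading B -> 0 < quad (dtn lam) a.
Proof.
move=> hl a0 d0 dB hB B0 fB.
pose Q x := \sum_(i < 3) ext1 lam a i x * ext lam a i x - B x.
have dQ x : 0 <= x -> is_derive x 1 Q (fm lam (ext lam a) (ext1 lam a) x - B1 x).
  move=> x0; have h := der_energy (fun i => ext_der a i hl x0) (ext_sol a hl) x0.
  by have := dB x x0 => ?; rewrite /Q; der.
have Q1 x : 0 <= x -> d * \sum_(i < 3) ext lam a i x ^+ 2 <= fm lam (ext lam a) (ext1 lam a) x - B1 x.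
  by move=> x0; have := hB x x0; lra.
have fQ : fading Q by apply: fadingD; [exact: fading_energy|exact: fadingN].
have S0 x : 0 <= \sum_(i < 3) ext lam a i x ^+ 2 by apply: sumr_ge0 => i _; exact: sqr_ge0.
have [_ ] := fading_nondecreasing dQ (fun x hx => le_trans (mulr_ge0 (ltW d0) (S0 x)) (Q1 x hx)) fQ.
rewrite /Q quad_energy0// B0 subr0 oppr_lt0; apply.
apply: lt_le_trans (Q1 0 (lexx 0)); rewrite mulr_gt0//.
rewrite lt_neqAle S0 andbT eq_sym; apply/eqP => z; case/negP: a0; apply/eqP/colP => i; rewrite mxE.
have : ext lam a i 0 ^+ 2 <= 0.
  apply: (@le_trans _ _ (\sum_(l < 3) ext lam a l 0 ^+ 2)); last by rewrite z.
  by rewrite [leRHS](bigD1 i)//= lerDl; apply: sumr_ge0 => l _; exact: sqr_ge0.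
rewrite ext0// => h; apply/eqP; by rewrite -sqrf_eq0 eq_le h sqr_ge0.
Qed.

Lemma form_shift lam mu h h1 x : fm lam h h1 x = fm mu h h1 x + (lam - mu) * \sum_(i < 3) h i x ^+ 2.
Proof. by rewrite !formE; ring. Qed.

Lemma quad_gt0_nonneg lam mu a : spectral_range lam -> mu < lam -> a != 0 ->
  nonneg_form s t w mu (ext lam a) (ext1 lam a) -> 0 < quad (dtn lam) a.
Proof.
move=> hl ml a0 [Bd [Bd1 [C [dB hB B0 Bb]]]].
have d0 : 0 < lam - mu by rewrite subr_gt0.
apply: (quad_gt0 hl a0 d0 dB _ B0).
  by move=> x x0; rewrite (form_shift _ mu) lerD2r; exact: hB.
by apply: (fading_bound _ Bb) => i; exact: tame_ext.
Qed.

Lemma quad_top lam a : spectral_range lam -> 39 / 20 / 100 < lam -> a != 0 -> 0 < quad (dtn lam) a.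
Proof.
move=> hl h a0; apply: (quad_gt0_nonneg hl h a0).
by apply: (nonneg_form_top hw) => i x x0; exact: ext_der.
Qed.

(** Subtracting y v' leaves a remainder r that vanishes at 0 in the pinned components and has
    nonnegative energy at lam = 0. The mixed energy and the energy of v' are pure boundary terms,
    zero because v'' vanishes at 0; lam > 0 gives strict positivity. *)
Lemma quad_translation lam a y : spectral_range lam -> 0 < lam -> a != 0 ->
  (forall i, pinned s t i -> a i 0 = y * dprofile s t w1 i 0) -> 0 < quad (dtn lam) a.
Proof.
move=> hl l0 a0 ha.
pose p := dprofile s t w1; pose p1 := ddprofile s t w.
pose r i x := ext lam a i x - y * p i x; pose r1 i x := ext1 lam a i x - y * p1 i x.
have sp := lin_sol_dprofile hw.
have dp i (x : R) : 0 <= x -> is_derive x 1 (p i) (p1 i x) by move=> x0; have [] := sp i x x0.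
have dr i (x : R) : 0 <= x -> is_derive x 1 (r i) (r1 i x).
  by move=> x0; have := dp i x x0 => ?; have := ext_der a i hl x0 => ?; rewrite /r; der; rewrite /r1; ring.
have r0 i : pinned s t i -> r i 0 = 0 by move=> /ha; rewrite /r ext0// => ->; rewrite subrr.
have tp i : tame (p i) by have [C hC] := dprofile_le hw i; exact: tame_om hC.
have tp1 i : tame (p1 i) by have [C hC] := ddprofile_le hw i; exact: tame_om hC.
have tr i : tame (r i).
  rewrite /r (_ : (fun x => _) = fun x => ext lam a i x + - y * p i x); last by apply/funext => x; ring.
  by apply: tameD; [exact: tame_ext|exact: tameZ].
have [Bd [Bd1 [C [dB hB B0 Bb]]]] := nonneg_form_pinned hw dr r0.
have fB : fading Bd by exact: fading_bound tr Bb.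
pose B x := Bd x + 2 * y * (\sum_(i < 3) p1 i x * r i x) + y ^+ 2 * \sum_(i < 3) p1 i x * p i x.
apply: (@quad_gt0 lam a B (fun x => Bd1 x + 2 * y * bf 0 p p1 r r1 x + y ^+ 2 * fm 0 p p1 x) lam hl a0 l0).
- move=> x x0; have := dB x x0 => ?.
  have e1 := der_energy (fun i => dr i x x0) sp x0; have e2 := der_energy (fun i => dp i x x0) sp x0.
  rewrite /B; der; rewrite /form; ring.
- move=> x x0; rewrite (form_shift lam 0) subr0; cbv beta; rewrite lerD2r; have := hB x x0.
  have -> : fm 0 (ext lam a) (ext1 lam a) x = fm 0 r r1 x + 2 * y * bf 0 p p1 r r1 x + y ^+ 2 * fm 0 p p1 x.
    rewrite /form /bform /r /r1 !sum3 (hs_sym _ _ _ 1 0) (hs_sym _ _ _ 2 0) (hs_sym _ _ _ 2 1); ring.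
  lra.
- by rewrite /B B0 !big1 ?mulr0 ?addr0// => i _; rewrite /p1 (ddprofile0 hw) mul0r.
- apply: fadingD; [apply: fadingD => //; apply: fadingZ|apply: fadingZ].
    by apply: (@fading_sum _ _ (fun i x => p1 i x * r i x)) => i; exact: fadingM.
  by apply: (@fading_sum _ _ (fun i x => p1 i x * p i x)) => i; exact: fadingM.
Qed.

(* The trial function [a i * psi (k i)] solves the uncoupled problem at [lam = 0], so only the perturbation
   enters; [c - d tk^2] integrates against [psi^2] to [2/3 c - 2/15 d], up to the factor [1 / k]. *)
Lemma quad_trial lam a (c d : R) : spectral_range lam -> a != 0 -> 0 <= c -> 5 * c < d ->
  (forall x, 0 <= x -> lam * \sum_(i < 3) (a i 0 * psi (k i) x) ^+ 2 -
     qform s t w (fun i x => a i 0 * psi (k i) x) x <=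
     \sum_(i < 3) (c - d * tk (k i) x ^+ 2) * (a i 0 * psi (k i) x) ^+ 2) ->
  quad (dtn lam) a < 0.
Proof.
move=> hl an c0 cd hq.
pose f i x := a i 0 * psi (k i) x; pose f1 i x := a i 0 * (- 2 * k i * tk (k i) x * psi (k i) x).
have df i x : is_derive x 1 (f i) (f1 i x) by rewrite /f; der; rewrite /f1; ring.
pose h := ext lam a; pose h1 := ext1 lam a.
pose g i x := f i x - h i x; pose g1 i x := f1 i x - h1 i x.
have dg i (x : R) : 0 <= x -> is_derive x 1 (g i) (g1 i x).
  by move=> x0; have := df i x => ?; have := ext_der a i hl x0 => ?; rewrite /g /h; der.
have g00 i : g i 0 = 0 by rewrite /g /f /h ext0// psi0 mulr1 subrr.
have tf i : tame (f i) by apply: tameZ; exact/tame_psi/kk_rate.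
have th i : tame (h i) by exact: tame_ext.
have tg i : tame (g i).
  rewrite /g (_ : (fun x => _) = fun x => f i x + (-1) * h i x); last by apply/funext => x; ring.
  by apply: tameD => //; exact: tameZ.
have [Bd [Bd1 [C [dB hB B0 Bb]]]] := nonneg_form_pinned hw dg (fun i _ => g00 i).
have fB : fading Bd by exact: fading_bound tg Bb.
pose T i x := tk (k i) x.
have kn i : k i != 0 by rewrite gt_eqF// kk_gt0.
pose S x := \sum_(i < 3) a i 0 ^+ 2 * (- 2 * k i * tk (k i) x * psi (k i) x ^+ 2).
(* A primitive of (c - d tanh^2) sech^4, tending to 2/3 c - 2/15 d over k. The hypothesis 5 c < d
   makes this limit negative. *)
pose p i x := (c * (T i x - T i x ^+ 3 / 3) - d * (T i x ^+ 3 / 3 - T i x ^+ 5 / 5)) / k i.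
pose P x := \sum_(i < 3) a i 0 ^+ 2 * p i x.
pose P1 x := \sum_(i < 3) (c - d * tk (k i) x ^+ 2) * (a i 0 * psi (k i) x) ^+ 2.
pose S1 x := \sum_(i < 3) (f1 i x ^+ 2 + pot (k i) x * f i x ^+ 2).
have dS x : is_derive x 1 S (S1 x).
  apply: (@der_sum _ _ (fun i x => a i 0 ^+ 2 * (- 2 * k i * tk (k i) x * psi (k i) x ^+ 2))
     (fun i x => f1 i x ^+ 2 + pot (k i) x * f i x ^+ 2)) => i.
  by der; rewrite /f1 /f /pot /psi; ring.
have dP x : is_derive x 1 P (P1 x).
  apply: (@der_sum _ _ (fun i x => a i 0 ^+ 2 * p i x)
     (fun i x => (c - d * tk (k i) x ^+ 2) * (a i 0 * psi (k i) x) ^+ 2)) => i.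
  by rewrite /p /T; der; rewrite /psi; field; exact: kn.
pose E x := \sum_(i < 3) h1 i x * h i x; pose X x := \sum_(i < 3) h1 i x * g i x.
have sh := ext_sol a hl.
pose Q x := S x + P x - E x - 2 * X x - Bd x.
pose dQ1 x := S1 x + P1 x - fm lam h h1 x - 2 * bf lam h h1 g g1 x - Bd1 x.
have dQ x : 0 <= x -> is_derive x 1 Q (dQ1 x).
  move=> x0; have e1 := der_energy (fun i => ext_der a i hl x0) sh x0.
  have e2 := der_energy (fun i => dg i x x0) sh x0; have := dB x x0 => ?; have := dS x => ?; have := dP x => ?.
  by rewrite /Q /E /X; der; rewrite /dQ1 /form; ring.
have Q1 x : 0 <= x -> 0 <= dQ1 x.
  rewrite /dQ1 => x0; have := hq x x0; have := hB x x0; rewrite -/(P1 x).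
  have e : fm lam f f1 x = S1 x + (lam * \sum_(i < 3) f i x ^+ 2 - qform s t w f x) by rewrite formE /S1; ring.
  (* Dirichlet principle: the trial function f and the solution h agree at 0, the energy of g = f -
     h is nonnegative because g vanishes there, and the mixed term is the boundary term [X]. *)
  have e3 : fm lam f f1 x = fm lam h h1 x + 2 * bf lam h h1 g g1 x + fm lam g g1 x.
    rewrite /g /g1 /form /bform !sum3 (hs_sym _ _ _ 1 0) (hs_sym _ _ _ 2 0) (hs_sym _ _ _ 2 1); ring.
  have e4 := form_shift lam 0 g g1 x.
  have e5 : 0 <= (lam - 0) * \sum_(i < 3) g i x ^+ 2.
    by rewrite subr0; apply: mulr_ge0; [case/andP: hl|apply: sumr_ge0 => i _; exact: sqr_ge0].
  move: e e3 e4 e5; rewrite /f; lra.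
have mono N : 0 <= N -> Q 0 <= Q N.
  move=> N0; exact: (@der_nondecreasing _ Q dQ1 0 N (fun x h => dQ x (proj1 (andP h))) (fun x h => Q1 x (proj1 (andP h))) N0).
have Q0 : Q 0 = quad (dtn lam) a.
  rewrite /Q B0 /E quad_energy0// (_ : S 0 = 0) 1?(_ : P 0 = 0) 1?(_ : X 0 = 0); first by ring.
  - by rewrite /X big1// => i _; rewrite g00 mulr0.
  - by rewrite /P big1// => i _; rewrite /p /T tk0 !expr0n/=; ring.
  - by rewrite /S big1// => i _; rewrite tk0; ring.
have fF : fading (fun x => S x - E x - 2 * X x - Bd x).
  apply: fadingD; last exact: fadingN.
  apply: fadingD; last first.
    apply: fadingN; apply: fadingZ; apply: (@fading_sum _ _ (fun i x => h1 i x * g i x)) => i.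
    by apply: fadingM => //; exact: tame_ext1.
  apply: fadingD; last by apply: fadingN; exact: fading_energy.
  apply: (@fading_sum _ _ (fun i x => a i 0 ^+ 2 * (- 2 * k i * tk (k i) x * psi (k i) x ^+ 2))) => i.
  apply: fadingZ; apply: (@fading_le _ _ (fun x => (2 * k i) * psi (k i) x ^+ 2)) => [x x0|].
    have p0 : 0 <= psi (k i) x ^+ 2 by exact: sqr_ge0.
    have kip := @kk_gt0 R s t i.
    have t0 := tk_ge0 (ltW kip) x0; have /ltW t1 := tk_lt1 (k i) x.
    rewrite [leLHS]normrM [leRHS]normrM; apply: ler_wpM2r => //.
    by rewrite (@ger0_norm _ (2 * k i)); [rewrite ler_norml; apply/andP; split; nra|lra].
  by apply: fadingZ; apply: fadingM; exact/tame_psi/kk_rate.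
pose l i := (2 / 3 * c - 2 / 15 * d) / k i.
have l0 i : l i < 0 by rewrite /l pmulr_llt0 ?invr_gt0 ?kk_gt0//; lra.
have dp : 0 < 2 * d by lra.
(* Half of the negative limit is kept for large arguments; the other half is left for the fading
   terms. *)
have large i : exists Y, forall N, 0 <= N -> Y <= N -> p i N <= l i / 2.
  have kp := @kk_gt0 R s t i.
  have kL : 0 < - l i * k i / (2 * d) by rewrite divr_gt0// mulr_gt0// oppr_gt0.
  have [Y hY] := vanishing_psi kp kL; exists Y => N N0 YN.
  have T0 : 0 <= T i N by exact: tk_ge0 (ltW kp) N0.
  have /ltW T1 : T i N < 1 by exact: tk_lt1.
  have := hY N YN; rewrite gtr0_norm ?psi_gt0// ler_pdivlMr//.
  rewrite /psi -/(T i N) /p /l => hpsi.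
  have {}hpsi : (1 - T i N ^+ 2) * (2 * d) <= - (2 / 3 * c - 2 / 15 * d).
    by rewrite (_ : - (2 / 3 * c - 2 / 15 * d) = - ((2 / 3 * c - 2 / 15 * d) / k i) * k i)//; field.
  rewrite ler_pdivrMr// (_ : _ / 2 * _ = (2 / 3 * c - 2 / 15 * d) / 2); last by field.
  have q1 : T i N - T i N ^+ 3 / 3 <= 2 / 3.
    have := mulr_ge0 (sqr_ge0 (T i N - 1)) (addr_ge0 T0 (ler0n R 2)); lra.
  (* The difference of the two sides is (1 - t) / 30 times the polynomial in [G0]. *)
  have q2 : 2 / 15 - (1 - T i N ^+ 2) / 2 <= T i N ^+ 3 / 3 - T i N ^+ 5 / 5.
    have G0 : 0 <= 11 + 11 * T i N - 4 * T i N ^+ 2 + 6 * T i N ^+ 3 + 6 * T i N ^+ 4.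
      have := exprn_ge0 3 T0; have := exprn_ge0 4 T0; have : T i N ^+ 2 <= 1 by rewrite exprn_ile1.
      lra.
    have u0 : 0 <= 1 - T i N by rewrite subr_ge0.
    have := mulr_ge0 u0 G0; lra.
  have q3 := ler_wpM2l c0 q1; have d0 : 0 <= d by lra.
  have q4 := ler_wpM2l d0 q2; lra.
have [Y0 hY0] := large 0; have [Y1 hY1] := large 1; have [Y2 hY2] := large 2.
pose L := \sum_(i < 3) a i 0 ^+ 2 * l i.
have L0 : L < 0.
  rewrite -oppr_gt0 -sumrN lt_neqAle sumr_ge0 => [|i _]; last first.
    by rewrite oppr_ge0; apply: mulr_ge0_le0; [exact: sqr_ge0|exact: ltW].
  rewrite andbT eq_sym psumr_neq0 => [|i _]; last first.
    by rewrite oppr_ge0; apply: mulr_ge0_le0; [exact: sqr_ge0|exact: ltW].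
  apply/hasP; have [i ai] : exists i, a i 0 != 0.
    apply: contrapT => nai; case/negP: an; apply/eqP/colP => i; rewrite mxE.
    by apply: contrapT => /eqP ai; apply: nai; exists i.
  exists i; first exact: mem_index_enum.
  by rewrite /= oppr_gt0 pmulr_rlt0// exprn_even_gt0.
have L2 : 0 < - L / 4 by lra.
have [N [N0]] := fading_small fF (Num.max Y0 (Num.max Y1 Y2)) L2.
rewrite !ge_max -Q0 => /and3P[y0 y1 y2] hN.
apply: le_lt_trans (mono N N0) _.
have PN : P N <= L / 2.
  rewrite /P /L mulr_suml; apply: ler_sum => i _; rewrite -mulrA; apply: ler_wpM2l; first exact: sqr_ge0.
  by move: i; apply: forall3; [exact: hY0|exact: hY1|exact: hY2].
have -> : Q N = P N + (S N - E N - 2 * X N - Bd N) by rewrite /Q; ring.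
by move: hN; rewrite ler_norml => /andP[_ hN]; lra.
Qed.

End fixed_basis.
End boundary_matrix.

(** * Determinant signs of symmetric matrices of order three *)

Section symmetric_forms.
Context {R : realType}.
Implicit Types (M P : 'M[R]_3) (a : 'cV[R]_3).

Lemma det2 (N : 'M[R]_2) : \det N = N 0 0 * N 1 1 - N 0 1 * N 1 0.
Proof.
rewrite (expand_det_row _ 0) !big_ord_recl big_ord0 /cofactor !det_mx11 !mxE /=.
transitivity (N 0 0 * ((-1) ^+ 0 * N 1 1) + (N 0 1 * ((-1) ^+ 1 * N 1 0) + 0)); last by ring.
by congr (_ * (_ * _) + (_ * (_ * _) + _)); congr (N _ _); exact: val_inj.
Qed.
Lemma det3 (M : 'M[R]_3) : \det M = M 0 0 * (M 1 1 * M 2 2 - M 1 2 * M 2 1) - M 0 1 * (M 1 0 * M 2 2 - M 1 2 * M 2 0)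
  + M 0 2 * (M 1 0 * M 2 1 - M 1 1 * M 2 0).
Proof.
rewrite (expand_det_row _ 0) !big_ord_recl big_ord0 /cofactor !det2 !mxE /=.
transitivity (M 0 0 * ((-1) ^+ 0 * (M 1 1 * M 2 2 - M 1 2 * M 2 1)) + (M 0 1 * ((-1) ^+ 1 * (M 1 0 * M 2 2 - M 1 2 * M 2 0))
  + (M 0 2 * ((-1) ^+ 2 * (M 1 0 * M 2 1 - M 1 1 * M 2 0)) + 0))); last by ring.
by congr (_ * (_ * (_ * _ - _ * _)) + (_ * (_ * (_ * _ - _ * _)) + (_ * (_ * (_ * _ - _ * _)) + _)));
  congr (M _ _); exact: val_inj.
Qed.

Lemma quad_congr M P a : quad (P^T *m M *m P) a = quad M (P *m a).
Proof.
have e (N : 'M[R]_3) b : quad N b = (b^T *m N *m b) 0 0.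
  by rewrite -mulmxA mxE; apply: eq_bigr => i _; rewrite [in RHS]mulrC; congr (_ * _); rewrite mxE.
by rewrite !e trmx_mul !mulmxA.
Qed.

Lemma quadN M a : quad (- M) a = - quad M a.
Proof. by rewrite /quad mulNmx -sumrN; apply: eq_bigr => i _; rewrite mxE mulNr. Qed.

Lemma quad_col3 M x y z : M^T = M -> quad M (col3 x y z) =
  M 0 0 * x ^+ 2 + M 1 1 * y ^+ 2 + M 2 2 * z ^+ 2 + 2 * M 0 1 * x * y + 2 * M 0 2 * x * z + 2 * M 1 2 * y * z.
Proof.
move=> /matrixP sM; have s i j : M i j = M j i by rewrite -[in RHS]sM mxE.
rewrite /quad sum3 !mxE !sum3 !mxE /= (s 1 0) (s 2 0) (s 2 1); ring.
Qed.

(** The trial vectors are columns of adjugates of the trailing blocks. The last one is mapped by M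
    to det M times the first basis vector, so its quadratic value is the trailing minor times det
    M. *)
Lemma det_pos_def M : M^T = M -> (forall a, a != 0 -> 0 < quad M a) -> 0 < \det M.
Proof.
move=> sM pM.
have s i j : M i j = M j i by rewrite -[in RHS]sM mxE.
have nz x y z : y != 0 \/ z != 0 \/ x != 0 -> col3 x y z != 0.
  move=> h; apply/eqP => /colP e; have := e 0; have := e 1; have := e 2; rewrite !mxE/= => z0 y0 x0.
  by case: h => [|[|]] /eqP.
have m11 : 0 < M 1 1.
  have n1 : col3 0 1 0 != 0 :> 'cV[R]_3 by apply: nz; left; exact: oner_neq0.
  by have := pM _ n1; rewrite quad_col3//; lra.
have c00 : 0 < M 1 1 * M 2 2 - M 1 2 ^+ 2.
  have n2 : col3 0 (- M 1 2) (M 1 1) != 0 by apply: nz; right; left; rewrite gt_eqF.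
  have := pM _ n2; rewrite quad_col3//.
  by rewrite (_ : _ + _ = M 1 1 * (M 1 1 * M 2 2 - M 1 2 ^+ 2)) ?pmulr_rgt0//; ring.
have n3 : col3 (M 1 1 * M 2 2 - M 1 2 ^+ 2) (M 0 2 * M 1 2 - M 0 1 * M 2 2) (M 0 1 * M 1 2 - M 0 2 * M 1 1) != 0.
  by apply: nz; right; right; rewrite gt_eqF.
have := pM _ n3; rewrite quad_col3//.
rewrite (_ : _ + _ = (M 1 1 * M 2 2 - M 1 2 ^+ 2) * \det M) ?pmulr_rgt0//.
rewrite det3 (s 1 0) (s 2 0) (s 2 1); ring.
Qed.

(** In the basis P the lower 2 x 2 block is positive definite and the first diagonal entry negative.
    The determinant identity for 2 x 2 minors then gives the sign; the congruence only multiplies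
    the determinant by a square. *)
Lemma det_signature M P : M^T = M -> \det P != 0 -> quad M (P *m col3 1 0 0) < 0 ->
  (forall y z, y != 0 \/ z != 0 -> 0 < quad M (P *m col3 0 y z)) -> \det M < 0.
Proof.
move=> sM P0 hx hyz; pose G := P^T *m M *m P.
have sG : G^T = G by rewrite /G !trmx_mul sM trmxK mulmxA.
have s i j : G i j = G j i by rewrite -[in RHS]sG [RHS]mxE.
have dG : \det G = \det P ^+ 2 * \det M by rewrite /G !det_mulmx det_tr; ring.
suff : \det G < 0 by rewrite dG pmulr_rlt0// lt0r sqr_ge0 sqrf_eq0 P0.
move: hx; rewrite -quad_congr -/G quad_col3// => hx.
have pG y z : y != 0 \/ z != 0 -> 0 < quad G (col3 0 y z) by rewrite quad_congr; exact: hyz.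
have m11 : 0 < G 1 1 by have := pG 1 0 (or_introl (oner_neq0 _)); rewrite quad_col3//; lra.
have c00 : 0 < G 1 1 * G 2 2 - G 1 2 ^+ 2.
  have n2 : - G 1 2 != 0 \/ G 1 1 != 0 by right; rewrite gt_eqF.
  have := pG _ _ n2; rewrite quad_col3//.
  by rewrite (_ : _ + _ = G 1 1 * (G 1 1 * G 2 2 - G 1 2 ^+ 2)) ?pmulr_rgt0//; ring.
have G00 : G 0 0 < 0 by lra.
have g0 : G 0 0 * G 1 1 - G 0 1 ^+ 2 < 0 by have := sqr_ge0 (G 0 1); nra.
rewrite -(pmulr_rlt0 _ m11).
rewrite (_ : _ * _ = (G 1 1 * G 2 2 - G 1 2 ^+ 2) * (G 0 0 * G 1 1 - G 0 1 ^+ 2) - (G 1 1 * G 0 2 - G 0 1 * G 1 2) ^+ 2).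
  have := sqr_ge0 (G 1 1 * G 0 2 - G 0 1 * G 1 2).
  by have : (G 1 1 * G 2 2 - G 1 2 ^+ 2) * (G 0 0 * G 1 1 - G 0 1 ^+ 2) < 0; [rewrite pmulr_rlt0|lra].
rewrite det3 (s 1 0) (s 2 0) (s 2 1); ring.
Qed.

End symmetric_forms.

(** * Sign changes of the determinant *)

Section trial_estimates.
Context {R : realType} (s t : sign) (w w1 : 'I_3 -> R -> R).
Hypothesis hw : wave_data s t w w1.
Local Notation k := (@kk R s t).
Local Notation pi_ := (pert s t w).
Implicit Types (i : 'I_3) (x lam : R) (a : 'cV[R]_3).

Lemma pert0_plus x : s = Plus -> 0 <= x -> 1 / 100 * tau x ^+ 2 <= pi_ 0 x.
Proof.
move=> sP x0; have := pert_main hw 0 x0; have /andP[a1 a2] := cube_bounds hw 0 1 x0.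
rewrite sum3 {1 2 3}/cpl /= !mul0r ?add0r ?addr0 sP; rewrite sP in a1.
have -> : be Plus t 0 = 104 / 100 :> R by rewrite /be sum3 /cpl /bb /=; lra.
have T0 := sqr_ge0 (tau x); have /andP[_ e1] := @eps_bounds R Plus t.
have h : 3 / 4 * (104 / 100) * (eps Plus t * (41 / 20)) * tau x ^+ 2 <= 3 / 4 * (104 / 100) * (1 / 250 * (41 / 20)) * tau x ^+ 2.
  by apply: ler_wpM2r => //; lra.
by rewrite /signr ler_norml => /andP[h2 _]; lra.
Qed.

Lemma pert2_plus x : t = Plus -> 0 <= x -> 1 / 5 / 100 * tau x ^+ 2 <= pi_ 2 x.
Proof.
move=> tP x0; have := pert_main hw 2 x0; have /andP[a1 a2] := cube_bounds hw 2 1 x0.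
rewrite sum3 {1 2 3}/cpl /= !mul0r ?add0r ?addr0 tP; rewrite tP in a1.
have -> : be s Plus 2 = 98 / 100 :> R by rewrite /be sum3 /cpl /bb /=; lra.
have T0 := sqr_ge0 (tau x); have /andP[_ e1] := @eps_bounds R s Plus.
have h : 3 / 4 * (98 / 100) * (eps s Plus * (41 / 20)) * tau x ^+ 2 <= 3 / 4 * (98 / 100) * (1 / 250 * (41 / 20)) * tau x ^+ 2.
  by apply: ler_wpM2r => //; lra.
by rewrite /signr ler_norml => /andP[h2 _]; lra.
Qed.

Lemma tk_tau_sqr i x : 0 <= x -> tk (k i) x ^+ 2 <= 105 / 100 * tau x ^+ 2.
Proof.
move=> x0; have t0 := tau_ge0 x0; have /andP[_ h] := @tk_tau R s t i x x0.
have := tk_ge0 (ltW (@kk_gt0 R s t i)) x0; nra.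
Qed.

Variables (H H1 : R -> 'I_3 -> 'I_3 -> R -> R).
Hypothesis basis : decaying_basis s t w H H1.
Local Notation W := (dtn H1).

(** With the middle value zero there is no cross term between the outer trial functions. In each
    remaining component [pert] is at least 1/500 tau^2, which dominates five times lam after the
    loss 105/100 from tau to tanh. *)
Lemma quad_plus_plane lam a : 0 <= lam <= 1 / 50 / 100 -> a != 0 -> a 1 0 = 0 ->
  (s = Minus -> a 0 0 = 0) -> (t = Minus -> a 2 0 = 0) -> quad (W lam) a < 0.
Proof.
move=> /andP[l0 l1] an a1 sM tM.
have hl : spectral_range lam by apply/andP; split; lra.
apply: (quad_trial hw basis (d := 1 / 5 / 100 / (105 / 100)) hl an l0); first by lra.
move=> x x0; rewrite /qform a1 !sum3 a1 !mul0r !mulr0 !subr0 expr0n /= !mulr0 !addr0.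
have T i := tk_tau_sqr i x0; have T0 := sqr_ge0 (tau x).
have P0 : lam * (a 0 0 * psi (k 0) x) ^+ 2 - pi_ 0 x * (a 0 0 * psi (k 0) x) ^+ 2 <=
    (lam - 1 / 5 / 100 / (105 / 100) * tk (k 0) x ^+ 2) * (a 0 0 * psi (k 0) x) ^+ 2.
  have [E|E] : s = Plus \/ s = Minus by case: (s); [left|right].
    rewrite -mulrBl; apply: ler_wpM2r; first exact: sqr_ge0.
    by have := pert0_plus E x0; have := T 0; lra.
  by rewrite sM// mul0r expr0n /= !mulr0 subr0.
have P2 : lam * (a 2 0 * psi (k 2) x) ^+ 2 - pi_ 2 x * (a 2 0 * psi (k 2) x) ^+ 2 <=
    (lam - 1 / 5 / 100 / (105 / 100) * tk (k 2) x ^+ 2) * (a 2 0 * psi (k 2) x) ^+ 2.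
  have [E|E] : t = Plus \/ t = Minus by case: (t); [left|right].
    rewrite -mulrBl; apply: ler_wpM2r; first exact: sqr_ge0.
    by have := pert2_plus E x0; have := T 2; lra.
  by rewrite tM// mul0r expr0n /= !mulr0 subr0.
by move: P0 P2 => /=; lra.
Qed.

End trial_estimates.

Section determinant.
Context {R : realType} (s t : sign) (w w1 : 'I_3 -> R -> R).
Hypothesis hw : wave_data s t w w1.
Variables (H H1 : R -> 'I_3 -> 'I_3 -> R -> R).
Hypothesis basis : decaying_basis s t w H H1.
Local Notation W := (dtn H1).
Implicit Types (i : 'I_3) (x lam : R) (a : 'cV[R]_3).

Lemma dtn_tr lam : spectral_range lam -> (W lam)^T = W lam.
Proof. by move=> hl; apply/matrixP => i j; rewrite mxE; exact: (dtn_sym basis). Qed.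

Lemma det_dtn_top : 0 < \det (W (1 / 50)).
Proof.
have hl : spectral_range (1 / 50 : R) by apply/andP; split; lra.
apply: det_pos_def; first exact: dtn_tr.
by move=> a an; apply: (quad_top hw basis hl _ an); lra.
Qed.

(** The basis is only specified for lam in [0, 1/50]. Clamping yields a continuous function on the
    whole line for the intermediate value theorem. *)
Definition clamp lam : R := Num.max 0 (Num.min lam (1 / 50)).

Lemma clamp_range lam : spectral_range (clamp lam).
Proof.
rewrite /spectral_range /clamp le_max lexx /= ge_max ge_min lexx orbT andbT; lra.
Qed.

Lemma clamp_id lam : spectral_range lam -> clamp lam = lam.
Proof. by move=> /andP[h1 h2]; rewrite /clamp min_l// max_r. Qed.

Lemma clamp_lip lam mu : `|clamp lam - clamp mu| <= `|lam - mu|.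
Proof.
rewrite /clamp /Num.max /Num.min; do ! case: ifP => /=; rewrite ?ltNge => *.
all: rewrite ler_norml; apply/andP; split; case: (ger0P (lam - mu)) => ?; lra.
Qed.

Lemma continuous_dtn i j : continuous (fun lam => W (clamp lam) i j).
Proof.
pose C : R := 48 / al.
have C0 : 0 < C by rewrite divr_gt0// al_gt0.
move=> lam; apply/cvgrPdist_le => e e0.
have eC : 0 < e / C by rewrite divr_gt0.
near=> y; have h := dtn_lipschitz basis i j (clamp_range lam) (clamp_range y).
rewrite (dtn_sym basis j i (clamp_range y)) in h.
apply: le_trans h _; apply: (@le_trans _ _ (e / C * C)); last by rewrite divfK// gt_eqF.
apply: ler_wpM2r; first exact: ltW.
apply: le_trans (clamp_lip _ _) _; near: y; exact: cvgr_dist_le.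
Unshelve. all: by end_near. Qed.

Lemma continuous_det_dtn : continuous (fun lam => \det (W (clamp lam))).
Proof.
have c i j := @continuous_dtn i j.
rewrite (_ : (fun lam => _) = fun lam => W (clamp lam) 0 0 * (W (clamp lam) 1 1 * W (clamp lam) 2 2 - W (clamp lam) 1 2 * W (clamp lam) 2 1)
  - W (clamp lam) 0 1 * (W (clamp lam) 1 0 * W (clamp lam) 2 2 - W (clamp lam) 1 2 * W (clamp lam) 2 0)
  + W (clamp lam) 0 2 * (W (clamp lam) 1 0 * W (clamp lam) 2 1 - W (clamp lam) 1 1 * W (clamp lam) 2 0)).
  by cont; exact: c.
by apply/funext => lam; rewrite det3.
Qed.

Definition even_mode lam (h h1 : 'I_3 -> R -> R) :=
  [/\ lin_sol s t w lam h h1, forall i, h1 i 0 = 0, exists i, h i 0 != 0 &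
      forall i, exists C, forall x, 0 <= x -> `|h i x| <= C * om x /\ `|h1 i x| <= C * om x].

(** A kernel vector of the boundary matrix gives a decaying solution with zero derivative at 0. The
    strict inequalities for lam keep modes from adjacent intervals apart. *)
Lemma even_mode_exists la lb : 0 <= la <= lb -> lb <= 1 / 50 ->
  (\det (W la) < 0 < \det (W lb) \/ \det (W lb) < 0 < \det (W la)) ->
  exists lam h h1, la < lam < lb /\ even_mode lam h h1.
Proof.
move=> /andP[la0 lab] lb1 hd.
have ra : spectral_range la by apply/andP; split=> //; exact: le_trans lb1.
have rb : spectral_range lb by apply/andP; split=> //; exact: le_trans lab.
pose D lam := \det (W (clamp lam)).
have [||lam] := @IVT _ D la lb 0 lab.
- exact/continuous_subspaceT/continuous_det_dtn.
- rewrite /D !clamp_id// ge_min le_max; by case: hd => /andP[/ltW -> /ltW ->]; rewrite ?orbT.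
rewrite in_itv /= => /andP[h1 h2] D0.
have rl : spectral_range lam.
  by apply/andP; split; [exact: le_trans h1|exact: le_trans lb1].
rewrite /D clamp_id// in D0.
have nla : lam != la.
  by apply/eqP => e; rewrite e in D0; case: hd => /andP[]; rewrite D0 ltxx.
have nlb : lam != lb.
  by apply/eqP => e; rewrite e in D0; case: hd => /andP[]; rewrite D0 ltxx.
have /det0P[v v0 vW] : \det (W lam) == 0 by rewrite D0.
pose a := v^T.
have Wa : W lam *m a = 0 by rewrite /a -[W lam]dtn_tr// -trmx_mul vW trmx0.
exists lam, (ext H lam a), (ext1 H1 lam a); split.
  by rewrite !lt_neqAle h1 h2 nlb eq_sym nla.
split.
- exact: (ext_sol basis).
- by move=> i; rewrite ext10 Wa mxE oppr0.
- apply: contrapT => hn; case/negP: v0; apply/eqP/rowP => i; rewrite mxE.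
  apply: contrapT => /eqP vi; apply: hn; exists i.
  by rewrite (ext0 basis)// mxE.
- move=> i.
  have /choice[C hC] : forall j, exists C, forall x, 0 <= x -> `|H lam j i x| <= C * om x /\ `|H1 lam j i x| <= C * om x.
    move=> j; have [_ _ h4 /(_ i)[C hC]] := basis j rl; exists (4 + `|C|) => x x0.
    have o0 := om_gt0 x0; have q4 := h4 i x x0; have qC := hC x x0.
    have := ler_norm C => cn; have := normr_ge0 C => n0; split.
      by apply: le_trans q4 _; rewrite ler_pM2r//; lra.
    by apply: le_trans qC _; rewrite ler_pM2r//; lra.
  exists (\sum_(j < 3) `|a j 0| * C j) => x x0; split.
    apply: le_trans (ler_norm_sum _ _ _) _; rewrite mulr_suml; apply: ler_sum => j _.
    by rewrite normrM -mulrA; apply: ler_wpM2l => //; case: (hC j x x0).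
  apply: le_trans (ler_norm_sum _ _ _) _; rewrite mulr_suml; apply: ler_sum => j _.
  by rewrite normrM -mulrA; apply: ler_wpM2l => //; case: (hC j x x0).
Qed.

End determinant.

Section signs.
Context {R : realType}.
Implicit Types (M : 'M[R]_3) (x y z : 'cV[R]_3).

Definition cols x y z : 'M[R]_3 := \matrix_(i, j) [:: x i 0; y i 0; z i 0]`_j.

Lemma cols_mul x y z (a b c : R) : cols x y z *m col3 a b c = a *: x + b *: y + c *: z.
Proof. by apply/colP => i; rewrite !mxE sum3 !mxE /=; ring. Qed.

Lemma det_neg M x y z : M^T = M -> \det (cols x y z) != 0 -> quad M x < 0 ->
  (forall b c, b != 0 \/ c != 0 -> 0 < quad M (b *: y + c *: z)) -> \det M < 0.
Proof.
move=> sM P0 hx hyz; apply: (det_signature sM P0).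
  by rewrite cols_mul !scale0r !addr0 scale1r.
by move=> b c bc; rewrite cols_mul scale0r add0r; exact: hyz.
Qed.

(** Apply [det_neg] to - M: in odd dimension the determinant changes sign. *)
Lemma det_pos M x y z : M^T = M -> \det (cols x y z) != 0 -> 0 < quad M x ->
  (forall b c, b != 0 \/ c != 0 -> quad M (b *: y + c *: z) < 0) -> 0 < \det M.
Proof.
move=> sM P0 hx hyz; have sN : (- M)^T = - M by rewrite raddfN /= sM.
have : \det (- M) < 0.
  apply: (@det_neg (- M) x y z sN P0); first by rewrite quadN oppr_lt0.
  by move=> b c bc; rewrite quadN oppr_gt0; exact: hyz.
by rewrite -scaleN1r detZ (_ : (-1) ^+ 3 = -1 :> R) ?mulN1r ?oppr_lt0//; ring.
Qed.

End signs.

(** * Existence of even modes *)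

Section mode_existence.
Context {R : realType} (s t : sign) (w w1 : 'I_3 -> R -> R).
Hypothesis hw : wave_data s t w w1.
Implicit Types (i : 'I_3) (x lam : R) (a : 'cV[R]_3).
Local Notation mode := (even_mode s t w).

Definition pvec : 'cV[R]_3 := \col_i dprofile s t w1 i 0.

Definition small_rate : R := 1 / 50 / 100.

Lemma small_range : spectral_range small_rate.
Proof. by apply/andP; rewrite /small_rate; split; lra. Qed.

Section with_basis.
Variables (H H1 : R -> 'I_3 -> 'I_3 -> R -> R).
Hypothesis basis : decaying_basis s t w H H1.
Local Notation W := (dtn H1).

Lemma quad_translation_vec lam b a : spectral_range lam -> 0 < lam -> b *: pvec + a != 0 ->
  (forall i, pinned s t i -> a i 0 = 0) -> 0 < quad (W lam) (b *: pvec + a).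
Proof.
move=> hl l0 n0 ha; apply: (quad_translation hw basis (y := b) hl l0 n0) => i /ha ai.
by rewrite !mxE ai addr0.
Qed.

(** The negative direction is the outer component with positive coupling. On the span of v'(0) and
    the other outer direction the form is positive, since that direction is not pinned. *)
Lemma det_dtn_mixed : (s, t) = (Plus, Minus) \/ (s, t) = (Minus, Plus) -> \det (W small_rate) < 0.
Proof.
have p0 i : dprofile s t w1 i 0 != 0 by rewrite gt_eqF// (dprofile_gt0 hw).
have sp : 0 < small_rate by rewrite /small_rate; lra.
have nz (b : R) a j : b != 0 \/ a j 0 != 0 -> a 1 0 = 0 -> b *: pvec + a != 0.
  move=> h a1; apply/eqP => /colP e; have b0 : b = 0.
    by have := e 1; rewrite !mxE a1 addr0 => /eqP; rewrite mulf_eq0 (negbTE (p0 1)) orbF => /eqP.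
  by have := e j; rewrite !mxE b0 mul0r add0r => aj; case: h; rewrite ?b0 ?aj eqxx.
have tr := dtn_tr basis small_range.
case=> st.
- apply: (@det_neg _ _ (col3 1 0 0) pvec (col3 0 0 1) tr).
  + by rewrite det3 !mxE /=; rewrite (_ : _ + _ = dprofile s t w1 1 0) ?p0//; ring.
  + apply: (quad_plus_plane hw basis).
    * by rewrite /small_rate; apply/andP; split; lra.
    * by apply/eqP => /colP/(_ 0); rewrite !mxE /= => /eqP; rewrite oner_eq0.
    * by rewrite mxE.
    * by case: st => -> ; rewrite ?mxE.
    * by case: st => _ ->; rewrite ?mxE.
  + move=> b c bc; apply: (quad_translation_vec small_range sp).
      by apply: (@nz b (c *: col3 0 0 1) 2); rewrite // !mxE /= ?mulr1 ?mulr0.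
    by case: st => -> -> i; rewrite !mxE /pinned; move: i; apply: forall3; rewrite //= ?mulr0.
- apply: (@det_neg _ _ (col3 0 0 1) pvec (col3 1 0 0) tr).
  + by rewrite det3 !mxE /=; rewrite (_ : _ + _ = - dprofile s t w1 1 0) ?oppr_eq0 ?p0//; ring.
  + apply: (quad_plus_plane hw basis).
    * by rewrite /small_rate; apply/andP; split; lra.
    * by apply/eqP => /colP/(_ 2); rewrite !mxE /= => /eqP; rewrite oner_eq0.
    * by rewrite mxE.
    * by case: st => -> ; rewrite ?mxE.
    * by case: st => _ ->; rewrite ?mxE.
  + move=> b c bc; apply: (quad_translation_vec small_range sp).
      by apply: (@nz b (c *: col3 1 0 0) 0); rewrite // !mxE /= ?mulr1 ?mulr0.
    by case: st => -> -> i; rewrite !mxE /pinned; move: i; apply: forall3; rewrite //= ?mulr0.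
Qed.

(** All components are pinned, so positivity is only known along v'(0), and the form is negative on
    the whole plane of the outer components. Two negative directions give a positive determinant. *)
Lemma det_dtn_plus_plus : (s, t) = (Plus, Plus) -> 0 < \det (W small_rate).
Proof.
move=> st.
have p0 i : dprofile s t w1 i 0 != 0 by rewrite gt_eqF// (dprofile_gt0 hw).
have sp : 0 < small_rate by rewrite /small_rate; lra.
have tr := dtn_tr basis small_range.
apply: (@det_pos _ _ pvec (col3 1 0 0) (col3 0 0 1) tr).
- by rewrite det3 !mxE /=; rewrite (_ : _ + _ = - dprofile s t w1 1 0) ?oppr_eq0 ?p0//; ring.
- have := @quad_translation_vec small_rate 1 0 small_range sp; rewrite addr0 scale1r; apply.
    by apply/eqP => /colP/(_ 1); rewrite !mxE; exact/eqP/p0.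
  by move=> i _; rewrite mxE.
- move=> b c bc; apply: (quad_plus_plane hw basis).
  + by rewrite /small_rate; apply/andP; split; lra.
  + apply/eqP => /colP e; have := e 0; have := e 2; rewrite !mxE /= !mulr0 !mulr1 addr0 add0r => c0 b0.
    by move: bc; rewrite b0 c0 eqxx; case.
  + by rewrite !mxE /= !mulr0 addr0.
  + by case: st => ->.
  + by case: st => _ ->.
Qed.

End with_basis.

Lemma one_mode : (s, t) = (Plus, Minus) \/ (s, t) = (Minus, Plus) ->
  exists lam h h1, 0 < lam /\ mode lam h h1.
Proof.
move=> st; have [H [H1 basis]] := decaying_basis_exists hw.
have [| |lam [h [h1 [/andP[l0 _] hm]]]] := even_mode_exists basis (la := small_rate) (lb := 1 / 50) _ (lexx _).
- by rewrite /small_rate; apply/andP; split; lra.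
- by left; rewrite (det_dtn_mixed basis st) (det_dtn_top hw basis).
by exists lam, h, h1; split => //; apply: lt_trans l0; rewrite /small_rate; lra.
Qed.

End mode_existence.

Section two_mode_existence.
Context {R : realType} (w w1 : 'I_3 -> R -> R).
Hypothesis hw : wave_data Plus Plus w w1.
Local Notation k := (@kk R Plus Plus).

(** Chosen in a narrow window: [nonneg_form_mid] requires lam > 0.0063, and the trial function along
    (1, -1, 0) requires 5 lam < 0.033. The number 0.033 comes from (0.0131 + 0.0213 + 0.036) / 2,
    the lower bounds of the two [pert] and of the cross term, divided by 105/100. *)
Definition mid_rate : R := 65 / 100 / 100.

Lemma det_dtn_mid H H1 : decaying_basis Plus Plus w H H1 -> \det (dtn H1 mid_rate) < 0.
Proof.
move=> basis.
have hl : spectral_range mid_rate by apply/andP; rewrite /mid_rate; split; lra.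
have two : (2 : R) != 0 by rewrite pnatr_eq0.
apply: (@det_neg _ _ (col3 1 (-1) 0) (col3 1 1 0) (col3 0 0 1) (dtn_tr basis hl)).
- by rewrite det3 !mxE /=; rewrite (_ : _ + _ = 2)//; ring.
- have n1 : col3 1 (-1) 0 != 0 :> 'cV[R]_3.
    by apply/eqP => /colP/(_ 0); rewrite !mxE /= => /eqP; rewrite oner_eq0.
  apply: (quad_trial hw basis (c := mid_rate) (d := 33 / 10 / 100) hl n1); [rewrite /mid_rate; lra..|].
  move=> x x0; rewrite /qform !sum3 !mxE /= -(@kk_pp01 R) !mul0r !mulr0 expr0n /= !mulr0 !addr0 !subr0.
  have [/andP[a0 _] /andP[a1 _] _] := pert_pp_bounds hw x0.
  have /andP[v0 _] := vv_bounds hw 0 1 x0; have T := tk_tau_sqr Plus Plus 0 x0.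
  have c01 : cpl Plus Plus 0 1 = 1 / 25 :> R by rewrite /cpl /signr /=; lra.
  rewrite c01; have T0 := sqr_ge0 (tau x).
  rewrite (_ : _ - _ = (2 * mid_rate - (pert Plus Plus w 0 x + pert Plus Plus w 1 x + 1 / 25 * (profile Plus Plus w 0 x * profile Plus Plus w 1 x))) * psi (k 0) x ^+ 2); last by ring.
  rewrite [leRHS](_ : _ = 2 * (mid_rate - 33 / 10 / 100 * tk (k 0) x ^+ 2) * psi (k 0) x ^+ 2); last by ring.
  by apply: ler_wpM2r; [exact: sqr_ge0|rewrite /mid_rate; lra].
- move=> b c bc; apply: (quad_gt0_nonneg basis hl (mu := 63 / 100 / 100)).
  + by rewrite /mid_rate; lra.
  + apply/eqP => /colP e; have := e 0; have := e 2; rewrite !mxE /= !mulr0 !mulr1 addr0 add0r => c0 b0.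
    by move: bc; rewrite b0 c0 eqxx; case.
  + apply: (nonneg_form_mid hw) => [i x x0|]; first exact: (ext_der basis).
    by rewrite !(ext0 basis)// !mxE /= !mulr1.
Qed.

Lemma two_modes : exists lam h h1 lam' h' h1',
  [/\ 0 < lam, lam < lam', even_mode Plus Plus w lam h h1 & even_mode Plus Plus w lam' h' h1'].
Proof.
have [H [H1 basis]] := decaying_basis_exists hw.
have dm := det_dtn_mid basis.
have [|||lam [h [h1 [/andP[l0 l1] hm]]]] := even_mode_exists basis (la := small_rate) (lb := mid_rate).
- by rewrite /small_rate /mid_rate; apply/andP; split; lra.
- by rewrite /mid_rate; lra.
- by right; rewrite dm (det_dtn_plus_plus hw basis).
have [|||lam' [h' [h1' [/andP[l2 l3] hm']]]] := even_mode_exists basis (la := mid_rate) (lb := 1 / 50).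
- by rewrite /mid_rate; apply/andP; split; lra.
- by [].
- by left; rewrite dm (det_dtn_top hw basis).
exists lam, h, h1, lam', h', h1'; split => //; last exact: lt_trans l2.
by apply: lt_trans l0; rewrite /small_rate; lra.
Qed.

End two_mode_existence.

(** * From even modes to the point spectrum *)

Section gluing.
Context {R : realType}.
Implicit Types (f g : R -> R).

Lemma der_cvg f (x d : R) : is_derive x 1 f d <-> (fun h => h^-1 * (f (h + x) - f x)) @ 0^' --> d.
Proof.
have E : (fun h : R => h^-1 *: ((f \o shift x) (h *: (1 : R)) - f x)) = fun h => h^-1 * (f (h + x) - f x).
  by apply/funext => h; rewrite /= [_%:A]mulr1.
split => [[dv]|h].
  by rewrite /derive E => <-; move: dv; rewrite /derivable E.
by split; [rewrite /derivable E; apply/cvg_ex; exists d|rewrite /derive E; exact: cvg_lim h].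
Qed.

Lemma der_glue f g (p d : R) : is_derive p 1 f d -> is_derive p 1 g d -> f p = g p ->
  is_derive p 1 (fun x => if p <= x then f x else g x) d.
Proof.
move=> /der_cvg df /der_cvg dg fg; apply/der_cvg/cvgrPdist_le => e e0.
have {}df := @cvgr_dist_le _ _ _ _ _ _ _ df e e0.
have {}dg := @cvgr_dist_le _ _ _ _ _ _ _ dg e e0.
near=> h; rewrite lexx.
have h1 : `|d - h^-1 * (f (h + p) - f p)| <= e by near: h; apply: df.
have h2 : `|d - h^-1 * (g (h + p) - g p)| <= e by near: h; apply: dg.
by case: ifP => _; [exact: h1|rewrite fg; exact: h2].
Unshelve. all: by end_near. Qed.

Lemma der_near f g (x d : R) : (\near x, f x = g x) -> is_derive x 1 g d -> is_derive x 1 f d.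
Proof. by move=> fg; apply: near_eq_is_derive; near=> y; symmetry; near: y. Unshelve. all: by end_near. Qed.

Definition even_ext f x := if 0 <= x then f x else f (- x).
Definition odd_ext f x := if 0 <= x then f x else - f (- x).

(** The Neumann condition makes the one-sided derivatives agree at 0. *)
Lemma der_even_ext f (f1 : R -> R) : (forall x : R, 0 <= x -> is_derive x 1 f (f1 x)) -> f1 0 = 0 ->
  forall x : R, is_derive x 1 (even_ext f) (odd_ext f1 x).
Proof.
move=> df f10 x; have [x0|x0|->] := ltgtP x 0.
- apply: (@der_near _ (fun y => f (- y))).
    by near=> y; rewrite /even_ext leNgt; case: ltP => //; rewrite leNgt => /negP[]; near: y; exact: lt_nbhsl.
  rewrite /odd_ext leNgt x0 /=; have xn : 0 <= - x by rewrite oppr_ge0 ltW.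
  apply: (derE (der_comp (derN (derI x)) (df _ xn))); ring.
- apply: (@der_near _ f).
    by near=> y; rewrite /even_ext; case: leP => //; rewrite ltNge => /negP[]; apply: ltW; near: y; exact: lt_nbhsr.
  rewrite /odd_ext (ltW x0); exact/df/ltW.
- rewrite /odd_ext lexx; apply: der_glue; [exact: df| |by rewrite oppr0].
  have n0 : 0 <= - 0 :> R by rewrite oppr0.
  by apply: (derE (der_comp (derN (derI 0)) (df _ n0))); rewrite oppr0 f10; ring.
Unshelve. all: by end_near. Qed.

Lemma der_odd_ext f (f1 : R -> R) : (forall x : R, 0 <= x -> is_derive x 1 f (f1 x)) -> f 0 = 0 ->
  forall x : R, is_derive x 1 (odd_ext f) (even_ext f1 x).
Proof.
move=> df f0 x; have [x0|x0|->] := ltgtP x 0.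
- apply: (@der_near _ (fun y => - f (- y))).
    by near=> y; rewrite /odd_ext leNgt; case: ltP => //; rewrite leNgt => /negP[]; near: y; exact: lt_nbhsl.
  rewrite /even_ext leNgt x0 /=; have xn : 0 <= - x by rewrite oppr_ge0 ltW.
  apply: (derE (derN (der_comp (derN (derI x)) (df _ xn)))); ring.
- apply: (@der_near _ f).
    by near=> y; rewrite /odd_ext; case: leP => //; rewrite ltNge => /negP[]; apply: ltW; near: y; exact: lt_nbhsr.
  rewrite /even_ext (ltW x0); exact/df/ltW.
- rewrite /even_ext lexx; apply: der_glue; [exact: df| |by rewrite oppr0 f0 oppr0].
  have n0 : 0 <= - 0 :> R by rewrite oppr0.
  by apply: (derE (derN (der_comp (derN (derI 0)) (df _ n0)))); rewrite oppr0; ring.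
Unshelve. all: by end_near. Qed.

End gluing.

Section line_eigenfunction.
Context {R : realType} (s t : sign) (w w1 : 'I_3 -> R -> R).
Hypothesis hw : wave_data s t w w1.
Implicit Types (i : 'I_3) (x lam : R).

Definition line_sol lam (e e1 : 'I_3 -> R -> R) := forall i x,
  is_derive x 1 (e i) (e1 i x) /\ is_derive x 1 (e1 i) (lin_rhs s t w lam e i x).

Lemma even_mode_line lam h h1 : even_mode s t w lam h h1 ->
  line_sol lam (fun i => even_ext (h i)) (fun i => odd_ext (h1 i)).
Proof.
move=> [sh h10 _ _] i x; split.
  by apply: der_even_ext => // y y0; have [] := sh i y y0.
apply: (derE (@der_odd_ext _ (h1 i) (lin_rhs s t w lam h i) (fun y y0 => (sh i y y0).2) (h10 i) x)).
rewrite /even_ext /lin_rhs; case: leP => // _.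
by under eq_bigr do rewrite (hs_even hw).
Qed.

End line_eigenfunction.

(** * The Hessian of the potential along the wave *)

Section hessian_formula.
Context {R : realType}.
Implicit Types (b v : 'cV[R]_3) (i j : 'I_3).

Lemma directional_derivative (G : 'cV[R]_3 -> R) (a v : 'cV[R]_3) (d : R) :
  is_derive (0 : R) 1 (fun h : R => G (h *: a + v)) d -> 'D_a G v = d.
Proof.
move=> [_ <-]; rewrite /derive; congr (lim (_ @ 0^')).
by apply/funext => h; rewrite /= addr0 [_%:A]mulr1 scale0r add0r.
Qed.

Lemma shift_entry i j v (h : R) : (h *: delta_mx j 0 + v) i 0 = h * (i == j)%:R + v i 0.
Proof. by rewrite !mxE eqxx andbT. Qed.

Definition potential_grad b (c12 c23 : R) j v : R :=
  let u1 := v 0 0 in let u2 := v 1 0 in let u3 := v 2 0 in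
  - (1 / 2) * b j 0 * v j 0 * (1 - v j 0) * (1 - 2 * v j 0)
  - (1 / 2) * (1 - 2 * v j 0) * [:: c12 * u2 * (1 - u2); c12 * u1 * (1 - u1) + c23 * u3 * (1 - u3); c23 * u2 * (1 - u2)]`_j.

Lemma grad_potential b (c12 c23 : R) j v :
  'D_(delta_mx j 0) (potential b c12 c23) v = potential_grad b c12 c23 j v.
Proof.
apply: directional_derivative; rewrite /potential /potential_grad.
rewrite (_ : (fun h => _) = fun h =>
  - (1 / 4) * (b 0 0 * (h * (0 == j)%:R + v 0 0) ^+ 2 * (1 - (h * (0 == j)%:R + v 0 0)) ^+ 2
     + b 1 0 * (h * (1 == j)%:R + v 1 0) ^+ 2 * (1 - (h * (1 == j)%:R + v 1 0)) ^+ 2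
     + b 2 0 * (h * (2 == j)%:R + v 2 0) ^+ 2 * (1 - (h * (2 == j)%:R + v 2 0)) ^+ 2)
  - (1 / 2) * (c12 * (h * (0 == j)%:R + v 0 0) * (1 - (h * (0 == j)%:R + v 0 0)) * (h * (1 == j)%:R + v 1 0) * (1 - (h * (1 == j)%:R + v 1 0))
     + c23 * (h * (1 == j)%:R + v 1 0) * (1 - (h * (1 == j)%:R + v 1 0)) * (h * (2 == j)%:R + v 2 0) * (1 - (h * (2 == j)%:R + v 2 0)))).
  by der; move: j; apply: forall3 => /=; field.
by apply/funext => h; rewrite sum3 !shift_entry.
Qed.

Lemma hessian_potential b (c12 c23 : R) v i j :
  hessian (potential b c12 c23) v i j =
  let u1 := v 0 0 in let u2 := v 1 0 in let u3 := v 2 0 in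
  if i == j then - (1 / 2) * b i 0 * (1 - 6 * v i 0 + 6 * v i 0 ^+ 2)
     + [:: c12 * u2 * (1 - u2); c12 * u1 * (1 - u1) + c23 * u3 * (1 - u3); c23 * u2 * (1 - u2)]`_i
  else - (1 / 2) * (1 - 2 * v i 0) * (1 - 2 * v j 0) * nth 0 (nth [::] [:: [:: 0; c12; 0]; [:: c12; 0; c23]; [:: 0; c23; 0]] i) j.
Proof.
rewrite mxE (_ : 'D_(delta_mx j 0) _ = potential_grad b c12 c23 j); last by apply/funext => y; exact: grad_potential.
apply: directional_derivative; rewrite /potential_grad.
rewrite (_ : (fun h => _) = fun h =>
  - (1 / 2) * b j 0 * (h * (j == i)%:R + v j 0) * (1 - (h * (j == i)%:R + v j 0)) * (1 - 2 * (h * (j == i)%:R + v j 0))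
  - (1 / 2) * (1 - 2 * (h * (j == i)%:R + v j 0)) *
   (c12 * (j == 0)%:R * (h * (1 == i)%:R + v 1 0) * (1 - (h * (1 == i)%:R + v 1 0))
    + c12 * (j == 1)%:R * (h * (0 == i)%:R + v 0 0) * (1 - (h * (0 == i)%:R + v 0 0))
    + c23 * (j == 1)%:R * (h * (2 == i)%:R + v 2 0) * (1 - (h * (2 == i)%:R + v 2 0))
    + c23 * (j == 2)%:R * (h * (1 == i)%:R + v 1 0) * (1 - (h * (1 == i)%:R + v 1 0)))).
  by der; move: i j; apply: forall3; apply: forall3 => /=; field.
apply/funext => h; rewrite !shift_entry.
by move: i j; apply: forall3; apply: forall3 => /=; rewrite ?shift_entry /=; ring.
Qed.

Definition b0 : 'cV[R]_3 := col3 1 (98 / 100) (96 / 100).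

Definition wave s t (w : 'I_3 -> R -> R) x : 'cV[R]_3 := \col_i ((1 + profile s t w i x) / 2).

Lemma b0E i : b0 i 0 = bb i.
Proof. by rewrite mxE. Qed.

(** For u = (1 + v) / 2 one has u (1 - u) = (1 - v^2) / 4 and 1 - 2 u = - v. *)
Lemma hessian_wave s t w x i j :
  hessian (potential b0 (signr s * (4 / 100)) (signr t * (2 / 100))) (wave s t w x) i j = hs s t w i j x.
Proof.
rewrite hessian_potential /hs /diag_coef b0E sum3 /cpl !mxE.
by move: i j; apply: forall3; apply: forall3 => /=; field.
Qed.

End hessian_formula.

(** * Integration on the line and test functions *)

Section real_line.
Context {R : realType}.
Local Notation mu := (@lebesgue_measure R).
Implicit Types (f g F : R -> R) (a b x : R).

Lemma integrable_itv f a b : continuous f -> mu.-integrable `[a, b] (EFin \o f).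
Proof.
move=> cf; apply: continuous_compact_integrable; first exact: segment_compact.
exact: continuous_subspaceT.
Qed.

Lemma integral_der F f a b : (forall x, is_derive x 1 F (f x)) -> continuous f -> a < b ->
  (\int[mu]_(x in `[a, b]) (f x)%:E)%E = (F b - F a)%:E.
Proof.
move=> dF cf ab; rewrite (@continuous_FTC2 _ f F a b)//.
- exact: continuous_subspaceT.
- split; first by move=> x _; have [] := dF x.
    by apply: cvg_at_right_filter; exact: der_continuous (dF a).
  by apply: cvg_at_left_filter; exact: der_continuous (dF b).
- by move=> x _; rewrite derive1E; have [_ ->] := dF x.
Qed.

Lemma Rintegral_der F f a b : (forall x, is_derive x 1 F (f x)) -> continuous f -> a < b ->
  \int[mu]_(x in `[a, b]) f x = F b - F a.
Proof. by move=> dF cf ab; rewrite /Rintegral (integral_der dF cf ab). Qed.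

Lemma Rintegral_outside f (A B : R) : (forall x, (x < A) || (B < x) -> f x = 0) ->
  \int[mu]_(x in `[A, B]) f x = \int[mu]_x f x.
Proof.
move=> fB; rewrite Rintegral_mkcond; congr Rintegral; apply/funext => x.
by rewrite patchE mem_setE in_itv /=; case: ifP => // /negbT; rewrite negb_and -!ltNge => /fB.
Qed.

Lemma test_function_support (psi : R -> R) : test_function psi ->
  exists2 B, 0 < B & forall x, B < `|x| -> psi x = 0 /\ psi^`()%classic x = 0.
Proof.
move=> [_ /compact_bounded[M [_ /(_ (`|M| + 1))]]].
rewrite (le_lt_trans (ler_norm M)) ?ltrDl// => /(_ isT) hM.
have z x : `|M| + 1 < `|x| -> psi x = 0.
  move=> hx; apply: contrapT => /eqP px; have : `|x| <= `|M| + 1 := hM x (@subset_closure _ _ x px).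
  by rewrite leNgt hx.
exists (`|M| + 1); first by rewrite ltr_wpDl.
move=> x hx; split; first exact: z.
rewrite derive1E; suff [_ ->] : is_derive x 1 psi 0 by [].
apply: (@der_near _ psi (fun=> 0) x 0 _ (derC 0 x)).
have /cvgr_gt/(_ _ hx) h : (fun y : R => `|y|) @ x --> `|x| by exact: norm_continuous.
by near=> y; apply: z; near: y; exact: h.
Unshelve. all: by end_near. Qed.

Lemma test_function_continuous (psi : R -> R) : test_function psi ->
  continuous psi /\ continuous psi^`()%classic.
Proof.
move=> [d _]; split => x; apply/differentiable_continuous/derivable1_diffP.
  exact: (d 0%N x).
exact: (d 1%N x).
Qed.

Lemma test_function_der (psi : R -> R) x : test_function psi -> is_derive x 1 psi (psi^`()%classic x).
Proof. by move=> [d _]; split; [exact: (d 0%N x)|rewrite derive1E]. Qed.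

Lemma integration_by_parts_test f (f1 psi : R -> R) : (forall x, is_derive x 1 f (f1 x)) -> continuous f1 ->
  test_function psi ->
  \int[mu]_x (f x * psi^`()%classic x) = - \int[mu]_x (f1 x * psi x).
Proof.
move=> df cf1 tp; have [B B0 hB] := test_function_support tp.
have [c0 c1] := test_function_continuous tp.
have cf : continuous f by move=> x; exact: der_continuous (df x).
have out x : (x < - (B + 1)) || (B + 1 < x) -> B < `|x|.
  by rewrite ltr_normr => /orP[] h; apply/orP; [right|left]; lra.
rewrite -(@Rintegral_outside _ (- (B + 1)) (B + 1)) => [|x /out/hB[_ ->]]; last by rewrite mulr0.
rewrite -(@Rintegral_outside (fun x => f1 x * psi x) (- (B + 1)) (B + 1)) => [|x /out/hB[-> _]]; last by rewrite mulr0.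
apply/eqP; rewrite -addr_eq0 -RintegralD//; [|by apply: integrable_itv; exact: contM..].
have dP (x : R) : is_derive x 1 (fun x => f x * psi x) (f x * psi^`()%classic x + f1 x * psi x).
  by have := df x => ?; have := test_function_der x tp => ?; der; ring.
have cP : continuous (fun x => f x * psi^`()%classic x + f1 x * psi x) by apply: contD; exact: contM.
rewrite (Rintegral_der dP cP); last by rewrite gtrN// addr_gt0.
have b1 : B < `|B + 1| by rewrite gtr0_norm ?ltrDl// addr_gt0//.
by have [-> _] := hB _ b1; rewrite -normrN in b1; have [-> _] := hB _ b1; rewrite !mulr0 subrr.
Qed.

Lemma ae_continuous_zero f : continuous f -> {ae mu, forall x, f x = 0} -> forall x, f x = 0.
Proof.
move=> cf h x; apply: contrapT => /eqP fx.
have hn := cvgr_neq0 (f x) (cf x) fx.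
have [r /= r0 hr] : nbhs x [set y | f y != 0] by exact: hn.
have : mu.-negligible (ball x r).
  apply: negligibleS h => y /hr /= fy; exact/eqP.
move=> /measure_negligible => /(_ (measurable_ball _ _)).
move=> z; have := lebesgue_measure_ball x (ltW r0); rewrite [LHS]z => /esym/eqP.
by rewrite eqe mulrn_eq0 /= gt_eqF.
Qed.

Lemma continuous_om_norm : continuous (fun x : R => om `|x|).
Proof.
rewrite (_ : (fun x => _) = fun x => (1 + al * `|x|)^-1); last by apply/funext => x; rewrite /om.
have c : continuous (fun x : R => 1 + al * `|x|).
  by apply: contD; [exact: contC|apply: contM; [exact: contC|exact: norm_continuous]].
move=> x; apply: cvgV; last exact: c.
by rewrite gt_eqF// ltr_pwDl// mulr_ge0// ltW// al_gt0.
Qed.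

(** On the half-line - C^2 om / al is a bounded primitive of the integrand. *)
Lemma integral_om2 (C : R) : (\int[mu]_x ((C * om `|x|) ^+ 2)%:E < +oo)%E.
Proof.
have an : al != 0 :> R by rewrite gt_eqF// al_gt0.
have cf : continuous (fun x : R => (C * om `|x|) ^+ 2).
  by apply: contX; apply: contM; [exact: contC|exact: continuous_om_norm].
have dF (x : R) : 0 <= x -> is_derive x 1 (fun x => - (C ^+ 2 / al) * om x) ((C * om x) ^+ 2).
  by move=> x0; have := der_om x0 => d; der; field.
have om0 : om x @[x --> +oo] --> (0 : R).
  apply/cvgrPdist_le => e e0; have [X hX] := vanishing_om e0.
  by near=> x; rewrite sub0r normrN; apply: hX; near: x; apply: nbhs_pinfty_ge; exact: num_real.
rewrite ge0_symfun_integralT//; last by move=> x; rewrite /= normrN.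
  rewrite -set_itvcy.
  rewrite (@ge0_continuous_FTC2y _ _ (fun x => - (C ^+ 2 / al) * om x) 0 0).
  - by rewrite -EFinB -EFinM ltry.
  - by move=> x _; exact: sqr_ge0.
  - exact: continuous_subspaceT.
  - rewrite -[X in _ --> X](mulr0 (- (C ^+ 2 / al))); exact: cvgMr.
  - by move=> x /ltW/dF[].
  - by apply: cvg_at_right_filter; exact: der_continuous (dF 0 (lexx 0)).
  - move=> x; rewrite in_itv /= andbT => x0; have [_ e] := dF x (ltW x0).
    by rewrite derive1E [LHS]e (gtr0_norm x0).
by move=> x; exact: sqr_ge0.
Unshelve. all: by end_near. Qed.

Lemma Lfun2_om f (C : R) : continuous f -> (forall x, `|f x| <= C * om `|x|) -> f \in Lfun mu 2%:E.
Proof.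
move=> cf hf; have mf : measurable_fun setT f by exact: continuous_measurable_fun.
rewrite inE; apply/andP; split; rewrite inE//=.
rewrite /finite_norm unlock poweR_lty//.
apply: le_lt_trans (integral_om2 C); apply: ge0_le_integral => //=.
- apply/measurable_EFinP; apply: (@measurableT_comp _ _ _ _ _ _ (fun x : R => x `^ 2)) => //.
  exact: measurableT_comp.
- apply/measurable_EFinP; apply: continuous_measurable_fun.
  by apply: contX; apply: contM; [exact: contC|exact: continuous_om_norm].
- move=> x _; rewrite lee_fin powR_mulrn// lerXn2r ?nnegrE//; exact: le_trans (hf x).
Qed.

End real_line.

(** * Even modes as eigenfunctions in the Sobolev space *)

Section mode_in_spectrum.
Context {R : realType} (s t : sign) (w w1 : 'I_3 -> R -> R).
Hypothesis hw : wave_data s t w w1.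
Local Notation v := (profile s t w).
Local Notation mu := (@lebesgue_measure R).
Implicit Types (i j : 'I_3) (x lam : R).

Lemma profile_norm i x : `|v i x| <= 2.
Proof.
have [x0|/ltW x0] := leP 0 x; first exact: (profile_norm_le hw).
by rewrite -normrN -(profile_odd hw); apply: (profile_norm_le hw); rewrite oppr_ge0.
Qed.

Lemma hs_bounded i j : exists K : R, forall x, `|hs s t w i j x| <= K.
Proof.
have one (l : 'I_3) x : 0 <= v l x ^+ 2 <= 4.
  by have := profile_norm l x; rewrite ler_norml sqr_ge0 => /andP[h1 h2] /=; nra.
exists (1 / 4 * (`|bb i| * 13 + \sum_(l < 3) `|cpl s t i l| * 5) + `|cpl s t i j / 2| * 4) => x.
rewrite /hs; apply: le_trans (ler_normB _ _) _; apply: lerD; last first.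
  rewrite normrM; apply: ler_wpM2l => //; rewrite normrM.
  by apply: (@le_trans _ _ (2 * 2)); [apply: ler_pM => //; exact: profile_norm|lra].
case: eqP => _; last first.
  rewrite normr0; apply: mulr_ge0; first lra.
  apply: addr_ge0; first by apply: mulr_ge0.
  by apply: sumr_ge0 => l _; apply: mulr_ge0.
rewrite /diag_coef normrM (@ger0_norm R (1 / 4)); last lra.
apply: ler_wpM2l; first lra.
apply: le_trans (ler_normD _ _) _; apply: lerD.
  rewrite normrM; apply: ler_wpM2l => //; have /andP[h1 h2] := one i x.
  by rewrite ler_norml; apply/andP; split; lra.
apply: le_trans (ler_norm_sum _ _ _) _; apply: ler_sum => l _; rewrite normrM.
apply: ler_wpM2l => //; have /andP[h1 h2] := one l x.
by rewrite ler_norml; apply/andP; split; lra.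
Qed.

Lemma lin_rhs_bounded lam (e : 'I_3 -> R -> R) (C : R) i :
  (forall i x, `|e i x| <= C * om `|x|) ->
  exists D : R, forall x, `|lin_rhs s t w lam e i x| <= D * om `|x|.
Proof.
move=> he; have /choice[K hK] := hs_bounded i.
exists (`|lam| * C + \sum_(j < 3) K j * C) => x.
rewrite /lin_rhs; apply: le_trans (ler_normB _ _) _; rewrite mulrDl; apply: lerD.
  by rewrite normrM -mulrA; apply: ler_wpM2l.
apply: le_trans (ler_norm_sum _ _ _) _; rewrite mulr_suml; apply: ler_sum => j _.
by rewrite normrM -mulrA; apply: ler_pM.
Qed.

Lemma continuous_lin_rhs lam (e : 'I_3 -> R -> R) i :
  (forall i, continuous (e i)) -> continuous (lin_rhs s t w lam e i).
Proof.
move=> ce; rewrite /lin_rhs; apply: contB; first by apply: contM; [exact: contC|exact: ce].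
apply: cont_sum => j; apply: contM; [exact: (continuous_hs hw)|exact: ce].
Qed.

Lemma mode_in_spectrum lam h h1 : even_mode s t w lam h h1 ->
  point_spectrum b0 (signr s * (4 / 100)) (signr t * (2 / 100)) (wave s t w) lam.
Proof.
move=> hm; have [sh h10 [i0 hi0] /choice[C0 hC0]] := hm; have ls := even_mode_line hw hm.
pose e i := even_ext (h i); pose e1 i := odd_ext (h1 i).
pose C := \sum_(i < 3) `|C0 i|.
have CC i : C0 i <= C.
  by apply: le_trans (ler_norm _) _; rewrite /C (bigD1 i)//= lerDl; apply: sumr_ge0.
have be i x : `|e i x| <= C * om `|x|.
  have [b _] := hC0 i `|x| (normr_ge0 x); apply: le_trans (_ : _ <= C0 i * om `|x|) _; last first.
    by apply: ler_wpM2r => //; exact/ltW/om_gt0.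
  apply: le_trans b; rewrite /e /even_ext; case: ifP => x0; first by rewrite (ger0_norm x0).
  by rewrite (@ltr0_norm _ x)// ltNge x0.
have be1 i x : `|e1 i x| <= C * om `|x|.
  have [_ b] := hC0 i `|x| (normr_ge0 x); apply: le_trans (_ : _ <= C0 i * om `|x|) _; last first.
    by apply: ler_wpM2r => //; exact/ltW/om_gt0.
  apply: le_trans b; rewrite /e1 /odd_ext; case: ifP => x0; first by rewrite (ger0_norm x0).
  by rewrite normrN (@ltr0_norm _ x)// ltNge x0.
have de i (x : R) : is_derive x 1 (e i) (e1 i x) by have [] := ls i x.
have de1 i (x : R) : is_derive x 1 (e1 i) (lin_rhs s t w lam e i x) by have [] := ls i x.
have ce i : continuous (e i) by move=> x; exact: der_continuous (de i x).
have ce1 i : continuous (e1 i) by move=> x; exact: der_continuous (de1 i x).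
have ce2 i := @continuous_lin_rhs lam e i ce.
exists (fun x => \col_i e i x), (fun x => \col_i lin_rhs s t w lam e i x); split.
- split.
    move=> i; rewrite (_ : (fun x => _) = e i); last by apply/funext => x; rewrite mxE.
    exact: Lfun2_om (be i).
  exists (fun x => \col_i e1 i x); split.
  + move=> i; rewrite (_ : (fun x => _) = e1 i); last by apply/funext => x; rewrite mxE.
    exact: Lfun2_om (be1 i).
  + move=> i; rewrite (_ : (fun x => _) = lin_rhs s t w lam e i); last by apply/funext => x; rewrite mxE.
    by have [D hD] := lin_rhs_bounded lam i be; exact: Lfun2_om hD.
  + move=> psi tp i; under eq_Rintegral do rewrite mxE; under [in RHS]eq_Rintegral do rewrite mxE.
    exact: (integration_by_parts_test (de i) (ce1 i) tp).
  + move=> psi tp i; under eq_Rintegral do rewrite mxE; under [in RHS]eq_Rintegral do rewrite mxE.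
    exact: (integration_by_parts_test (de1 i) (ce2 i) tp).
- move=> z; case/negP: hi0; apply/eqP.
  have : {ae mu, forall x, e i0 x = 0}.
    by apply: negligibleS z => x /= nx /colP/(_ i0); rewrite !mxE.
  by move=> /(ae_continuous_zero (ce i0))/(_ 0); rewrite /e /even_ext lexx.
- apply: aeW => x; apply/colP => i; rewrite !mxE /lin_rhs.
  rewrite -[RHS](subrK (\sum_(j < 3) hs s t w i j x * e j x)); congr (_ + _).
  by apply: eq_bigr => j _; rewrite hessian_wave mxE.
Qed.

End mode_in_spectrum.

(** * Regularity of weak eigenfunctions *)

Section smooth.
Context {R : realType}.
Implicit Types (f g : R -> R) (x y : R).

(** Every function in a set closed under differentiation is smooth, so no formula for an n-th
    derivative is needed. *)
Definition smooth_class (S : set (R -> R)) :=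
  forall g, S g -> exists2 g', S g' & forall x, is_derive x 1 g (g' x).

Lemma smooth_class_derive S g n : smooth_class S -> S g -> S g^`(n)%classic.
Proof.
move=> hS Sg; elim: n => [//|n /hS[g' Sg' dg]].
rewrite (_ : g^`(n.+1)%classic = g') //; apply/funext => x.
by rewrite derive1nS derive1E; have [_ ->] := dg x.
Qed.

Lemma smooth_class_derivable S g n x : smooth_class S -> S g -> derivable g^`(n)%classic x 1.
Proof.
by move=> hS Sg; have [g' _ /(_ x)[]] := hS _ (smooth_class_derive n hS Sg).
Qed.

Lemma der_quad f x (K : R) : (forall y, `|f y - f x| <= K * (y - x) ^+ 2) -> is_derive x 1 f 0.
Proof.
move=> h; apply/der_cvg/cvgrPdist_le => e e0.
have K1 : 0 < `|K| + 1 by rewrite ltr_wpDl.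
near=> y; have yn : y != 0 by near: y; exact: nbhs_dnbhs_neq.
have ye : `|y| <= e / (`|K| + 1).
  by near: y; apply: dnbhs0_le; rewrite divr_gt0.
rewrite sub0r normrN normrM normfV ler_pdivrMl ?normr_gt0//.
have := h (y + x); rewrite addrK => h1; apply: le_trans h1 _.
rewrite -real_normK ?num_real// mulrC expr2 -mulrA; apply: ler_wpM2l => //.
rewrite ler_pdivlMr// in ye; apply: le_trans ye; apply: ler_wpM2l => //.
by have := ler_norm K; lra.
Unshelve. all: by end_near. Qed.

(** Polynomial multiples of z^(-m) exp (- 1 / z) with z = 1 - y^2: the functions that arise by
    differentiating the standard bump. *)
Definition bump_term (p : {poly R}) (m : nat) y : R :=
  if y ^+ 2 < 1 then p.[y] * (1 - y ^+ 2)^-1 ^+ m * expR (- (1 - y ^+ 2)^-1) else 0.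

(** From exp (1 / (k z)) >= 1 / (k z), raised to the power k. *)
Lemma expR_inv_le (z : R) k : 0 < z -> (0 < k)%N -> expR (- z^-1) <= (k%:R * z) ^+ k.
Proof.
move=> z0 k0; have kp : 0 < k%:R :> R by rewrite ltr0n.
rewrite expRN -[leRHS]invrK; rewrite lef_pV2 ?posrE ?expR_gt0 ?invr_gt0 ?exprn_gt0 ?mulr_gt0//.
rewrite -exprVn invfM -[leRHS](_ : expR (k%:R^-1 * z^-1) ^+ k = _); last first.
  by rewrite -expRM_natl mulrA divff ?gt_eqF// mul1r.
rewrite lerXn2r ?nnegrE ?expR_ge0 ?mulr_ge0 ?invr_ge0 ?(ltW kp) ?(ltW z0)//.
by apply: le_trans (expR_ge1Dx _); rewrite lerDr.
Qed.

(** The exponential bound with exponent m + 2 cancels z^(-m) and leaves z^2, where z = (x - y) (x +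
    y) at an endpoint x. Hence the derivative at the endpoints is 0. *)
Lemma bump_term_quad p m : exists K : R, forall x y, x ^+ 2 = 1 -> `|bump_term p m y - bump_term p m x| <= K * (y - x) ^+ 2.
Proof.
pose M := \sum_(i < size p) `|p`_i|.
have [k kE] : exists k, k = (m + 2)%N by eexists.
exists (M * (k%:R ^+ k * 4)) => x y x1.
rewrite {2}/bump_term x1 ltxx subr0 /bump_term; case: ifP => y1; last first.
  rewrite normr0; apply: mulr_ge0; last exact: sqr_ge0.
  apply: mulr_ge0; first exact: sumr_ge0.
  by apply: mulr_ge0 => //; exact: exprn_ge0.
have z0 : 0 < 1 - y ^+ 2 by rewrite subr_gt0.
have pM : `|p.[y]| <= M.
  rewrite horner_coef; apply: le_trans (ler_norm_sum _ _ _) _; apply: ler_sum => i _.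
  rewrite normrM normrX; apply: ler_piMr => //; apply: exprn_ile1 => //.
  by rewrite -(@expr_le1 _ 2)// real_normK ?num_real// ltW.
have b0 : 0 <= (1 - y ^+ 2)^-1 ^+ m by rewrite exprn_ge0// invr_ge0 ltW.
rewrite -mulrA normrM -[leRHS]mulrA; apply: ler_pM => //.
rewrite ger0_norm; last by rewrite mulr_ge0// expR_ge0.
have k0 : (0 < k)%N by rewrite kE addn2.
have e := @expR_inv_le (1 - y ^+ 2) k z0 k0.
apply: (@le_trans _ _ ((1 - y ^+ 2)^-1 ^+ m * (k%:R * (1 - y ^+ 2)) ^+ k)).
  by apply: ler_wpM2l.
have zn : (1 - y ^+ 2) ^+ m != 0 by rewrite expf_neq0// gt_eqF.
rewrite exprMn exprVn mulrCA -[leRHS]mulrA; apply: ler_wpM2l; first exact: exprn_ge0.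
rewrite kE exprD mulKf//.
have -> : 1 - y ^+ 2 = (x - y) * (x + y) by rewrite -x1; ring.
rewrite exprMn [leRHS]mulrC -[in leRHS]sqrrN opprB; apply: ler_wpM2l; first exact: sqr_ge0.
by have := sqr_ge0 (x - y); rewrite sqrrB sqrrD; move: x1 y1; lra.
Qed.

Lemma bump_smooth : smooth_class [set g | exists p m, g = bump_term p m].
Proof.
move=> _ [p [m ->]].
(* The product rule with z' = - 2 y, collected over z^(m + 2). *)
pose q := p^`() * (1 - 'X^2) ^+ 2 + m%:R%:P * (2%:P * 'X * p * (1 - 'X^2)) - 2%:P * 'X * p.
exists (bump_term q m.+2); first by exists q, m.+2.
move=> y; have [y1|y1|y1] := ltgtP (y ^+ 2) 1.
- have cy : continuous (fun y : R => y ^+ 2) by exact: exprn_continuous.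
  apply: (@der_near _ _ (fun y => p.[y] * (1 - y ^+ 2)^-1 ^+ m * expR (- (1 - y ^+ 2)^-1)) y).
    near=> z; rewrite /bump_term (_ : z ^+ 2 < 1)//; near: z.
    exact: (cvgr_lt _ (cy y)).
  have zn : 1 - y ^+ 2 != 0 by rewrite gt_eqF// subr_gt0.
  have dp : is_derive y 1 (horner p) p^`().[y] by exact: is_derive_poly.
  have de (x : R) : is_derive x 1 expR (expR x) by exact: is_derive_expR.
  have dz : is_derive y 1 (fun y => - (1 - y ^+ 2)^-1) (- (2 * y) / (1 - y ^+ 2) ^+ 2) by der => //; field.
  have dE := der_comp dz (de _).
  der; first exact: zn.
  have qE : q.[y] = p^`().[y] * (1 - y ^+ 2) ^+ 2 + m%:R * (2 * y * p.[y] * (1 - y ^+ 2)) - 2 * y * p.[y].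
    by rewrite /q !hornerE; ring.
  rewrite /bump_term y1 qE; move: (expR _) p.[y] p^`().[y] => E a b.
  case: (m) => [|l]; first by rewrite !expr0 /=; field.
  by rewrite [l.+1.-1]/= !exprS; move: (_ ^+ l) => Z; field.
- apply: (@der_near _ _ (fun=> 0) y).
    near=> z; rewrite /bump_term ltNge (_ : 1 <= z ^+ 2)//; apply: ltW; near: z.
    exact: (cvgr_gt _ (@exprn_continuous _ 2 y)).
  by rewrite /bump_term ltNge (ltW y1); exact: derC.
- have [K hK] := bump_term_quad p m.
  rewrite {2}/bump_term y1 ltxx; apply: der_quad => z; exact: hK.
Unshelve. all: by end_near. Qed.

End smooth.

(** * Smoothed indicators of intervals *)

Section smooth_step.
Context {R : realType}.
Implicit Types (f g : R -> R) (x y a b : R) (n : nat).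

(** Phi is a primitive of the bump rho. The mass c is not normalized; it cancels at the end. *)
Record smooth_step (rho Phi : R -> R) (c : R) : Prop := SmoothStep {
  step_height : 0 < c;
  step_continuous : continuous rho;
  step_density : forall y, 0 <= rho y <= 1;
  step_support : forall y, 1 <= `|y| -> rho y = 0;
  step_der : forall y, is_derive y 1 Phi (rho y);
  step_left : forall y, y <= -1 -> Phi y = 0;
  step_right : forall y, 1 <= y -> Phi y = c;
  step_bounds : forall y, 0 <= Phi y <= c;
  step_smooth : exists2 S, smooth_class S & S Phi }.

Lemma smooth_step_exists : exists rho Phi c, smooth_step rho Phi c.
Proof.
pose rho := bump_term (1 : {poly R}) 0.
have rhoS : [set g | exists p m, g = @bump_term R p m] rho by exists 1, 0%N.
have [rho' _ drho] := bump_smooth rhoS.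
have crho : continuous rho by move=> y; exact: der_continuous (drho y).
have rhoE y : rho y = if y ^+ 2 < 1 then expR (- (1 - y ^+ 2)^-1) else 0.
  by rewrite /rho /bump_term hornerC expr0 !mul1r.
have rho01 y : 0 <= rho y <= 1.
  rewrite rhoE; case: ifP => y1; last by rewrite lexx ler01.
  by rewrite expR_ge0 -[leRHS]expR0 ler_expR oppr_le0 invr_ge0 subr_ge0 ltW.
have rho_supp y : 1 <= `|y| -> rho y = 0.
  by move=> y1; rewrite rhoE ltNge -(real_normK (num_real y)) exprn_ege1.
have [F [_ dF]] := primitive_exists crho.
pose Phi y := F y - F (-1); pose c := Phi 1.
have dPhi (y : R) : is_derive y 1 Phi (rho y) by have := dF y => ?; rewrite /Phi; der; ring.
have mono y z : y <= z -> Phi y <= Phi z.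
  by move=> yz; apply: (@der_nondecreasing _ Phi rho y z _ _ yz) => x _ //; case/andP: (rho01 x).
have flat y z : y <= z -> (forall x, y <= x <= z -> 1 <= `|x|) -> Phi y = Phi z.
  move=> yz h; apply/eqP; rewrite eq_le mono//= -lerN2.
  have dN (x : R) : y <= x <= z -> is_derive x 1 (fun x => - Phi x) 0.
    by move=> xyz; have := dPhi x; rewrite (rho_supp x (h x xyz)) => d; der; ring.
  exact: (@der_nondecreasing _ (fun x => - Phi x) (fun=> 0) y z dN (fun _ _ => lexx 0) yz).
have left y : y <= -1 -> Phi y = 0.
  move=> y1; rewrite (flat y (-1) y1) ?/Phi ?subrr// => x /andP[_ x1].
  by rewrite -normrN; apply: le_trans (ler_norm _); rewrite lerNr.
have right y : 1 <= y -> Phi y = c.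
  by move=> y1; rewrite /c (flat 1 y y1)// => x /andP[x1 _]; exact: le_trans (ler_norm _).
have bounds y : 0 <= Phi y <= c.
  have [l|/ltW l] := leP y (-1); first by rewrite left// lexx /c -(left (-1))// mono//; lra.
  have [r|/ltW r] := leP 1 y; first by rewrite right// lexx andbT /c -(left (-1))// mono//; lra.
  by rewrite -(left (-1) (lexx _)) !mono.
exists rho, Phi, c; split => //.
- rewrite lt_neqAle; have /andP[c0 _] := bounds 1; rewrite c0 andbT eq_sym; apply/eqP => c00.
  have z y : Phi y = 0 by apply/eqP; rewrite eq_le; have := bounds y; rewrite c00 andbC.
  have := der_right_zero (dPhi 0) (fun y _ => z y); rewrite rhoE expr0n /= ltr01 => /eqP.
  by rewrite gt_eqF// expR_gt0.
- exists ([set g | exists p m, g = bump_term p m] `|` [set Phi]); last by right.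
  move=> g [[p [m ->]]|->].
    by have [g' Sg' dg] := @bump_smooth R _ (ex_intro _ p (ex_intro _ m erefl)); exists g' => //; left.
  by exists rho => //; left.
Qed.

Section step.
Variables (rho Phi : R -> R) (c : R).
Hypothesis hs : smooth_step rho Phi c.

Definition step a b n x : R := Phi (n.+1%:R * (x - a)) - Phi (n.+1%:R * (x - b)).

(** An approximate point mass at a, of total mass c and half-width 1 / (n + 1). *)
Definition dstep a n x : R := n.+1%:R * rho (n.+1%:R * (x - a)).

Lemma der_step a b n x : is_derive x 1 (step a b n) (dstep a n x - dstep b n x).
Proof.
have d z : is_derive x 1 (fun x => Phi (n.+1%:R * (x - z))) (dstep z n x).
  have dz : is_derive x 1 (fun x => n.+1%:R * (x - z)) n.+1%:R by der; ring.
  by apply: (derE (der_comp dz (step_der hs _))); rewrite mulrC.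
by have := d a => ?; have := d b => ?; rewrite /step; der.
Qed.

Lemma dstep_support a n x : n.+1%:R^-1 <= `|x - a| -> dstep a n x = 0.
Proof.
move=> h; rewrite /dstep (step_support hs) ?mulr0// normrM ger0_norm//.
by rewrite -ler_pdivrMl ?ltr0n// mulr1.
Qed.

Lemma dstep_bounds a n x : 0 <= dstep a n x <= n.+1%:R.
Proof.
have /andP[h1 h2] := step_density hs (n.+1%:R * (x - a)); rewrite mulr_ge0//=.
by rewrite ler_piMr.
Qed.

Lemma continuous_dstep a n : continuous (dstep a n).
Proof.
rewrite /dstep; apply: contM; first exact: contC.
apply: (cont_comp (f := rho)); first exact: (step_continuous hs).
by apply: contM; [exact: contC|apply: contB; [exact: contI|exact: contC]].
Qed.

Lemma step_outside a b n x : a < b -> (x <= a - 1) || (b + 1 <= x) -> step a b n x = 0.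
Proof.
move=> ab; have n1 : 1 <= n.+1%:R :> R by rewrite ler1n.
rewrite /step => /orP[h|h].
  by rewrite !(step_left hs) ?subrr//; nra.
by rewrite !(step_right hs) ?subrr//; nra.
Qed.

Lemma step_le a b n x : `|step a b n x| <= c.
Proof.
rewrite /step ler_norml; have := step_bounds hs (n.+1%:R * (x - a)).
by have := step_bounds hs (n.+1%:R * (x - b)); lra.
Qed.

Lemma test_function_step a b n : a < b -> test_function (step a b n).
Proof.
move=> ab; split.
  have [S hS SPhi] := step_smooth hs.
  (* The prefactor A collects the powers of n + 1 from the chain rule, so that the set is closed
     under differentiation. *)
  pose S' := [set g | exists (k l A : R) g1 g2, [/\ S g1, S g2 & g = fun x => A * (g1 (n.+1%:R * (x - k)) - g2 (n.+1%:R * (x - l)))]].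
  move=> m x; apply: (@smooth_class_derivable R S'); last first.
    exists a, b, 1, Phi, Phi; split => //; by apply/funext => y; rewrite mul1r.
  move=> _ [k [l [A [g1 [g2 [S1 S2 ->]]]]]].
  have [g1' S1' d1] := hS _ S1; have [g2' S2' d2] := hS _ S2.
  exists (fun x => (A * n.+1%:R) * (g1' (n.+1%:R * (x - k)) - g2' (n.+1%:R * (x - l)))).
    by exists k, l, (A * n.+1%:R), g1', g2'.
  move=> y.
  have d (g g' : R -> R) z : (forall x, is_derive x 1 g (g' x)) ->
      is_derive y 1 (fun x => g (n.+1%:R * (x - z))) (n.+1%:R * g' (n.+1%:R * (y - z))).
    move=> dg; have dz : is_derive y 1 (fun x => n.+1%:R * (x - z)) n.+1%:R by der; ring.
    by apply: (derE (der_comp dz (dg _))); rewrite mulrC.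
  by have := d _ _ k d1 => ?; have := d _ _ l d2 => ?; der; ring.
apply: (@subclosed_compact _ _ `[a - 1, b + 1]); [exact: closed_closure|exact: segment_compact|].
rewrite [X in _ `<=` X](closure_id _).1; last exact: itv_closed.
apply: closure_subset => x /= hx; rewrite in_itv /=; apply/andP; split; rewrite leNgt; apply/negP => h.
  by case/negP: hx; rewrite step_outside// ltW.
by case/negP: hx; rewrite step_outside// (ltW h) orbT.
Qed.

(** Away from the endpoints the sequence is eventually constant. At an endpoint the limit would be
    different, which only matters on a null set. *)
Lemma step_cvg a b x : a < b -> x != a -> x != b ->
  \forall n \near \oo, step a b n x = if a <= x <= b then c else 0.
Proof.
move=> ab xa xb.
have heaviside z : x != z -> \forall n \near \oo, Phi (n.+1%:R * (x - z)) = if z <= x then c else 0.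
  move=> xz; have yp : 0 < `|x - z| by rewrite normr_gt0 subr_eq0.
  exists (Num.truncn (`|x - z|^-1)) => // n /= hn.
  have big : 1 <= n.+1%:R * `|x - z|.
    rewrite -ler_pdivrMr// div1r.
    by apply: ltW; apply: lt_le_trans (truncnS_gt _) _; rewrite ler_nat ltnS.
  case: ifP => zx; first by rewrite (step_right hs)// -(@ger0_norm _ (x - z)) ?subr_ge0.
  rewrite (step_left hs)// lerNr -mulrN -(@ltr0_norm _ (x - z)) ?subr_lt0//.
  by rewrite ltNge zx.
near=> n; rewrite /step.
have -> : Phi (n.+1%:R * (x - a)) = if a <= x then c else 0 by near: n; exact: heaviside.
have -> : Phi (n.+1%:R * (x - b)) = if b <= x then c else 0 by near: n; exact: heaviside.
case: (leP a x) => ax; case: (leP x b) => bx /=.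
- by rewrite ifF ?subr0//; apply/negbTE; rewrite -ltNge lt_neqAle xb bx.
- by rewrite ltW// subrr.
- by rewrite ifF ?subrr//; apply/negbTE; rewrite -ltNge (lt_trans ax).
- by move: (lt_trans ax (lt_trans ab bx)); rewrite ltxx.
Unshelve. all: by end_near. Qed.

End step.
End smooth_step.

(** * Weak derivatives and increments at Lebesgue points *)

Section weak_increment.
Context {R : realType}.
Local Notation mu := (@lebesgue_measure R).
Implicit Types (f g u w : R -> R) (x y a b : R) (n : nat).

Lemma Lfun_measurable f : f \in Lfun mu 2%:E -> measurable_fun setT f.
Proof. by rewrite inE => /andP[/[!inE]]. Qed.

(** On a bounded interval |f| <= 1 + f^2. *)
Lemma integrable_L2 f a b : f \in Lfun mu 2%:E -> mu.-integrable `[a, b] (EFin \o f).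
Proof.
move=> fL; have mf := Lfun_measurable fL.
have i1 : mu.-integrable `[a, b] (EFin \o (fun=> 1 : R)) by apply: integrable_itv; exact: contC.
have i2 : mu.-integrable `[a, b] (EFin \o (fun x => f x ^+ 2)).
  by apply: integrableS (Lfun2_integrable_sqr fL).
apply: (le_integrable _ _ _ (integrableD _ i1 i2)) => //.
  by apply/measurable_EFinP; exact: measurable_funS mf.
move=> x _ /=; rewrite lee_fin [leRHS]ger0_norm; last by have := sqr_ge0 (f x); lra.
rewrite ler_norml; have := sqr_ge0 (f x - 1); have := sqr_ge0 (f x + 1); have := sqr_ge0 (f x).
by move=> ? ? ?; apply/andP; split; lra.
Qed.

Lemma locally_integrable_L2 f : f \in Lfun mu 2%:E -> locally_integrable setT f.
Proof.
move=> fL; split; [exact: Lfun_measurable|exact: openT|].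
move=> K _ cK; have [M [_ /(_ (`|M| + 1))]] := compact_bounded cK.
rewrite (le_lt_trans (ler_norm M)) ?ltrDl// => /(_ isT) hM.
have /integrableP[mf foo] := integrable_L2 (- (`|M| + 1)) (`|M| + 1) fL.
apply: le_lt_trans foo; apply: ge0_subset_integral => //.
- exact: compact_measurable.
- apply/measurable_EFinP; apply: measurableT_comp => //; exact/measurable_EFinP.
- move=> x /hM /=; by rewrite in_itv /= ler_norml.
Qed.

Lemma integrable_mul_bounded f g a b (K : R) : mu.-integrable `[a, b] (EFin \o f) ->
  measurable_fun setT g -> (forall x, `|g x| <= K) -> mu.-integrable `[a, b] (EFin \o (fun x => f x * g x)).
Proof.
move=> fi mg gK; have /integrableP[/measurable_EFinP mf _] := fi.
apply: (le_integrable _ _ _ (integrableZl _ K fi)) => //.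
  by apply/measurable_EFinP; apply: measurable_funM => //; exact: measurable_funS mg.
move=> x _ /=; rewrite lee_fin !normrM mulrC; apply: ler_wpM2r => //.
exact: le_trans (gK x) (ler_norm K).
Qed.

Lemma integrable_subr f a b (z : R) : mu.-integrable `[a, b] (EFin \o f) ->
  mu.-integrable `[a, b] (EFin \o (fun x => f x - z)).
Proof.
move=> fi; have ci := integrable_itv a b (@contC _ z).
rewrite (_ : EFin \o _ = (EFin \o f) \- (EFin \o (fun=> z)))%E; first exact: integrableB.
by apply/funext => x; rewrite /= EFinB.
Qed.

Variables (rho Phi : R -> R) (c : R).
Hypothesis hs : smooth_step rho Phi c.
Local Notation dstep := (dstep rho).
Local Notation step := (step Phi).

Lemma measurable_dstep a n : measurable_fun setT (dstep a n).
Proof. apply: continuous_measurable_fun; exact: (continuous_dstep hs). Qed.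

Lemma dstep_norm a n x : `|dstep a n x| <= n.+1%:R.
Proof. by have /andP[h1 h2] := dstep_bounds hs a n x; rewrite ger0_norm. Qed.

Lemma integral_dstep a n (A B : R) : A <= a - 1 -> a + 1 <= B ->
  \int[mu]_(x in `[A, B]) dstep a n x = c.
Proof.
move=> Aa aB; have n1 : 1 <= n.+1%:R :> R by rewrite ler1n.
have d (x : R) : is_derive x 1 (fun x => Phi (n.+1%:R * (x - a))) (dstep a n x).
  have dz : is_derive x 1 (fun x => n.+1%:R * (x - a)) n.+1%:R by der; ring.
  by apply: (derE (der_comp dz (step_der hs _))); rewrite mulrC.
rewrite (Rintegral_der d (@continuous_dstep _ _ _ _ hs a n)); last lra.
by rewrite (step_right hs) ?(step_left hs) ?subr0//; nra.
Qed.

Lemma lebesgue_pt_average u a : u \in Lfun mu 2%:E -> lebesgue_pt u a ->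
  forall e : R, 0 < e -> exists d : R, 0 < d /\ forall r : R, 0 < r -> r < d ->
    r^-1 * \int[mu]_(y in `]a - r, a + r[) `|u y - u a| <= e.
Proof.
move=> uL /fine_cvgP[_ /cvgr0_norm_le h] e e0.
have e2 : 0 < e / 2 by lra.
have [d /= d0 hd] := h _ e2; exists d; split => // r r0 rd.
have iu : mu.-integrable `]a - r, a + r[ (EFin \o (fun y => `|u y - u a|)).
  have ic : mu.-integrable `[a - r, a + r] (EFin \o (fun y => u y - u a)).
    exact/integrable_subr/integrable_L2.
  apply: (integrableS _ _ _ (integrable_norm ic)) => //.
  by move=> x /=; rewrite !in_itv /= => /andP[/ltW-> /ltW->].
have E : davg u a r = ((r *+ 2)^-1 * \int[mu]_(y in `]a - r, a + r[) `|u y - u a|)%:E.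
  rewrite /davg /iavg (lebesgue_measure_ball _ (ltW r0)) ball_itv EFinM inver mulrn_eq0 /= gt_eqF//.
  congr (_ * _)%E; rewrite /Rintegral fineK//; exact: integrable_fin_num.
have := hd r; rewrite /= sub0r normrN (gtr0_norm r0) E /= => /(_ rd r0).
set I := \int[mu]_(y in _) _; have I0 : 0 <= I by apply: Rintegral_ge0.
rewrite ger0_norm; last by apply: mulr_ge0 => //; rewrite invr_ge0 mulrn_wge0// ltW.
rewrite -mulr_natr invfM; lra.
Qed.

(** The kernel has mass c, is bounded by n + 1 and lives within distance 1 / (n + 1) of a. The error
    is therefore at most an average of |u - u(a)| of the kind estimated at Lebesgue points. *)
Lemma dstep_average u a (A B : R) : u \in Lfun mu 2%:E -> lebesgue_pt u a -> A <= a - 1 -> a + 1 <= B ->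
  (fun n => \int[mu]_(x in `[A, B]) (u x * dstep a n x)) @ \oo --> c * u a.
Proof.
move=> uL la Aa aB; apply/cvgrPdist_le => e e0.
have [d [d0 hd]] := lebesgue_pt_average uL la e0.
have iu := integrable_L2 A B uL.
have ic := integrable_itv A B (@contC _ (u a)).
have iuc : mu.-integrable `[A, B] (EFin \o (fun y => u y - u a)) by exact: integrable_subr.
near=> n.
have rd : n.+1%:R^-1 < d.
  near: n; exists (Num.truncn d^-1) => // m /= hm.
  rewrite invf_plt ?posrE//; apply: lt_le_trans (truncnS_gt _) _; by rewrite ler_nat ltnS.
pose r : R := n.+1%:R^-1; rewrite -/r in rd.
have r0 : 0 < r by rewrite invr_gt0.
have r1 : r <= 1 by rewrite invf_le1// ler1n.
have md := measurable_dstep a n; have bd := @dstep_norm a n.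
have i1 := integrable_mul_bounded ic md bd; have i2 := integrable_mul_bounded iuc md bd.
have -> : \int[mu]_(x in `[A, B]) (u x * dstep a n x) =
    \int[mu]_(x in `[A, B]) (u a * dstep a n x) + \int[mu]_(x in `[A, B]) ((u x - u a) * dstep a n x).
  rewrite -RintegralD//; apply: eq_Rintegral => x _; ring.
have idd : mu.-integrable `[A, B] (EFin \o dstep a n).
  by apply: integrable_itv; exact: (continuous_dstep hs).
rewrite RintegralZl// integral_dstep// [u a * c]mulrC opprD addrA subrr sub0r normrN.
apply: le_trans (le_normr_Rintegral _ i2) _ => //.
have -> : \int[mu]_(x in `[A, B]) `|(u x - u a) * dstep a n x| =
    \int[mu]_(x in `]a - r, a + r[) `|(u x - u a) * dstep a n x|.
  rewrite [LHS]Rintegral_mkcond [RHS]Rintegral_mkcond; congr Rintegral; apply/funext => x.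
  rewrite !patchE !mem_setE !in_itv /=; case: ifP => h1; case: ifP => h2 //.
    rewrite (dstep_support hs) ?mulr0 ?normr0//.
    by rewrite leNgt ltr_distl; apply/negP; rewrite h2.
  by move: h1 => /negbT/negP[]; case/andP: h2 => h2 h3; apply/andP; split; lra.
have sub : `]a - r, a + r[ `<=` `[A, B].
  by move=> x /=; rewrite !in_itv /= => /andP[h2 h3]; apply/andP; split; lra.
have iS g : mu.-integrable `[A, B] (EFin \o g) -> mu.-integrable `]a - r, a + r[ (EFin \o g).
  by apply: integrableS.
have in1 := iS _ (integrable_norm i2); have in2 := iS _ (integrable_norm iuc).
have in3 : mu.-integrable `]a - r, a + r[ (EFin \o (fun x => r^-1 * `|u x - u a|)).
  exact: (integrableZl _ r^-1 in2).
apply: le_trans (hd r r0 rd); rewrite -RintegralZl//.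
apply: le_Rintegral => // x _; rewrite normrM mulrC; apply: ler_wpM2r => //.
by rewrite /r invrK.
Unshelve. all: by end_near. Qed.

End weak_increment.

Section weak_primitive.
Context {R : realType}.
Local Notation mu := (@lebesgue_measure R).
Implicit Types (f g u w : R -> R) (x y a b : R) (n : nat).

Lemma Rintegral_itvD f a b (z : R) : a <= b -> b <= z -> mu.-integrable `[a, z] (EFin \o f) ->
  \int[mu]_(x in `[a, z]) f x = \int[mu]_(x in `[a, b]) f x + \int[mu]_(x in `[b, z]) f x.
Proof.
move=> ab bz fi; have h := Rintegral_itvB fi (_ : (BLeft a <= BRight b)%O) (_ : (BRight b <= BRight z)%O).
rewrite -(@Rintegral_itv_obnd_cbnd _ b) -?h ?bnd_simp//; first by rewrite addrC subrK.
by apply: (integrableS _ _ _ fi) => // x /=; rewrite !in_itv /= => /andP[/ltW/(le_trans ab)-> ->].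
Qed.

Lemma ae_point (Q : R -> Prop) : {ae mu, forall x, Q x} -> exists x, Q x.
Proof.
move=> h; apply: contrapT => nQ.
have : mu.-negligible (ball (0 : R) 1).
  by apply: negligibleS h => y _ /= Qy; apply: nQ; exists y.
move=> /measure_negligible => /(_ (measurable_ball _ _)) z.
have := lebesgue_measure_ball (0 : R) (@ler01 R); rewrite [LHS]z => /esym/eqP.
by rewrite eqe mulrn_eq0 /= oner_eq0.
Qed.

Section with_step.
Variables (rho Phi : R -> R) (c : R).
Hypothesis hs : smooth_step rho Phi c.
Local Notation dstep := (dstep rho).
Local Notation step := (step Phi).

(** Dominated convergence with bound c |w|, the two endpoints being a null set. *)
Lemma step_integral_cvg w a b : w \in Lfun mu 2%:E -> a < b ->
  (fun n => \int[mu]_(x in `[a - 1, b + 1]) (w x * step a b n x)) @ \oo --> c * \int[mu]_(x in `[a, b]) w x.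
Proof.
move=> wL ab.
pose F x := w x * (if a <= x <= b then c else 0).
have wi := integrable_L2 (a - 1) (b + 1) wL.
have cs n : continuous (step a b n) by move=> x; exact: der_continuous (der_step hs a b n x).
have mw : measurable_fun `[a - 1, b + 1] w by case/integrableP : wi => /measurable_EFinP.
have mind : measurable_fun setT (fun x => if a <= x <= b then c else 0).
  rewrite (_ : (fun x => _) = (fun=> c) \_ `[a, b]); last first.
    by apply/funext => x; rewrite patchE mem_setE in_itv.
  by apply: (measurable_restrictT _ _).1 => //; exact: measurable_itv.
have ig : mu.-integrable `[a - 1, b + 1] (EFin \o (fun x => c * `|w x|)).
  exact: (integrableZl _ c (integrable_norm wi)).
have c0 := step_height hs.
have [] := @dominated_convergence _ _ R mu `[a - 1, b + 1]%classic (measurable_itv _) (fun n x => (w x * step a b n x)%:E)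
  (EFin \o F) (EFin \o (fun x => c * `|w x|)).
- move=> n; apply/measurable_EFinP; apply: measurable_funM => //.
  by apply: measurable_funS (continuous_measurable_fun (cs n)).
- apply/measurable_EFinP; apply: measurable_funM => //; exact: measurable_funS mind.
- have : mu.-negligible ([set a] `|` [set b]).
    by apply: negligibleU; apply/negligibleP => //; exact: lebesgue_measure_set1.
  apply: negligibleS => x /= nc; apply: contrapT => /not_orP[/eqP xa /eqP xb]; apply: nc => _.
  apply: cvg_near_cst; near=> n; congr (_ * _)%:E; near: n; exact: (step_cvg hs ab xa xb).
- exact: ig.
- apply: aeW => x n _; rewrite /= lee_fin normrM mulrC; apply: ler_wpM2r => //; exact: (step_le hs).
move=> /= iF _ h.
have eF : (\int[mu]_(x in `[(a - 1)%R, (b + 1)%R]) (EFin \o F) x)%E = (c * \int[mu]_(x in `[a, b]) w x)%:E.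
  have -> : c * \int[mu]_(x in `[a, b]) w x = \int[mu]_(x in `[a - 1, b + 1]) F x.
    rewrite -RintegralZl; [|exact: measurable_itv|exact: integrable_L2].
    rewrite [LHS]Rintegral_mkcond [RHS]Rintegral_mkcond; congr Rintegral; apply/funext => x.
    rewrite !patchE !mem_setE !in_itv /= /F; case: ifP => h1; last by case: ifP => //; rewrite mulr0.
    by rewrite ifT 1?mulrC//; case/andP: h1 => h1 h2; apply/andP; split; lra.
  by rewrite /Rintegral fineK//; exact: (integrable_fin_num _ iF).
by rewrite eF in h; exact: (fine_cvg h).
Unshelve. all: by end_near. Qed.

Definition weak_der u w := forall psi, test_function psi ->
  \int[mu]_x (u x * psi^`()%classic x) = - \int[mu]_x (w x * psi x).

Lemma weak_der_increment u w a b : u \in Lfun mu 2%:E -> w \in Lfun mu 2%:E -> weak_der u w ->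
  lebesgue_pt u a -> lebesgue_pt u b -> a < b -> u b - u a = \int[mu]_(x in `[a, b]) w x.
Proof.
move=> uL wL uw la lb ab; have c0 := step_height hs.
have Aa : a - 1 <= a - 1 by []. have aB : a + 1 <= b + 1 by lra.
have Ab : a - 1 <= b - 1 by lra. have bB : b + 1 <= b + 1 by [].
have h1 := dstep_average hs uL la Aa aB; have h2 := dstep_average hs uL lb Ab bB.
have h3 := step_integral_cvg wL ab.
have ui := integrable_L2 (a - 1) (b + 1) uL.
have E : (fun n => \int[mu]_(x in `[a - 1, b + 1]) (u x * dstep a n x) - \int[mu]_(x in `[a - 1, b + 1]) (u x * dstep b n x)) =
    fun n => - \int[mu]_(x in `[a - 1, b + 1]) (w x * step a b n x).
  apply/funext => n; rewrite -RintegralB//; [|exact: (integrable_mul_bounded ui (measurable_dstep hs _ n) (dstep_norm hs _ n))..].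
  have out x : (x < a - 1) || (b + 1 < x) -> step a b n x = 0.
    by move=> hx; apply: (step_outside hs) => //; case/orP: hx => /ltW ->; rewrite ?orbT.
  have dout z x : a <= z <= b -> (x < a - 1) || (b + 1 < x) -> dstep z n x = 0.
    move=> /andP[az zb] hx; apply: (dstep_support hs); apply: (@le_trans _ _ 1); first by rewrite invf_le1// ler1n.
    by rewrite ler_normr; case/orP: hx => hx; apply/orP; [right|left]; lra.
  rewrite !Rintegral_outside; first last.
  - by move=> x hx; rewrite !dout ?lexx ?(ltW ab)//; ring.
  - by move=> x /out ->; rewrite mulr0.
  rewrite -(uw _ (test_function_step hs n ab)); apply: eq_Rintegral => x _.
  by rewrite derive1E; have [_ ->] := der_step hs a b n x; ring.
have h4 := cvgB h1 h2; have h5 := cvgN h3.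
rewrite (_ : _ - _ = - (fun n => \int[mu]_(x in `[a - 1, b + 1]) (w x * step a b n x))) in h4; last exact: E.
have e := @cvg_unique _ (@Rhausdorff R) _ _ _ _ (h4 _) (h5 _).
by apply: (mulfI (lt0r_neq0 c0)); apply: oppr_inj; rewrite -[RHS]e; ring.
Qed.

End with_step.

(** One Lebesgue point p fixes the additive constant. At every other Lebesgue point the increment
    formula identifies u with the primitive, and these points have full measure. *)
Lemma weak_primitive u w : u \in Lfun mu 2%:E -> w \in Lfun mu 2%:E -> weak_der u w ->
  exists U, {ae mu, forall x, u x = U x} /\ forall a b, a <= b -> U b - U a = \int[mu]_(x in `[a, b]) w x.
Proof.
move=> uL wL uw; have [rho [Phi [c hs]]] := @smooth_step_exists R.
have la := lebesgue_differentiation (locally_integrable_L2 uL).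
have [p lp] := ae_point la.
pose P x := if 0 <= x then \int[mu]_(y in `[0, x]) w y else - \int[mu]_(y in `[x, 0]) w y.
have wi a b := integrable_L2 a b wL.
have PP a b : a <= b -> P b - P a = \int[mu]_(x in `[a, b]) w x.
  move=> ab; rewrite /P; case: (leP 0 a) => a0; case: (leP 0 b) => b0.
  - by rewrite (Rintegral_itvD a0 ab)//; ring.
  - by have := lt_le_trans b0 (le_trans a0 ab); rewrite ltxx.
  - by rewrite (Rintegral_itvD (ltW a0) b0)//; ring.
  - by rewrite (Rintegral_itvD ab (ltW b0))//; ring.
exists (fun x => P x + (u p - P p)); split; last by move=> a b /PP <-; ring.
apply: negligibleS la => x /= nx lx; apply: nx.
have [xp|px|->] := ltgtP x p; last by ring.
- by have := weak_der_increment hs uL wL uw lx lp xp; rewrite -(PP _ _ (ltW xp)); lra.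
- by have := weak_der_increment hs uL wL uw lp lx px; rewrite -(PP _ _ (ltW px)); lra.
Qed.

End weak_primitive.

Section regularity.
Context {R : realType}.
Local Notation mu := (@lebesgue_measure R).
Implicit Types (f g u w U W : R -> R) (x y a b : R).

Definition primitive_of w U := forall a b, a <= b -> U b - U a = \int[mu]_(x in `[a, b]) w x.

Lemma primitive_continuous w U : w \in Lfun mu 2%:E -> primitive_of w U -> continuous U.
Proof.
move=> wL hU x; have ab : x - 1 < x + 1 by lra.
have c := parameterized_integral_continuous (ltW ab) (integrable_L2 (x - 1) (x + 1) wL).
have xi : x \in `]x - 1, x + 1[ by rewrite in_itv /=; apply/andP; split; lra.
have cx := within_continuous_continuous ab c xi.
pose P y := parameterized_integral mu (x - 1) y w.
have cP : {for x, continuous (fun y => U (x - 1) + P y)}.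
  by apply: cvgD; [exact: cvg_cst|exact: cx].
have E y : x - 1 <= y -> U y = U (x - 1) + P y by move=> xy; rewrite /P /parameterized_integral -(hU _ _ xy); ring.
apply: (@cvg_trans _ ((fun y => U (x - 1) + P y) @ x)); last by rewrite (E x)//; lra.
apply: near_eq_cvg; near=> y; rewrite -E//; apply: ltW; near: y.
by apply: lt_nbhsr; lra.
Unshelve. all: by end_near. Qed.

(** Integrals do not see the change from w to its continuous representative W, so U differs from a
    primitive of W by a constant. *)
Lemma primitive_der w U W : w \in Lfun mu 2%:E -> primitive_of w U -> continuous W ->
  {ae mu, forall x, w x = W x} -> forall x, is_derive x 1 U (W x).
Proof.
move=> wL hU cW wW; have [F [_ dF]] := primitive_exists cW.
have UF a b : a < b -> U b - U a = F b - F a.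
  move=> ab; rewrite (hU _ _ (ltW ab)) -(Rintegral_der dF cW ab); congr fine.
  apply: ae_eq_integral => //.
  - by case/integrableP : (integrable_L2 a b wL).
  - by case/integrableP : (integrable_itv a b cW).
  - by apply: negligibleS wW => x /= nx e; apply: nx => _; rewrite e.
have -> : U = fun x => F x + (U 0 - F 0).
  apply/funext => x; have [x0|x0|->] := ltgtP x 0; last by ring.
    by have := UF _ _ x0; lra.
  by have := UF _ _ x0; lra.
by move=> x; have := dF x => ?; der; ring.
Qed.

(** A primitive of U^2 has increments bounded by the integral of u^2. The reflected function is
    treated as well, since parity components combine both half-lines. *)
Lemma tame_L2 u U : u \in Lfun mu 2%:E -> continuous U -> {ae mu, forall x, u x = U x} ->
  tame U /\ tame (fun x => U (- x)).
Proof.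
move=> uL cU uU; have cU2 : continuous (fun x => U x ^+ 2) by exact: contX.
have [E [_ dE]] := primitive_exists cU2.
pose M := \int[mu]_x u x ^+ 2.
have u2 := Lfun2_integrable_sqr uL.
have EM a b : a <= b -> E b - E a <= M.
  rewrite le_eqVlt => /predU1P[->|ab].
    by rewrite subrr; apply: Rintegral_ge0 => x _; exact: sqr_ge0.
  rewrite -(Rintegral_der dE cU2 ab).
  have u2ab : mu.-integrable `[a, b] (EFin \o (fun x => u x ^+ 2)).
    by apply: integrableS u2.
  have -> : \int[mu]_(x in `[a, b]) (U x ^+ 2) = \int[mu]_(x in `[a, b]) (u x ^+ 2).
    congr fine; apply: ae_eq_integral => //.
    - by case/integrableP : (integrable_itv a b cU2).
    - by case/integrableP : u2ab.
    - by apply: negligibleS uU => x /= nx e; apply: nx => _; rewrite e.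
  apply: fine_le; [exact: integrable_fin_num|exact: integrable_fin_num|].
  apply: ge0_subset_integral => //; first by case/integrableP : u2.
  by move=> x _; rewrite lee_fin sqr_ge0.
split.
  exists (fun x => U x ^+ 2), E, (E 0 + M) => x x0; split; [exact: lexx|exact: dE|].
  by have := EM _ _ x0; lra.
exists (fun x => U (- x) ^+ 2), (fun x => - E (- x)), (M - E 0) => x x0; split; [exact: lexx| |].
  by apply: (derE (derN (der_comp (derN (derI x)) (dE _)))); ring.
by have x0' : - x <= 0 by [lra|rewrite oppr_le0]; have := EM _ _ x0'; lra.
Qed.

End regularity.

(** * From weak eigenfunctions to even classical ones *)

Section spectrum_bound.
Context {R : realType} (s t : sign) (w w1 : 'I_3 -> R -> R).
Hypothesis hw : wave_data s t w w1.
Local Notation mu := (@lebesgue_measure R).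
Local Notation v := (profile s t w).
Implicit Types (i j : 'I_3) (x lam : R).

Lemma ae_forall3 (Q : 'I_3 -> R -> Prop) : (forall i, {ae mu, forall x, Q i x}) -> {ae mu, forall x, forall i, Q i x}.
Proof.
move=> h; apply: (negligibleS _ (negligibleU (h 0) (negligibleU (h 1) (h 2)))) => x /= nx.
apply: contrapT => /not_orP[/contrapT h0 /not_orP[/contrapT h1 /contrapT h2]]; apply: nx.
by apply: forall3.
Qed.

(** Bootstrap: u and its weak derivative have continuous representatives U and V. The eigenvalue
    equation then makes the second weak derivative almost everywhere equal to a continuous function
    of U, so V is differentiable. *)
Lemma spectrum_classical lam :
  point_spectrum b0 (signr s * (4 / 100)) (signr t * (2 / 100)) (wave s t w) lam ->
  exists U V : 'I_3 -> R -> R, [/\ line_sol s t w lam U V,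
    forall i, tame (U i) /\ tame (fun x => U i (- x)),
    forall i, tame (V i) /\ tame (fun x => V i (- x)) & exists i x, U i x != 0].
Proof.
move=> [u [uxx [[uL [ux [uxL uxxL du dux]]] nz eq]]].
have /choice[U /all_and2[uU pU]] : forall i, exists U, {ae mu, forall x, u x i 0 = U x} /\ primitive_of (fun x => ux x i 0) U.
  by move=> i; apply: weak_primitive => // psi tp; exact: du.
have /choice[V /all_and2[uV pV]] : forall i, exists V, {ae mu, forall x, ux x i 0 = V x} /\ primitive_of (fun x => uxx x i 0) V.
  by move=> i; apply: weak_primitive => // psi tp; exact: dux.
have cU i : continuous (U i) by exact: primitive_continuous (pU i).
have cV i : continuous (V i) by exact: primitive_continuous (pV i).
have cW i := @continuous_lin_rhs _ _ _ _ _ hw lam U i cU.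
have dU i x : is_derive x 1 (U i) (V i x) by exact: (primitive_der _ (pU i) (cV i) (uV i)).
have eW i : {ae mu, forall x, uxx x i 0 = lin_rhs s t w lam U i x}.
  apply: (negligibleS _ (negligibleU eq (ae_forall3 uU))) => x /= nx.
  apply: contrapT => /not_orP[/contrapT e /contrapT h]; apply: nx.
  have := congr1 (fun M : 'cV[R]_3 => M i 0) e; rewrite !mxE /lin_rhs -h => <-.
  apply/eqP; rewrite eq_sym subr_eq; apply/eqP; congr (_ + _).
  by apply: eq_bigr => j _; rewrite hessian_wave h.
have dV i x : is_derive x 1 (V i) (lin_rhs s t w lam U i x) by exact: (primitive_der _ (pV i) (cW i) (eW i)).
exists U, V; split.
- by move=> i x; split.
- by move=> i; exact: (tame_L2 (uL i) (cU i) (uU i)).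
- by move=> i; exact: (tame_L2 (uxL i) (cV i) (uV i)).
- apply: contrapT => hn; apply: nz; apply: negligibleS (ae_forall3 uU) => x /= nx h; apply: nx.
  apply/colP => i; rewrite mxE h; apply: contrapT => /eqP Ux; apply: hn; by exists i, x.
Qed.

(** A function vanishing at 0 in all components satisfies the pinned condition. Its energy at lam >
    0 dominates lam |o|^2 while its boundary term at 0 vanishes. *)
Lemma odd_mode_zero lam o o1 : 0 < lam -> lin_sol s t w lam o o1 ->
  (forall i, tame (o i)) -> (forall i, tame (o1 i)) -> (forall i, o i 0 = 0) ->
  forall i x, 0 < x -> o i x = 0.
Proof.
move=> l0 so to to1 o0.
have dO i x : 0 <= x -> is_derive x 1 (o i) (o1 i x) by move=> x0; have [] := so i x x0.
have [Bd [Bd1 [C [dB hB B0 Bb]]]] := nonneg_form_pinned hw dO (fun i _ => o0 i).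
have fB : fading Bd by exact: fading_bound to Bb.
pose Q x := \sum_(i < 3) o1 i x * o i x - Bd x.
pose Q1 x := form s t w lam o o1 x - Bd1 x.
have dQ x : 0 <= x -> is_derive x 1 Q (Q1 x).
  move=> x0; have h := der_energy (fun i => dO i x x0) so x0.
  by have := dB x x0 => ?; rewrite /Q; der; rewrite /Q1 /form.
have S0 x : 0 <= \sum_(i < 3) o i x ^+ 2 by apply: sumr_ge0 => i _; exact: sqr_ge0.
have Q1ge x : 0 <= x -> lam * \sum_(i < 3) o i x ^+ 2 <= Q1 x.
  by move=> x0; rewrite /Q1 (form_shift _ _ _ lam 0) subr0; have := hB x x0; lra.
have mono a b : 0 <= a -> a <= b -> Q a <= Q b.
  move=> a0 ab; apply: (@der_nondecreasing _ Q Q1 a b _ _ ab) => x /andP[ax _].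
    exact: dQ (le_trans a0 ax).
  apply: le_trans (Q1ge x (le_trans a0 ax)); apply: mulr_ge0 => //; exact: ltW.
have fQ : fading Q.
  apply: fadingD; last exact: fadingN.
  apply: (@fading_sum _ _ (fun i x => o1 i x * o i x)) => i; exact: fadingM.
have Q00 : Q 0 = 0 by rewrite /Q B0 subr0 big1// => i _; rewrite o0 mulr0.
have Qz x : 0 <= x -> Q x = 0.
  move=> x0; apply/eqP; rewrite eq_le -{2}Q00 mono// andbT leNgt; apply/negP => Qx.
  have Qx2 : 0 < Q x / 2 by lra.
  have [N [N0 xN]] := fading_small fQ x Qx2; have := mono _ _ x0 xN.
  by rewrite ler_norml => h /andP[_ h2]; lra.
move=> i x x0; have z : Q1 x = 0.
  by apply: (der_right_zero (dQ x (ltW x0))) => y xy; apply: Qz; exact: le_trans (ltW x0) xy.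
have := Q1ge x (ltW x0); rewrite z pmulr_rle0// => S1.
have : o i x ^+ 2 <= 0.
  by apply: le_trans S1; rewrite (bigD1 i)//= lerDl; apply: sumr_ge0 => j _; exact: sqr_ge0.
by move=> h; apply/eqP; rewrite -sqrf_eq0 eq_le h sqr_ge0.
Qed.

(** The Hessian is even in x, so both parity parts solve the equation, and the odd part vanishes.
    Were the even part zero for x > 0 too, the eigenfunction would vanish off 0, hence everywhere by
    continuity. *)
Lemma spectrum_even lam : 0 < lam ->
  point_spectrum b0 (signr s * (4 / 100)) (signr t * (2 / 100)) (wave s t w) lam ->
  exists e e1 : 'I_3 -> R -> R, [/\ lin_sol s t w lam e e1, forall i, tame (e i),
    forall i, tame (e1 i), forall i, e1 i 0 = 0 & exists i x, 0 < x /\ e i x != 0].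
Proof.
move=> l0 /spectrum_classical[U [V [sUV tU tV [i0 [x0 Ux0]]]]].
have dU i (x : R) : is_derive x 1 (U i) (V i x) by have [] := sUV i x.
have dV i (x : R) : is_derive x 1 (V i) (lin_rhs s t w lam U i x) by have [] := sUV i x.
have dUn i (x : R) : is_derive x 1 (fun x => U i (- x)) (- V i (- x)).
  by apply: (derE (der_comp (derN (derI x)) (dU i _))); ring.
have dVn i (x : R) : is_derive x 1 (fun x => V i (- x)) (- lin_rhs s t w lam U i (- x)).
  by apply: (derE (der_comp (derN (derI x)) (dV i _))); ring.
pose e i x := U i x + U i (- x); pose e1 i x := V i x + -1 * V i (- x).
pose o i x := U i x + -1 * U i (- x); pose o1 i x := V i x + V i (- x).
have se : lin_sol s t w lam e e1.
  move=> i x _; split.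
    by have := dU i x => ?; have := dUn i x => ?; rewrite /e; der; rewrite /e1; ring.
  have := dV i x => ?; have := dVn i x => ?; rewrite /e1; der; rewrite /lin_rhs !sum3 !(hs_even hw) /e; ring.
have so : lin_sol s t w lam o o1.
  move=> i x _; split.
    by have := dU i x => ?; have := dUn i x => ?; rewrite /o; der; rewrite /o1; ring.
  have := dV i x => ?; have := dVn i x => ?; rewrite /o1; der; rewrite /lin_rhs !sum3 !(hs_even hw) /o; ring.
have oz := odd_mode_zero l0 so (fun i => tameD (tU i).1 (tameZ (-1) (tU i).2)) (fun i => tameD (tV i).1 (tV i).2).
have {}oz := oz (fun i => _); exists e, e1; split => //.
- by move=> i; exact: tameD (tU i).1 (tU i).2.
- by move=> i; apply: tameD (tV i).1 (tameZ (-1) (tV i).2).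
- by move=> i; rewrite /e1 oppr0; ring.
apply: contrapT => hn.
have ez i x : 0 < x -> e i x = 0.
  by move=> xp; apply: contrapT => /eqP ex; apply: hn; exists i, x.
have {}oz i x : 0 < x -> o i x = 0 by apply: oz => j; rewrite /o oppr0; ring.
have Uz i x : 0 < `|x| -> U i x = 0.
  case: (leP 0 x) => [x_ge|x_lt].
    rewrite ger0_norm// => xp; have := ez i x xp; have := oz i x xp; rewrite /e /o; lra.
  rewrite ltr0_norm// => xp; have := ez i _ xp; have := oz i _ xp; rewrite /e /o opprK; lra.
have U0 : U i0 x0 = 0.
  have cU : continuous (U i0) by move=> x; exact: der_continuous (dU i0 x).
  apply: (ae_continuous_zero cU); have : mu.-negligible [set (0 : R)].
    by apply/negligibleP => //; exact: lebesgue_measure_set1.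
  apply: negligibleS => x /= nx; apply: contrapT => /eqP x_neq; apply: nx; apply: Uz.
  by rewrite normr_gt0.
by rewrite U0 eqxx in Ux0.
Qed.

End spectrum_bound.

(** * Conclusion *)

Section columns.
Context {R : realType}.

Lemma cvg_column (F : set_system R) (FF : Filter F) (f : R -> 'cV[R]_3) (l : 'cV[R]_3) :
  (forall i, (fun x => f x i 0) @ F --> l i 0) -> f @ F --> l.
Proof.
move=> h; apply/cvgrPdist_le => e e0; near=> x.
rewrite /Num.Def.normr/= mx_normrE (bigmax_le _ (ltW e0))//= => -[i j] _.
rewrite !mxE (ord1 j) /=; move: i; near: x; apply: filter_forall => i.
exact: (@cvgr_dist_le _ _ _ _ _ _ _ (h i) e e0).
Unshelve. all: by end_near. Qed.

Lemma der_column (f f1 : 'I_3 -> R -> R) (x : R) : (forall i, is_derive x 1 (f i) (f1 i x)) ->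
  is_derive x 1 (fun y => \col_i f i y) (\col_i f1 i x : 'cV[R]_3).
Proof.
move=> df; have d : derivable (fun y => \col_i f i y : 'cV[R]_3) x 1.
  apply/derivable_mxP => i j; rewrite (_ : (fun y => _) = f i); first by case: (df i).
  by apply/funext => y; rewrite mxE.
split => //; rewrite derive_mx//; apply/matrixP => i j; rewrite !mxE.
rewrite (_ : (fun y => _) = f i); first by case: (df i).
by apply/funext => y; rewrite mxE.
Qed.

End columns.

Section standing.
Context {R : realType} (s t : sign) (w w1 : 'I_3 -> R -> R).
Hypothesis hw : wave_data s t w w1.
Local Notation v := (profile s t w).
Local Notation phi := (wave s t w).
Implicit Types (i : 'I_3) (x : R).

Lemma standing_wave_profile :
  standing_wave b0 (signr s * (4 / 100)) (signr t * (2 / 100)) phi.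
Proof.
have d1 (x : R) : is_derive x 1 phi (\col_i (dprofile s t w1 i x / 2)).
  have h i : is_derive x 1 (fun x => (1 + v i x) / 2) (dprofile s t w1 i x / 2).
    by have := der_profile hw i x => ?; der; field.
  exact: (der_column (f1 := fun i x => dprofile s t w1 i x / 2) h).
have d2 (x : R) : is_derive x 1 (fun x => \col_i (dprofile s t w1 i x / 2)) (\col_i (ddprofile s t w i x / 2) : 'cV[R]_3).
  have h i : is_derive x 1 (fun x => dprofile s t w1 i x / 2) (ddprofile s t w i x / 2).
    by have := der_dprofile hw i x => ?; der; field.
  exact: (der_column (f1 := fun i x => ddprofile s t w i x / 2) h).
have e1 : phi^`()%classic = fun x => \col_i (dprofile s t w1 i x / 2).
  by apply/funext => x; rewrite derive1E; have [_ ->] := d1 x.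
move=> r x r0; rewrite e1; split; [by have [] := d1 x|by have [] := d2 x|].
rewrite derive1nS derive1n1 e1 derive1E; have [_ ->] := d2 x.
rewrite (_ : _ + reaction _ _ _ _ = 0).
  by apply: cvg_near_cst; near=> h; rewrite /= subrr scaler0.
apply/colP => i; rewrite !mxE /ddprofile /f /g sum3 /cpl /bb.
by move: i; apply: forall3 => /=; field.
Unshelve. all: by end_near. Qed.

Lemma profile_near_one i x : 0 <= x -> `|1 - v i x| <= 3 * om x.
Proof.
move=> x0; have h := one_sub_profile_le hw i x0; apply: le_trans h.
have /andP[h1 _] := profile_tau hw i x0; have t0 := tau_ge0 x0.
have -> : 1 - v i x ^+ 2 = (1 - v i x) * (1 + v i x) by ring.
by rewrite normrM ler_peMr// (ger0_norm (_ : 0 <= 1 + v i x)); lra.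
Qed.

Lemma profile_limit (e : R) i : 0 < e -> exists X, forall x, X <= x -> `|1 - v i x| <= e.
Proof.
move=> e0; have e3 : 0 < e / 3 by lra.
have [X hX] := vanishing_om e3; exists (Num.max X 0) => x; rewrite ge_max => /andP[Xx x0].
have := hX x Xx; rewrite (gtr0_norm (om_gt0 x0)) => oe.
by have := profile_near_one i x0; lra.
Qed.

Lemma wave_right : phi x @[x --> +oo] --> (const_mx 1 : 'cV[R]_3).
Proof.
apply: cvg_column => i; rewrite mxE; apply/cvgrPdist_le => e e0.
have [X hX] := profile_limit i e0; near=> x.
have Xx : X <= x by near: x; apply: nbhs_pinfty_ge; exact: num_real.
rewrite mxE (_ : 1 - _ = (1 - v i x) / 2); last by field.
by have := hX x Xx; rewrite normrM (@ger0_norm _ 2^-1); lra.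
Unshelve. all: by end_near. Qed.

Lemma wave_left : phi x @[x --> -oo] --> (0 : 'cV[R]_3).
Proof.
apply: cvg_column => i; rewrite mxE; apply/cvgrPdist_le => e e0.
have [X hX] := profile_limit i e0; near=> x.
have Xx : X <= - x by rewrite lerNr; near: x; apply: nbhs_ninfty_le; exact: num_real.
rewrite mxE (_ : 0 - _ = - ((1 - v i (- x)) / 2)); last by rewrite (profile_odd hw); field.
by have := hX _ Xx; rewrite normrN normrM (@ger0_norm _ 2^-1); lra.
Unshelve. all: by end_near. Qed.

End standing.

(** * Counting the positive eigenvalues *)

Section counting.
Context {R : realType} (s t : sign) (w w1 : 'I_3 -> R -> R).
Hypothesis hw : wave_data s t w w1.
Local Notation positive := (positive_point_spectrum b0 (signr s * (4 / 100)) (signr t * (2 / 100)) (wave s t w)).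

(** Distinct positive eigenvalues supply the modes for [eigen_bound]. With Z enumerating the pinned
    components, their number is strictly below that of the pinned components. *)
Lemma positive_eigenvalue_bound (m : nat) (Z : 'I_m -> 'I_3) (lam : 'I_m -> R) :
  (forall i, pinned s t i -> exists l, Z l = i) -> injective lam -> ~ (forall j, positive (lam j)).
Proof.
move=> hZ linj hl.
have /choice[e /choice[e1 he]] : forall j, exists e e1 : 'I_3 -> R -> R,
    [/\ lin_sol s t w (lam j) e e1, forall i, tame (e i), forall i, tame (e1 i),
    forall i, e1 i 0 = 0 & exists i x, 0 < x /\ e i x != 0].
  by move=> j; have [h1 h2] := hl j; exact: (spectrum_even hw h2 h1).
apply: (@eigen_bound R s t w w1 hw m Z e e1 lam hZ) => // j; try by have [] := he j.
by have [_ h2] := hl j.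
Qed.

Lemma mode_positive lam h h1 : 0 < lam -> even_mode s t w lam h h1 -> positive lam.
Proof. by move=> l0 hm; split => //; exact: (mode_in_spectrum hw hm). Qed.

Lemma no_positive : (s, t) = (Minus, Minus) -> (positive #= `I_0)%card.
Proof.
move=> st; rewrite (_ : positive = set0) ?II0 ?card_eqxx//.
apply/seteqP; split => // lam hl.
apply: (@positive_eigenvalue_bound 1 (fun=> 1) (fun=> lam)) => //.
- by case: st => -> ->; apply: forall3 => // _; exists 0.
- by move=> i j _; rewrite (ord1 i) (ord1 j).
Qed.

Lemma one_positive : (s, t) = (Plus, Minus) \/ (s, t) = (Minus, Plus) -> (positive #= `I_1)%card.
Proof.
move=> st; have [lam [h [h1 [l0 hm]]]] := one_mode hw st.
have pl := mode_positive l0 hm.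
rewrite (_ : positive = [set lam]); first exact: card_set1.
apply/seteqP; split => [nu hnu|_ ->//]; apply: contrapT => /= /eqP ne.
(* The outer component whose coupling is positive; together with the middle one it exhausts the
   pinned components. *)
pose i0 : 'I_3 := if s is Plus then 0 else 2.
apply: (@positive_eigenvalue_bound 2 (fun l => if l == 0 then 1 else i0) (fun l => if l == 0 then lam else nu)).
- by rewrite /pinned /i0; case: st => -[-> ->]; apply: forall3 => //= _; [exists 1|exists 0|exists 0|exists 1].
- move=> i j; case: eqP => [->|i0']; case: eqP => [->|j0'] // e.
  + by rewrite e eqxx in ne.
  + by rewrite e eqxx in ne.
  + have one (l : 'I_2) : l <> 0 -> l = 1.
      by case: l => -[|[|//]] ? nl; [case: nl|]; exact: val_inj.
    by rewrite (one i i0') (one j j0').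
- by move=> l; case: ifP.
Qed.

Lemma two_positive : (s, t) = (Plus, Plus) -> (positive #= `I_2)%card.
Proof.
move=> st; have [la [lb [ab la_pos lb_pos]]] : exists la lb : R, [/\ la < lb, positive la & positive lb].
  move: hw mode_positive; case: st => -> -> hpp mp.
  have [la [h [h1 [lb [h' [h1' [l0 lab ha hb]]]]]]] := two_modes hpp.
  by exists la, lb; split => //; [exact: mp ha|apply: mp hb; exact: lt_trans lab].
apply/eq_cardSP; exists la => //.
rewrite (_ : positive `\ la = [set lb]); first exact: card_set1.
apply/seteqP; split => [nu [hnu /eqP na]|_ ->]; last by split => //; apply/eqP; rewrite gt_eqF.
apply: contrapT => /= /eqP nb.
apply: (@positive_eigenvalue_bound 3 id (fun l => if l == 0 then la else if l == 1 then lb else nu)).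
- by move=> i _; exists i.
- have ab' : la != lb by rewrite lt_eqF.
  apply: forall3; apply: forall3 => //= e; move: ab' na nb; by rewrite ?e ?eqxx // -?e ?eqxx.
- by apply: forall3.
Qed.

End counting.
Theorem theorem5 (R : realType) :
  let b : 'cV[R]_3 := col3 1 (98 / 100) (96 / 100) in
  let c12 (s : sign) : R := signr s * (4 / 100) in
  let c23 (t : sign) : R := signr t * (2 / 100) in
  exists phi : sign -> sign -> R -> 'cV[R]_3,
    let positive_eigenvalues (s t : sign) : set R :=
      positive_point_spectrum b (c12 s) (c23 t) (phi s t) in
    [/\ (forall s t : sign,
          [/\ standing_wave b (c12 s) (c23 t) (phi s t),
              phi s t x @[x --> -oo] --> (0 : 'cV[R]_3) &
              phi s t x @[x --> +oo] --> (const_mx 1 : 'cV[R]_3)]),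
        (positive_eigenvalues Minus Minus #= `I_0)%card,
        (positive_eigenvalues Plus Minus #= `I_1)%card
          /\ (positive_eigenvalues Minus Plus #= `I_1)%card &
        (positive_eigenvalues Plus Plus #= `I_2)%card].
Proof.
move=> b c12 c23.
have /choice[w /choice[w1 hw]] : forall p : sign * sign, exists w w1 : 'I_3 -> R -> R, wave_data p.1 p.2 w w1.
  by move=> p; exact: wave_exists.
exists (fun s t => wave s t (w (s, t))); split.
- move=> s t; have h := hw (s, t).
  by split; [exact: (standing_wave_profile h)|exact: (wave_left h)|exact: (wave_right h)].
- exact: (no_positive (hw (Minus, Minus))).
- split; first by apply: (one_positive (hw (Plus, Minus))); left.
  by apply: (one_positive (hw (Minus, Plus))); right.
- exact: (two_positive (hw (Plus, Plus))).
Qed.
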